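(* Let $N\ge2$, $1^*=\frac N{N-1}$, and $0<\lambda<N-1$. Then the minimum in $$\kappa=\inf_{u\in\dot{BV}(\mathbb{R}^N):\ \int_{\mathbb{R}^N}|u|^{1^*}dx=1}\left(\|Du\|-\lambda\int_{\mathbb{R}^N}\frac{|u|}{|x|}\,dx\right)$$ is attained.
   Context: $\dot{BV}(\mathbb{R}^N)$ is the space of measurable (locally integrable) functions $u:\mathbb{R}^N\to\mathbb{R}$ vanishing at infinity (i.e. $|\{x:|u(x)|>\epsilon\}|<\infty$ for every $\epsilon>0$) such that $$\|Du\|:=\sup_{v\in C_0^\infty(\mathbb{R}^N;\mathbb{R}^N),\ \|v\|_\infty=1}\int_{\mathbb{R}^N}u\,\mathrm{div}\,v\,dx<\infty .$$ Here $C_0^\infty$ means smooth with compact support and $\|v\|_\infty=\sup_x|v(x)|$ with the Euclidean norm. *)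

(* Defs.v *)
From HB Require Import structures.
From mathcomp Require Import all_boot all_order all_algebra.
From mathcomp Require Import all_classical all_reals all_analysis.

Set Implicit Arguments.
Unset Strict Implicit.
Unset Printing Implicit Defensive.

Import Order.TTheory GRing.Theory Num.Theory.
Import numFieldNormedType.Exports.

Local Open Scope classical_set_scope.
Local Open Scope ring_scope.

(* R^n is 'rV[R]_n, with the topology and derivatives of MathComp-Analysis.  It
   carries the product sigma-algebra of the n Borel sigma-algebras, set up like
   the library's instance on n.-tuple T; it is the Borel sigma-algebra of R^n. *)

Definition measure_row_display : measure_display -> measure_display.
Proof. exact. Qed.

Definition row_coord (R : realType) (n : nat) (i : 'I_n) (x : 'rV[R]_n) : R :=
  x ord0 i.

Section measurable_row.
Context (R : realType) (n : nat).

Let row_set0 : g_sigma_preimage (@row_coord R n) set0.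
Proof. exact: sigma_algebra0. Qed.

Let row_setC A : g_sigma_preimage (@row_coord R n) A ->
  g_sigma_preimage (@row_coord R n) (~` A).
Proof. exact: sigma_algebraC. Qed.

Let row_bigcup (F : (set 'rV[R]_n)^nat) :
  (forall i, g_sigma_preimage (@row_coord R n) (F i)) ->
  g_sigma_preimage (@row_coord R n) (\bigcup_i (F i)).
Proof. exact: sigma_algebra_bigcup. Qed.

HB.instance Definition _ := @isMeasurable.Build
  (measure_row_display default_measure_display) ('rV[R]_n)
  (g_sigma_preimage (@row_coord R n)) row_set0 row_setC row_bigcup.

End measurable_row.

Lemma measurable_row_coord (R : realType) (n : nat) (i : 'I_n) :
  measurable_fun setT (@row_coord R n i).
Proof.
move=> _ Y mY; rewrite setTI; apply: sub_sigma_algebra => /=.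
rewrite -bigcup_seq/=; exists i => /=; first by rewrite mem_index_enum.
by exists Y => //; rewrite setTI.
Qed.

Lemma measurable_fun_row (R : realType) d (T : measurableType d) (n : nat)
    (f : T -> 'rV[R]_n) :
  (forall i, measurable_fun setT (fun t => f t ord0 i)) -> measurable_fun setT f.
Proof.
move=> mf; apply: (measurability (\big[setU/set0]_(i < n)
  preimage_set_system setT (@row_coord R n i) measurable)) => //.
rewrite -bigcup_seq => _ [_ [i _ [A mA <-]] <-].
by rewrite !setTI -comp_preimage; have := mf i measurableT _ mA; rewrite setTI.
Qed.

Section row_measure_cons.
Context (R : realType) (n : nat).

(* the identification of R * R^n with R^(n+1) *)
Definition row_cons (p : R * 'rV[R]_n) : 'rV[R]_n.+1 :=
  \row_(i < n.+1) if unlift ord0 i is Some j then p.2 ord0 j else p.1.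

Definition row_uncons (x : 'rV[R]_n.+1) : R * 'rV[R]_n :=
  (x ord0 ord0, \row_(j < n) x ord0 (lift ord0 j)).

Lemma row_consK : cancel row_cons row_uncons.
Proof.
move=> [a x]; rewrite /row_uncons /row_cons; congr pair.
  by rewrite mxE unlift_none.
by apply/rowP => j; rewrite !mxE liftK.
Qed.

Lemma row_unconsK : cancel row_uncons row_cons.
Proof.
move=> x; apply/rowP => i; rewrite mxE.
by case: unliftP => [j ->|->]//=; rewrite mxE.
Qed.

Lemma measurable_row_cons : measurable_fun [set: measurableTypeR R * 'rV[R]_n]
  (row_cons : measurableTypeR R * 'rV[R]_n -> 'rV[R]_n.+1).
Proof.
apply: measurable_fun_row => i.
case: (unliftP ord0 i) => [j ->|->].
  rewrite (_ : (fun _ => _) = @row_coord R n j \o snd); last first.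
    by apply/funext => p; rewrite mxE liftK.
  exact: measurableT_comp (measurable_row_coord j) _.
rewrite (_ : (fun _ => _) = fst); first exact: measurable_fst.
by apply/funext => p; rewrite mxE unlift_none.
Qed.

Lemma measurable_row_uncons : measurable_fun [set: 'rV[R]_n.+1]
  (row_uncons : 'rV[R]_n.+1 -> measurableTypeR R * 'rV[R]_n).
Proof.
apply: measurable_fun_pair; first exact: measurable_row_coord.
apply: measurable_fun_row => i; rewrite (_ : (fun _ => _) = row_coord (lift ord0 i)).
  exact: measurable_row_coord.
by apply/funext => x; rewrite mxE.
Qed.

Variable m : {sigma_finite_measure set 'rV[R]_n -> \bar R}.

Definition row_measure_cons : set 'rV[R]_n.+1 -> \bar R :=
  pushforward (@lebesgue_measure R \x m)%E
    (row_cons : measurableTypeR R * 'rV[R]_n -> 'rV[R]_n.+1).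

Let row_measure_cons0 : row_measure_cons set0 = 0%E.
Proof. by apply: measure0; exact: measurable_row_cons. Qed.

Let row_measure_cons_ge0 A : (0 <= row_measure_cons A)%E.
Proof. by apply: measure_ge0; exact: measurable_row_cons. Qed.

Let row_measure_cons_sigma_additive : semi_sigma_additive row_measure_cons.
Proof.
by apply: measure_semi_sigma_additive; exact: measurable_row_cons.
Qed.

HB.instance Definition _ := isMeasure.Build _ _ _ row_measure_cons
  row_measure_cons0 row_measure_cons_ge0 row_measure_cons_sigma_additive.

Let row_measure_cons_sigma_finite : sigma_finite setT row_measure_cons.
Proof.
have [F FT mF] : sigma_finite setT (@lebesgue_measure R \x m)%E.
  have /sigma_finiteP[F [FT ndF Foo]] := sigma_finiteT (@lebesgue_measure R).
  have /sigma_finiteP[G [GT ndG Goo]] := sigma_finiteT m.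
  exists (fun k => F k `*` G k).
    rewrite -setXTT FT GT predeqE => -[x y]; split.
      move=> [/= [i _ Fix] [j _ Gjy]]; exists (maxn i j) => //; split.
        by move: x Fix; exact/subsetPset/ndF/leq_maxl.
      by move: y Gjy; exact/subsetPset/ndG/leq_maxr.
    by move=> [k _ []/= ? ?]; split; exists k.
  move=> k; have [? ?] := Foo k; have [? ?] := Goo k.
  split; first exact: measurableX.
  by rewrite product_measure1E// lte_mul_pinfty// ge0_fin_numE.
exists (fun k => row_uncons @^-1` F k).
  by rewrite -preimage_bigcup -FT preimage_setT.
move=> k; have [mFk Fk] := mF k; split.
  by rewrite -[X in measurable X]setTI; exact: measurable_row_uncons.
rewrite /row_measure_cons /pushforward -comp_preimage.
rewrite (_ : row_uncons \o row_cons = id) ?preimage_id//.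
by apply/funext => p; exact: row_consK.
Qed.

HB.instance Definition _ := Measure_isSigmaFinite.Build _ _ _ row_measure_cons
  row_measure_cons_sigma_finite.

End row_measure_cons.

Fixpoint lebesgue_row (R : realType) (n : nat) :
    {sigma_finite_measure set 'rV[R]_n -> \bar R} :=
  match n with
  | 0 => [the {sigma_finite_measure set 'rV[R]_0 -> \bar R} of
            dirac (0 : 'rV[R]_0)]
  | n'.+1 => [the {sigma_finite_measure set 'rV[R]_n'.+1 -> \bar R} of
                row_measure_cons (lebesgue_row R n')]
  end.

Lemma lebesgue_row_box (R : realType) (n : nat) (A : 'I_n -> set R) :
  (forall i, measurable (A i)) ->
  lebesgue_row R n [set x | forall i, A i (x ord0 i)] =
  (\prod_(i < n) lebesgue_measure (A i))%E.
Proof.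
elim: n A => [|n IHn] A mA.
  by rewrite big_ord0 /= diracE mem_set//; case.
rewrite big_ord_recl -IHn; last by move=> i; exact: mA.
have mB : measurable [set x : 'rV[R]_n | forall i, A (lift ord0 i) (x ord0 i)].
  rewrite (_ : mkset _ = \big[setI/setT]_(i < n)
    (@row_coord R n i @^-1` A (lift ord0 i))).
    apply: bigsetI_measurable => i _; rewrite -[X in measurable X]setTI.
    exact: measurable_row_coord.
  rewrite -bigcap_seq; apply/seteqP; split => [x xA i _|x xA i]; first exact: xA.
  by apply: xA => /=; rewrite mem_index_enum.
rewrite -product_measure1E//; last exact: mA.
rewrite /= /row_measure_cons /pushforward; congr (product_measure1 _ _ _).
apply/seteqP; split => [[a x]/= h|[a x]/= [h0 h] i].
  split; first by have := h ord0; rewrite mxE unlift_none.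
  by move=> i; have := h (lift ord0 i); rewrite mxE liftK.
by case: (unliftP ord0 i) => [j ->|->]; rewrite mxE ?liftK ?unlift_none.
Qed.

Section dotBV.
Context (R : realType) (N : nat).

Local Notation mu := (lebesgue_row R N).

(* the norm `|x| of the library on 'rV[R]_N is the maximum norm *)
Definition enorm (x : 'rV[R]_N) : R := Num.sqrt (\sum_(i < N) x ord0 i ^+ 2).

Definition partial (i : 'I_N) (v : 'rV[R]_N -> 'rV[R]_N) :
    'rV[R]_N -> 'rV[R]_N :=
  fun x => 'D_(delta_mx ord0 i) v x.

(* the derivative 'D is total, so that differentiability is required separately *)
Definition smooth (v : 'rV[R]_N -> 'rV[R]_N) : Prop :=
  forall s : seq 'I_N, continuous (foldr partial v s) /\
    forall (i : 'I_N) x, derivable (foldr partial v s) x (delta_mx ord0 i).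

Definition compactly_supported (v : 'rV[R]_N -> 'rV[R]_N) : Prop :=
  compact (closure [set x | v x != 0]).

Definition sup_norm (v : 'rV[R]_N -> 'rV[R]_N) : \bar R :=
  ereal_sup [set (enorm (v x))%:E | x in setT].

Definition divergence (v : 'rV[R]_N -> 'rV[R]_N) (x : 'rV[R]_N) : R :=
  \sum_(i < N) partial i v x ord0 i.

Definition bv_seminorm (u : 'rV[R]_N -> R) : \bar R :=
  ereal_sup [set (\int[mu]_x (u x * divergence v x)%:E)%E | v in
    [set v | [/\ smooth v, compactly_supported v & sup_norm v = 1%E]]].

Definition locally_integrable_row (u : 'rV[R]_N -> R) : Prop :=
  forall K : set 'rV[R]_N, compact K -> mu.-integrable K (EFin \o u).

Definition vanishes_at_infinity (u : 'rV[R]_N -> R) : Prop :=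
  forall e : R, 0 < e -> (mu [set x | (e < `|u x|)%R] < +oo)%E.

(* Elements of the space are represented by Borel functions; every Lebesgue
   measurable function is a.e. equal to one. *)
Definition dotBV (u : 'rV[R]_N -> R) : Prop :=
  [/\ measurable_fun setT u, locally_integrable_row u,
      vanishes_at_infinity u & (bv_seminorm u < +oo)%E].

(* 1^* = N / (N - 1) *)
Definition one_star : R := N%:R / (N%:R - 1).

Definition admissible (u : 'rV[R]_N -> R) : Prop :=
  dotBV u /\ (\int[mu]_x (`|u x| `^ one_star)%:E = 1)%E.

(* The value at the null set {0} of the weight is irrelevant.  On dotBV the
   first term is finite, hence no +oo - +oo occurs. *)
Definition hardy_energy (lam : R) (u : 'rV[R]_N -> R) : \bar R :=
  (bv_seminorm u - lam%:E * \int[mu]_x (`|u x| / enorm x)%:E)%E.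

End dotBV.

(* Main.v *)
Require Import Defs.
From HB Require Import structures.
From mathcomp Require Import all_boot all_order all_algebra.
From mathcomp Require Import all_classical all_reals all_analysis.
From mathcomp Require Import measurable_realfun simple_functions ring lra.

Set Implicit Arguments.
Unset Strict Implicit.
Unset Printing Implicit Defensive.

Import Order.TTheory GRing.Theory Num.Theory.
Import numFieldNormedType.Exports.
Import HBSimple.

Local Open Scope classical_set_scope.
Local Open Scope ring_scope.

(** The minimum is attained by the normalised characteristic function of the unit ball;
    this is proved by computing a sharp lower bound of the energy that the ball reaches.

    Write p for N / (N - 1), om for the volume of the unit ball, S for N om^(1/N), and
    Phi(u) for the integral over t > 0 of |{|u| > t}|^(1/p).  Three sharp inequalities hold
    for every admissible u:
      - |Du| >= S Phi(u), the isoperimetric inequality on every superlevel set, integrated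
        over the levels ([isoperimetric_bv]);
      - the integral of |u| / |x| is at most S / (N - 1) Phi(u), because among the sets of a
        given measure the centred ball carries the largest integral of 1 / |x|
        ([hardy_level]);
      - Phi(u) >= 1, because the integral of |u|^(p - 1) over A is at most |A|^(1/p) by
        Hoelder's inequality ([level_integral_ge1]).
    Since lam < N - 1, they give an energy of at least S (1 - lam / (N - 1)) Phi(u), hence of
    at least S (1 - lam / (N - 1)) ([hardy_energy_ge]).  The three are equalities for a
    multiple of the characteristic function of a centred ball, so that the ball attains the
    bound ([ball_minimizer_energy]): neither a compactness argument nor a rearrangement of u
    is needed, since the levels of u enter through their measures only.

    The first inequality is the hard one, because |Du| is given by duality.  For a smooth f
    with bounded derivatives, Brunn-Minkowski applied to a superlevel set and a small ball
    bounds from below the measure of the set where |f| + e |grad f| + O(e^2) exceeds t;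
    integrating over t and letting e tend to 0 replaces the coarea formula
    ([isoperimetric_smooth]).  Brunn-Minkowski itself comes from the Prekopa-Leindler
    inequality, which goes by induction on the dimension, as the measure does.  For a
    general u the inequality is applied to mollifications f of u.  On the one hand the
    integral of |grad f| is at most |Du|: the field grad f / |grad f|, cut off and
    mollified, is admissible in the definition of |Du|, and mollification is self-adjoint
    ([integral_gradient_conv]).  On the other hand the measures of the superlevel sets are
    lower semicontinuous along the mollifications, because the part of u above a small level
    is integrable and is recovered in the mean ([level_mollified_near]).

    For the ball, |D 1_B| <= N om is obtained by integrating by parts against radial
    Lipschitz functions that decrease from 1 to 0 between the spheres of radii 1 and r > 1,
    and letting r tend to 1 ([ramp_divergence_le], [ball_divergence_le]). *)

(** * Affine changes of variables in R^n *)

Lemma integral_row_cons (R : realType) n (f : 'rV[R]_n.+1 -> \bar R) :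
  measurable_fun setT f -> (forall x, 0 <= f x)%E ->
  (\int[lebesgue_row R n.+1]_x f x =
   \int[@lebesgue_measure R]_a \int[lebesgue_row R n]_x f (row_cons (a, x)))%E.
Proof.
move=> mf f0.
rewrite /= /row_measure_cons.
rewrite (ge0_integral_pushforward (@measurable_row_cons R n))//=.
rewrite preimage_setT fubini_tonelli1//.
exact: measurableT_comp mf (@measurable_row_cons R n).
Qed.

Lemma integral_row0 (R : realType) (f : 'rV[R]_0 -> \bar R) :
  measurable_fun setT f -> (\int[lebesgue_row R 0]_x f x = f 0%R)%E.
Proof. by move=> mf; rewrite integral_dirac// diracT mul1e. Qed.

Lemma measurable_affine (R : realType) (c b : R) :
  measurable_fun setT (fun t : measurableTypeR R => c * t + b : measurableTypeR R).
Proof. by apply: measurable_funD => //; apply: measurable_funM. Qed.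

Lemma lebesgue_measure_affine (R : realType) (c b : R) (A : set R) : 0 < c ->
  measurable A ->
  (lebesgue_measure A = c%:E * lebesgue_measure ((fun t => c * t + b)%R @^-1` A))%E.
Proof.
move=> c0 mA.
pose phi : measurableTypeR R -> measurableTypeR R := fun t => c * t + b.
have H := @lebesgue_measure_unique R
  (mscale (NngNum (ltW c0)) (pushforward (@lebesgue_measure R) phi)).
apply: (H (measurable_affine c b) _ A mA) => X [[x y] /= xy <-].
rewrite /mscale/= /pushforward.
have -> : phi @^-1` `]x, y] = `](x - b)/c, (y - b)/c]%classic.
  apply/seteqP; split => t /=; rewrite !in_itv /= /phi ltr_pdivrMr// ler_pdivlMr//
    ltrBlDr lerBrDr (mulrC c)//.
rewrite !lebesgue_measure_itv /= !lte_fin.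
rewrite ltr_pM2r ?invr_gt0// ltrD2r.
case: ifP => _; rewrite ?mule0// -!EFinD -EFinM; congr EFin.
by field; rewrite gt_eqF.
Qed.

Lemma lebesgue_measure_opp (R : realType) (A : set R) : measurable A ->
  (lebesgue_measure A = lebesgue_measure (-%R @^-1` A))%E.
Proof.
move=> mA.
pose phi : measurableTypeR R -> measurableTypeR R := -%R.
have H := @lebesgue_measure_unique R (pushforward (@lebesgue_measure R) phi).
apply: (H (@oppr_measurable R setT) _ A mA) => X [[x y] /= xy <-].
rewrite /pushforward.
have -> : phi @^-1` `]x, y] = `[- y, - x[%classic.
  apply/seteqP; split => t /=; rewrite !in_itv /= /phi ltrNr lerNl andbC//.
rewrite !lebesgue_measure_itv /= !lte_fin.
by rewrite ltrN2; case: ifP => _; rewrite // -!EFinD opprK addrC.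
Qed.

Lemma integral_mscale_eq (R : realType) (c : R) (c0 : 0 <= c)
    (m nu : {measure set (measurableTypeR R) -> \bar R}) (f : R -> \bar R) :
  (forall A, measurable A -> m A = c%:E * nu A)%E ->
  measurable_fun setT f -> (forall x, 0 <= f x)%E ->
  (\int[m]_x f x = c%:E * \int[nu]_x f x)%E.
Proof.
move=> mnu mf f0.
rewrite (@eq_measure_integral _ _ _ _ (mscale (NngNum c0) nu)); last first.
  by move=> A mA _; exact: mnu.
by rewrite ge0_integral_mscale.
Qed.

Lemma integral_affine1 (R : realType) (c b : R) (f : R -> \bar R) : c != 0 ->
  measurable_fun setT f -> (forall x, 0 <= f x)%E ->
  (\int[lebesgue_measure]_x f x =
   `|c|%:E * \int[lebesgue_measure]_t f (c * t + b)%R)%E.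
Proof.
move=> c0 mf f0.
wlog cp : c b f c0 mf f0 / 0 < c.
  move=> H; have [cp|cn] := ltP 0 c; first exact: H.
  have cn' : 0 < - c by rewrite oppr_gt0 lt_neqAle c0.
  have mopp : measurable_fun setT
    (-%R : measurableTypeR R -> measurableTypeR R) by exact: oppr_measurable.
  have mg : measurable_fun setT (fun t : measurableTypeR R => f (c * t + b)).
    exact: measurableT_comp mf (measurable_affine c b).
  have E := ge0_integral_pushforward mopp (@lebesgue_measure R) measurableT mg
    (fun y _ => f0 _).
  rewrite (H (- c) b)//; last by rewrite oppr_eq0.
  rewrite normrN; congr (_ * _)%E.
  rewrite preimage_setT in E.
  transitivity (\int[lebesgue_measure]_x (f (c * - x + b)%R))%E.
    by apply: eq_integral => t _; rewrite mulrN mulNr.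
  rewrite -[LHS]E; apply/esym; rewrite -[RHS]mul1e.
  apply: integral_mscale_eq => //.
  by move=> A mA; rewrite mul1e; exact: lebesgue_measure_opp.
have E := ge0_integral_pushforward (measurable_affine c b) (@lebesgue_measure R)
  measurableT mf (fun y _ => f0 _).
rewrite preimage_setT in E.
rewrite gtr0_norm// -[X in (_ = _ * X)%E]E.
apply: integral_mscale_eq => //; first exact: ltW.
  exact: measurable_affine.
by move=> ? A mA; exact: (lebesgue_measure_affine b cp mA).
Qed.

Lemma row_cons_affine (R : realType) n (c a : R) (b : 'rV[R]_n.+1) (x : 'rV_n) :
  c *: row_cons (a, x) + b =
  row_cons (c * a + (row_uncons b).1, c *: x + (row_uncons b).2).
Proof.
apply/rowP => i; rewrite !mxE; case: unliftP => [j ->|->] /=; rewrite ?liftK ?mxE//.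
Qed.

Lemma measurable_row_affine (R : realType) n (c : R) (b : 'rV[R]_n) :
  measurable_fun setT (fun x : 'rV[R]_n => c *: x + b).
Proof.
apply: measurable_fun_row => i.
rewrite (_ : (fun _ => _) = (fun x : 'rV[R]_n => c * row_coord i x + b ord0 i)).
  by apply: measurable_funD => //; apply: measurable_funM => //;
    exact: measurable_row_coord.
by apply/funext => x; rewrite !mxE.
Qed.

(** The measure is an iterated product, so the formula goes by induction on the dimension
    with Tonelli's theorem, from the uniqueness of Lebesgue measure on the line. *)
Lemma integral_affine (R : realType) n (c : R) (b : 'rV[R]_n)
    (f : 'rV[R]_n -> \bar R) : c != 0 ->
  measurable_fun setT f -> (forall x, 0 <= f x)%E ->
  (\int[lebesgue_row R n]_x f x =
   (`|c| ^+ n)%:E * \int[lebesgue_row R n]_t f (c *: t + b)%R)%E.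
Proof.
move=> c0; elim: n b f => [|n IH] b f mf f0.
  rewrite !integral_row0 ?expr0 ?mul1e//; first by congr f; apply/rowP; case.
  exact: measurableT_comp mf (measurable_row_affine c b).
have mfc a : measurable_fun setT (fun x => f (row_cons (a, x))).
  by apply: measurableT_comp (measurableT_comp mf (@measurable_row_cons R n)) _.
have mF : measurable_fun setT (fun a : measurableTypeR R =>
    \int[lebesgue_row R n]_x f (row_cons (a, x)))%E.
  apply: (@measurable_fun_fubini_tonelli_F _ _ _ _ _ _ (f \o @row_cons R n)).
    exact: measurableT_comp mf (@measurable_row_cons R n).
  by move=> p; exact: f0.
rewrite (integral_row_cons mf f0).
have mg : measurable_fun setT (fun x : 'rV[R]_n.+1 => f (c *: x + b)).
  exact: measurableT_comp mf (measurable_row_affine c b).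
rewrite (integral_row_cons mg)//.
rewrite (integral_affine1 (row_uncons b).1 c0)//; last first.
  by move=> a; apply: integral_ge0 => x _.
rewrite exprS EFinM -muleA; congr (_ * _)%E.
rewrite -ge0_integralZl//=; first last.
- by move=> a _; apply: integral_ge0.
- apply: (@measurable_fun_fubini_tonelli_F _ _ _ _ _ _
    (fun p : measurableTypeR R * 'rV[R]_n => f (c *: row_cons p + b))) => //.
  exact: measurableT_comp mg (@measurable_row_cons R n).
apply: eq_integral => a _.
rewrite (IH (row_uncons b).2)//.
congr (_ * _)%E; apply: eq_integral => x _.
by rewrite row_cons_affine.
Qed.

(** * The Euclidean norm and the Borel sets of R^n *)

Section euclidean_norm.
Context (R : realType) (n : nat).
Implicit Types x y : 'rV[R]_n.

Lemma enorm_ge0 x : 0 <= enorm x.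
Proof. exact: sqrtr_ge0. Qed.

Lemma enorm_sqr x : enorm x ^+ 2 = \sum_(i < n) x ord0 i ^+ 2.
Proof. by rewrite sqr_sqrtr// sumr_ge0// => i _; exact: sqr_ge0. Qed.

Lemma enorm0 : enorm (0 : 'rV[R]_n) = 0.
Proof.
by rewrite /enorm big1 ?sqrtr0// => i _; rewrite mxE expr0n.
Qed.

Lemma enorm_le_sqr x (a : R) : 0 <= a ->
  (enorm x <= a) = (\sum_(i < n) x ord0 i ^+ 2 <= a ^+ 2).
Proof. by move=> a0; rewrite -enorm_sqr ler_pXn2r// nnegrE// enorm_ge0. Qed.

Lemma normr_coord_enorm x i : `|x ord0 i| <= enorm x.
Proof.
rewrite -(@ler_pXn2r _ 2)// ?nnegrE// ?enorm_ge0// enorm_sqr real_normK ?num_real//.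
by rewrite (bigD1 i)//= lerDl sumr_ge0// => j _; exact: sqr_ge0.
Qed.

Lemma cauchy_schwarz x y :
  \sum_(i < n) x ord0 i * y ord0 i <= enorm x * enorm y.
Proof.
have [/eqP|] := eqVneq (enorm x) 0.
  move=> x0; rewrite (eqP x0) mul0r big1// => i _.
  suff -> : x ord0 i = 0 by rewrite mul0r.
  by apply/eqP; rewrite -normr_le0 -(eqP x0) normr_coord_enorm.
have [/eqP|] := eqVneq (enorm y) 0.
  move=> y0 _; rewrite (eqP y0) mulr0 big1// => i _.
  suff -> : y ord0 i = 0 by rewrite mulr0.
  by apply/eqP; rewrite -normr_le0 -(eqP y0) normr_coord_enorm.
move=> y0 x0.
have xp : 0 < enorm x by rewrite lt_def x0 enorm_ge0.
have yp : 0 < enorm y by rewrite lt_def y0 enorm_ge0.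
suff : (\sum_(i < n) x ord0 i * y ord0 i) * 2 <= (enorm x * enorm y) * 2.
  by rewrite ler_pM2r.
(* 2ab <= (s a^2 + b^2/s) with s = |y|/|x| *)
set s := enorm y / enorm x.
have sp : 0 < s by rewrite divr_gt0.
apply: (@le_trans _ _ (\sum_(i < n) (s * x ord0 i ^+ 2 + s^-1 * y ord0 i ^+ 2))).
  rewrite mulr_suml; apply: ler_sum => i _.
  rewrite -subr_ge0.
  rewrite [X in 0 <= X](_ : _ = s^-1 * (s * x ord0 i - y ord0 i) ^+ 2); last first.
    by field; rewrite gt_eqF.
  by apply: mulr_ge0; [rewrite invr_ge0 ltW|exact: sqr_ge0].
rewrite big_split/= -!mulr_sumr -!enorm_sqr /s.
by rewrite le_eqVlt; apply/orP; left; apply/eqP; field; rewrite ?x0 ?y0.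
Qed.

Lemma enormD x y : enorm (x + y) <= enorm x + enorm y.
Proof.
rewrite enorm_le_sqr ?addr_ge0 ?enorm_ge0//.
rewrite sqrrD !enorm_sqr.
rewrite (eq_bigr (fun i => x ord0 i ^+ 2 + (x ord0 i * y ord0 i) *+ 2 + y ord0 i ^+ 2)).
  by rewrite big_split/= big_split/= sumrMnl lerD2r lerD2l lerMn2r/= cauchy_schwarz.
by move=> i _; rewrite mxE sqrrD.
Qed.

Lemma enormZ (c : R) x : enorm (c *: x) = `|c| * enorm x.
Proof.
apply/eqP; rewrite -(@eqrXn2 _ 2)// ?mulr_ge0 ?enorm_ge0//.
rewrite exprMn !enorm_sqr real_normK ?num_real// mulr_sumr.
by apply/eqP/eq_bigr => i _; rewrite mxE exprMn.
Qed.

Lemma enormN x : enorm (- x) = enorm x.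
Proof. by rewrite -scaleN1r enormZ normrN1 mul1r. Qed.

Lemma enorm_le_sum x : enorm x <= \sum_(i < n) `|x ord0 i|.
Proof.
rewrite enorm_le_sqr ?sumr_ge0// expr2 mulr_suml; apply: ler_sum => i _.
rewrite -[leLHS](real_normK (num_real _)) expr2 ler_wpM2l//.
by rewrite (bigD1 i)//= lerDl sumr_ge0.
Qed.

Lemma row_norm_le x (a : R) : 0 <= a ->
  (`|x| <= a) <-> (forall i, `|x ord0 i| <= a).
Proof.
move=> a0; rewrite (_ : `|x| = mx_norm x)// mx_normrE; split.
  by move=> /bigmax_leP[_ h] i; exact: (h (ord0, i)).
by move=> h; apply/bigmax_leP; split=> // -[i j] _ /=; rewrite ord1; exact: h.
Qed.

Lemma normr_coord x i : `|x ord0 i| <= `|x|.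
Proof. by move: i; apply/row_norm_le. Qed.

Lemma norm_le_enorm x : `|x| <= enorm x.
Proof. by apply/row_norm_le; [exact: enorm_ge0|exact: normr_coord_enorm]. Qed.

Lemma enorm_le_norm x : enorm x <= n%:R * `|x|.
Proof.
apply: (le_trans (enorm_le_sum x)).
apply: (@le_trans _ _ (\sum_(i < n) `|x|)); first by apply: ler_sum => i _; exact: normr_coord.
by rewrite sumr_const card_ord mulr_natl.
Qed.

Lemma enorm_eq0 x : enorm x = 0 -> x = 0.
Proof.
move=> x0; apply/rowP => i; rewrite mxE; apply/eqP.
by rewrite -normr_le0 -x0 normr_coord_enorm.
Qed.

Lemma enorm_dist x y : `|enorm x - enorm y| <= enorm (x - y).
Proof.
rewrite ler_norml; apply/andP; split.
  by rewrite lerBrDl lerBlDr addrC -[in leRHS]enormN opprB (le_trans _ (enormD _ _))// subrK.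
by rewrite lerBlDr (le_trans _ (enormD _ _))// subrK.
Qed.

(** The topology of rows is that of the maximum norm, hence coordinatewise closeness is all
    that is ever checked. *)
Lemma nbhs_rowP x (A : set 'rV[R]_n) :
  nbhs x A <-> exists2 e, 0 < e & forall y, (forall i, `|y ord0 i - x ord0 i| < e) -> A y.
Proof.
split.
  move=> /nbhs_ballP[e /= e0 xA]; exists e => // y xy; apply: xA; split => // i j.
  by rewrite ord1 /ball/= distrC.
move=> [e e0 xA]; apply/nbhs_ballP; exists e => //= y [_ xy]; apply: xA => i.
by rewrite distrC; exact: xy.
Qed.

Lemma lipschitz_row_continuous (f : 'rV[R]_n -> R) (C : R) :
  (forall x y, `|f x - f y| <= C * `|x - y|) -> continuous f.
Proof.
move=> fC x A /nbhs_ballP[e /= e0 xA].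
have C0 : 0 < `|C| + 1 by rewrite ltr_wpDl.
apply/nbhs_ballP; exists (e / (`|C| + 1)) => /=; first by rewrite divr_gt0.
move=> y; rewrite mx_norm_ball /ball_/= => xy.
apply: xA; apply: (le_lt_trans (fC _ _)).
apply: (@le_lt_trans _ _ ((`|C| + 1) * `|x - y|)).
  by rewrite ler_wpM2r// (le_trans (ler_norm _))// lerDl.
by rewrite mulrC -ltr_pdivlMr.
Qed.

Lemma enorm_continuous : continuous (@enorm R n).
Proof.
apply: (@lipschitz_row_continuous _ n%:R) => x y.
exact: (le_trans (enorm_dist x y) (enorm_le_norm _)).
Qed.

End euclidean_norm.

Section borel_row.
Context (R : realType) (n : nat).

Lemma measurable_row_set (A : 'I_n -> set R) : (forall i, measurable (A i)) ->
  measurable [set x : 'rV[R]_n | forall i, A i (x ord0 i)].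
Proof.
move=> mA; rewrite (_ : mkset _ = \big[setI/setT]_(i < n)
    (@row_coord R n i @^-1` A i)).
  apply: bigsetI_measurable => i _; rewrite -[X in measurable X]setTI.
  exact: measurable_row_coord.
rewrite -bigcap_seq; apply/seteqP; split => [x xA i _|x xA i]; first exact: xA.
by apply: xA => /=; rewrite mem_index_enum.
Qed.

(** The sigma-algebra is the product one; an open set is the union of the countably many
    cubes of rational centre and size 1 / (k + 1) that it contains. *)
Lemma open_measurable_row (U : set 'rV[R]_n) : open U -> measurable U.
Proof.
move=> oU.
pose q (p : {ffun 'I_n -> rat}) : 'rV[R]_n := \row_i (ratr (p i)).
pose B (p : {ffun 'I_n -> rat}) (k : nat) :=
  [set x : 'rV[R]_n | forall i, `|x ord0 i - q p ord0 i| < k.+1%:R^-1].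
(* the rational cubes are enumerated by their codes; those not inside U are dropped *)
pose F (m : nat) : set 'rV[R]_n :=
  if unpickle m is Some pk then
    (if `[< B (pk : {ffun 'I_n -> rat} * nat).1 pk.2 `<=` U >] then B pk.1 pk.2 else set0)
  else set0.
rewrite (_ : U = \bigcup_m F m).
  apply: bigcup_measurable => m _; rewrite /F; case: unpickle => // -[p k].
  case: ifP => // _.
  apply: (@measurable_row_set (fun i => [set t | `|t - q p ord0 i| < k.+1%:R^-1])) => i.
  apply: open_measurable.
  rewrite (_ : mkset _ = ball (q p ord0 i) k.+1%:R^-1); first exact: ball_open.
  by apply/seteqP; split => t /=; rewrite /ball/= distrC.
apply/seteqP; split => x; last first.
  by move=> [m _]; rewrite /F; case: unpickle => // -[p k]; case: ifP => // /asboolP; apply.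
move=> Ux; have /nbhs_rowP[e e0 xU] : nbhs x U by exact: open_nbhs_nbhs.
have [k ke] : exists k, k.+1%:R^-1 < e / 2.
  have [k] := ltr_add_invr (divr_gt0 e0 (ltr0Sn _ 1)); rewrite add0r; by exists k.
have k0 : 0 < k.+1%:R^-1 :> R by rewrite invr_gt0.
have /choice[p xp] : forall i, exists r : rat, `|x ord0 i - ratr r| < k.+1%:R^-1.
  move=> i; have [r] := rat_in_itvoo (etrans (ltrDl (x ord0 i) k.+1%:R^-1) k0).
  rewrite in_itv/= => /andP[h1 h2]; exists r.
  by rewrite distrC gtr0_norm ?subr_gt0// ltrBlDl.
exists (pickle ([ffun i => p i] : {ffun 'I_n -> rat}, k)) => //.
rewrite /F pickleK /=; case: ifPn => [_ i|/asboolPn h]; first by rewrite mxE ffunE.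
exfalso; apply: h => y By; apply: xU => i.
have := By i; rewrite mxE ffunE => yi.
rewrite -(subrKA (ratr (p i))) (le_lt_trans (ler_normD _ _))//.
rewrite [ltRHS]splitr ltrD//; first exact: lt_trans yi ke.
by rewrite distrC (lt_trans (xp i)).
Qed.

Lemma continuous_measurable_row (f : 'rV[R]_n -> R) : continuous f ->
  measurable_fun setT f.
Proof.
move=> cf; apply: (measurability _ (RGenOpens.measurableE R)).
move=> _ [_ [a [b ->]] <-]; rewrite setTI; apply: open_measurable_row.
by apply: open_comp => // x _; exact: cf.
Qed.

End borel_row.

(** * Cubes and Euclidean balls *)

Section row_measure.
Context (R : realType) (n : nat).
Local Notation mu := (lebesgue_row R n).

Lemma integral_translate (b : 'rV[R]_n) (f : 'rV[R]_n -> \bar R) :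
  measurable_fun setT f -> (forall x, 0 <= f x)%E ->
  (\int[mu]_x f (x + b)%R = \int[mu]_x f x)%E.
Proof.
move=> mf f0; rewrite [RHS](integral_affine b (oner_neq0 R))// normr1 expr1n mul1e.
by apply: eq_integral => x _; rewrite scale1r.
Qed.

Lemma integral_reflect (b : 'rV[R]_n) (f : 'rV[R]_n -> \bar R) :
  measurable_fun setT f -> (forall x, 0 <= f x)%E ->
  (\int[mu]_x f (b - x)%R = \int[mu]_x f x)%E.
Proof.
move=> mf f0; rewrite [RHS](@integral_affine _ _ (- 1) b)// ?oppr_eq0 ?oner_eq0//.
rewrite normrN1 expr1n mul1e.
by apply: eq_integral => x _; rewrite scaleN1r addrC.
Qed.

Lemma measure_row_affine (c : R) (b : 'rV[R]_n) (A : set 'rV[R]_n) : c != 0 ->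
  measurable A ->
  (mu A = (`|c| ^+ n)%:E * mu ((fun x => c *: x + b)%R @^-1` A))%E.
Proof.
move=> c0 mA.
have mB : measurable ((fun x => c *: x + b)%R @^-1` A).
  by rewrite -[X in measurable X]setTI; apply: measurable_row_affine.
transitivity (\int[mu]_x (\1_A x)%:E)%E; first by rewrite integral_indic// setIT.
rewrite (integral_affine b c0)//; last first.
  by apply/measurable_EFinP; exact: measurable_indic.
congr (_ * _)%E; rewrite -[in RHS](setIT (_ @^-1` _)) -integral_indic//.
Qed.

Lemma measure_row_scale (c : R) (A : set 'rV[R]_n) : 0 < c -> measurable A ->
  (mu [set c *: x | x in A] = (c ^+ n)%:E * mu A)%E.
Proof.
move=> c0 mA; have cn0 : c != 0 by rewrite gt_eqF.
have -> : [set c *: x | x in A] = (fun x => c^-1 *: x + 0) @^-1` A.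
  apply/seteqP; split => [_ /= [x Ax <-]|x /= Ax].
    by rewrite addr0 scalerA mulVf// scale1r.
  by exists (c^-1 *: x + 0) => //; rewrite addr0 scalerA divff// scale1r.
have mB : measurable ((fun x : 'rV[R]_n => c^-1 *: x + 0)%R @^-1` A).
  by rewrite -[X in measurable X]setTI; apply: measurable_row_affine.
rewrite (measure_row_affine 0 cn0 mB) gtr0_norm//; congr (_ * mu _)%E.
by apply/seteqP; split => x /=; rewrite !addr0 scalerA mulVf// scale1r.
Qed.

Definition cube (M : R) : set 'rV[R]_n := [set x | forall i, `[- M, M]%classic (x ord0 i)].

Lemma cubeP (M : R) x : cube M x <-> (forall i, `|x ord0 i| <= M).
Proof. by split=> h i; have := h i; rewrite /= in_itv/= ler_norml. Qed.

Lemma measurable_cube M : measurable (cube M).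
Proof. exact: (@measurable_row_set _ _ (fun=> `[- M, M]%classic)). Qed.

Lemma measure_cube_lty M : (mu (cube M) < +oo)%E.
Proof.
rewrite /cube (lebesgue_row_box (A := fun=> `[- M, M]%classic))//.
rewrite lebesgue_measure_itv/=; case: ifPn => _.
  by rewrite -EFinD prodEFin ltry.
case: n => [|k]; first by rewrite big_ord0 ltry.
by rewrite big_ord_recl mul0e.
Qed.

Lemma compact_cube M : compact (cube M).
Proof.
by apply: (@rV_compact _ _ (fun=> `[- M, M]%classic)) => _; exact: segment_compact.
Qed.

(** Euclidean balls, as opposed to the balls of the maximum norm of rows. *)
Definition eball (r : R) : set 'rV[R]_n := [set x | enorm x < r].

Lemma measurable_enorm : measurable_fun setT (@enorm R n).
Proof. by apply: continuous_measurable_row; exact: enorm_continuous. Qed.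

Lemma measurable_eball r : measurable (eball r).
Proof.
rewrite (_ : eball r = setT `&` @enorm R n @^-1` `]-oo, r[%classic).
  by apply: measurable_enorm.
by apply/seteqP; split => x /=; rewrite in_itv/=; [split|case].
Qed.

Lemma measurable_eclosed r : measurable [set x : 'rV[R]_n | enorm x <= r].
Proof.
rewrite (_ : mkset _ = setT `&` @enorm R n @^-1` `]-oo, r]%classic).
  by apply: measurable_enorm.
by apply/seteqP; split => x /=; rewrite in_itv/=; [split|case].
Qed.

Lemma measure_eball_lty r : (mu (eball r) < +oo)%E.
Proof.
apply: le_lt_trans (measure_cube_lty r); apply: le_measure; rewrite ?inE.
- exact: measurable_eball.
- exact: measurable_cube.
- move=> x /= xr; apply/cubeP => i.
  exact: le_trans (normr_coord_enorm x i) (ltW xr).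
Qed.

Definition ball_volume : R := fine (mu (eball 1)).

Lemma ball_volumeE : mu (eball 1) = ball_volume%:E.
Proof. by rewrite fineK// ge0_fin_numE// measure_eball_lty. Qed.

Lemma ball_volume_gt0 : 0 < ball_volume.
Proof.
rewrite -lte_fin -ball_volumeE.
have e0 : 0 < n.+1%:R^-1 :> R by rewrite invr_gt0.
apply: (@lt_le_trans _ _ (mu [set x : 'rV[R]_n | forall i, `]- n.+1%:R^-1, n.+1%:R^-1[%classic (x ord0 i)])).
  rewrite (lebesgue_row_box (A := fun=> `]- n.+1%:R^-1, n.+1%:R^-1[%classic))//.
  rewrite lebesgue_measure_itv/= lte_fin gtrN// -EFinD prodEFin lte_fin.
  by apply: prodr_gt0 => i _; rewrite opprK addr_gt0.
apply: le_measure; rewrite ?inE.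
- exact: (@measurable_row_set _ _ (fun=> `]- n.+1%:R^-1, n.+1%:R^-1[%classic)).
- exact: measurable_eball.
- move=> x /= xi; apply: le_lt_trans (enorm_le_norm x) _.
  apply: (@le_lt_trans _ _ (n%:R * n.+1%:R^-1)).
    rewrite ler_wpM2l//; apply/row_norm_le; first exact: ltW.
    by move=> i; have := xi i; rewrite in_itv/= -ltr_norml => /ltW.
  by rewrite ltr_pdivrMr// mul1r ltr_nat.
Qed.

Lemma measure_eball r : 0 < r -> mu (eball r) = (r ^+ n * ball_volume)%:E.
Proof.
move=> r0; rewrite EFinM -ball_volumeE -measure_row_scale//; last exact: measurable_eball.
congr (mu _); apply/seteqP; split => [x /= xr|_ /= [x x1 <-]].
  exists (r^-1 *: x); last by rewrite scalerA divff ?scale1r// gt_eqF.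
  by rewrite /= /eball/= enormZ gtr0_norm ?invr_gt0// mulrC ltr_pdivrMr// mul1r.
by rewrite /eball/= enormZ gtr0_norm// -ltr_pdivlMl// mulVf// gt_eqF.
Qed.

(** A closed ball lies in every larger open ball, and the volume of these is continuous in
    the radius.  Spheres are therefore null. *)
Lemma measure_eclosed r : 0 < r ->
  mu [set x | enorm x <= r] = (r ^+ n * ball_volume)%:E.
Proof.
move=> r0; apply/eqP; rewrite eq_le; apply/andP; split; last first.
  rewrite -measure_eball//; apply: le_measure; rewrite ?inE.
  - exact: measurable_eball.
  - exact: measurable_eclosed.
  - by move=> x /ltW.
have H s : r < s -> (mu [set x : 'rV[R]_n | (enorm x <= r)%R] <= (s ^+ n * ball_volume)%:E)%E.
  move=> rs; rewrite -measure_eball; last exact: lt_trans rs.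
  apply: le_measure; rewrite ?inE.
  - exact: measurable_eclosed.
  - exact: measurable_eball.
  - by move=> x /= xr; exact: le_lt_trans xr rs.
have fin : mu [set x : 'rV[R]_n | enorm x <= r] \is a fin_num.
  rewrite ge0_fin_numE//; apply: le_lt_trans (H (r + 1) _) _; last exact: ltry.
  by rewrite ltrDl.
rewrite -(fineK fin) lee_fin.
have cvs : (s ^+ n * ball_volume) @[s --> r^'+] --> r ^+ n * ball_volume.
  apply: cvg_at_right_filter; apply: cvgM; last exact: cvg_cst.
  exact: exprn_continuous.
apply: (cvgr_to_ge cvs).
near=> s; rewrite -lee_fin fineK//; apply: H; near: s; exact: nbhs_right_gt.
Unshelve. all: by end_near. Qed.

Lemma measure_sphere r : 0 < r -> mu [set x | enorm x = r] = 0%E.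
Proof.
move=> r0.
have -> : [set x : 'rV[R]_n | enorm x = r] = [set x | enorm x <= r] `\` eball r.
  apply/seteqP; split => x /=.
    by move=> xr; rewrite /eball/= xr ltxx; split.
  by move=> [xr /negP]; rewrite -leNgt => rx; apply/eqP; rewrite eq_le xr.
have mc := measurable_eclosed r; have mb := measurable_eball r.
have fin : (mu [set x : 'rV[R]_n | (enorm x <= r)%R] < +oo)%E.
  by rewrite measure_eclosed// ltry.
rewrite (measureD mc mb fin).
rewrite setIidr; last by move=> x /ltW.
by rewrite [X in (X - _)%E](measure_eclosed r0) [X in (_ - X)%E](measure_eball r0) subee.
Qed.

Lemma measure_row_origin : (0 < n)%N -> mu [set 0 : 'rV[R]_n] = 0%E.
Proof.
move=> n0.
have -> : [set 0 : 'rV[R]_n] = [set x | forall i, [set 0 : R] (x ord0 i)].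
  apply/seteqP; split => [x ->|x /= xi]; first by move=> i; rewrite /= mxE.
  by apply/rowP => i; rewrite mxE; exact: xi.
rewrite (lebesgue_row_box (A := fun=> [set 0]))//.
by rewrite (bigD1 (Ordinal n0))//= lebesgue_measure_set1 mul0e.
Qed.

End row_measure.

(** * Layer cake formulas *)

Lemma indic_bool (R : pzRingType) T (p : T -> bool) x :
  \1_[set y | p y] x = (p x)%:R :> R.
Proof.
rewrite indicE; case E : (p x); first by rewrite mem_set//= E.
by rewrite memNset//= E.
Qed.

Section layer_cake.
Context (R : realType) d (T : measurableType d)
  (m : {sigma_finite_measure set T -> \bar R}).
Variables (f : T -> R) (g : T -> \bar R).
Hypotheses (mf : measurable_fun setT f) (f0 : forall x, 0 <= f x).
Hypotheses (mg : measurable_fun setT g) (g0 : forall x, (0 <= g x)%E).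

Let F (p : T * measurableTypeR R) : \bar R :=
  (g p.1 * (\1_[set q : T * measurableTypeR R | (q.2 < f q.1)%R] p)%:E)%E.

Let measurable_hypograph :
  measurable [set q : T * measurableTypeR R | (q.2 < f q.1)%R].
Proof.
rewrite (_ : mkset _ = setT `&` (fun q : T * measurableTypeR R =>
    f q.1 - q.2) @^-1` `]0, +oo[%classic).
  apply: (measurable_funB (measurableT_comp mf measurable_fst) measurable_snd) => //.
by apply/seteqP; split => q /=; rewrite in_itv/= andbT subr_gt0; [split|case].
Qed.

Let F0 p : (0 <= F p)%E.
Proof. by rewrite mule_ge0// lee_fin. Qed.

Let mF : measurable_fun setT F.
Proof.
apply: emeasurable_funM; first exact: measurableT_comp mg measurable_fst.
by apply/measurable_EFinP; exact: measurable_indic.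
Qed.

Let FE t : (\int[m]_x F (x, t) = \int[m]_(x in [set x | (t < f x)%R]) g x)%E.
Proof.
rewrite [RHS]integral_mkcond; apply: eq_integral => x _.
rewrite /F /patch indicE /=; case: (ltP t (f x)) => h.
  by rewrite !mem_set ?mule1.
by rewrite !memNset ?mule0//=; apply/negP; rewrite -leNgt.
Qed.

Lemma measurable_layer : measurable_fun setT
  (fun t : measurableTypeR R => \int[m]_(x in [set x | (t < f x)%R]) g x)%E.
Proof.
rewrite (_ : (fun _ => _) = (fun t => \int[m]_x F (x, t))%E).
  exact: measurable_fun_fubini_tonelli_G.
by apply/funext => t; rewrite FE.
Qed.

(** Tonelli's theorem on the region below the graph of f.  The weight g serves twice: as
    1 / |x| in Hardy's inequality and as |w|^(p - 1) in the normalisation. *)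
Lemma layer_cake_weighted :
  (\int[m]_x (g x * (f x)%:E) =
   \int[lebesgue_measure]_(t in `[0%R, +oo[)
     \int[m]_(x in [set x | (t < f x)%R]) g x)%E.
Proof.
pose H (p : T * measurableTypeR R) : \bar R := (F p * (\1_[set t : R | 0 <= t] p.2)%:E)%E.
have H0 p : (0 <= H p)%E by rewrite mule_ge0// lee_fin.
have m0 : measurable [set t : measurableTypeR R | 0 <= t].
  by rewrite -(set_itvcy (0 : R)).
have mH : measurable_fun setT H.
  apply: emeasurable_funM => //; apply/measurable_EFinP.
  exact: (measurableT_comp (measurable_indic m0) measurable_snd).
have := @fubini_tonelli _ _ _ _ _ m (@lebesgue_measure R) H mH H0.
rewrite /fubini_F /fubini_G => E.
transitivity (\int[m]_x \int[lebesgue_measure]_t H (x, t))%E.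
  apply: eq_integral => x _.
  rewrite (_ : (fun t => _) = (fun t : measurableTypeR R =>
      g x * (\1_(`[0%R, f x[%classic) t)%:E)%E); last first.
    apply/funext => t; rewrite /H /F/= -muleA; congr (_ * _)%E.
    rewrite -EFinM !indic_bool/= in_itv/= -natrM mulnb.
    by rewrite andbC.
  rewrite ge0_integralZl//; last first.
    by apply/measurable_EFinP; exact: measurable_indic.
  rewrite integral_indic// setIT [X in _ = (_ * X)%E]lebesgue_measure_itv/= lte_fin.
  by case: ltP => [_|fx]; rewrite ?sube0//;
    have -> : f x = 0 by apply/eqP; rewrite eq_le fx f0.
rewrite E [RHS]integral_mkcond; apply: eq_integral => t _.
rewrite /patch mem_setE/= in_itv/= andbT -FE /H/= indic_bool.
by case: ifP => _; under eq_integral do rewrite ?mule1 ?mule0//; rewrite ?integral0.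
Qed.

End layer_cake.

Lemma layer_cake (R : realType) d (T : measurableType d)
    (m : {sigma_finite_measure set T -> \bar R}) (f : T -> R) :
  measurable_fun setT f -> (forall x, 0 <= f x) ->
  (\int[m]_x (f x)%:E =
   \int[lebesgue_measure]_(t in `[0%R, +oo[) m [set x | (t < f x)%R])%E.
Proof.
move=> mf f0.
have mS t : measurable [set x | t < f x].
  rewrite (_ : mkset _ = setT `&` f @^-1` `]t, +oo[%classic); first exact: mf.
  by apply/seteqP; split => x /=; rewrite in_itv/= andbT; [split|case].
transitivity (\int[m]_x (cst 1%E x * (f x)%:E))%E.
  by apply: eq_integral => x _; rewrite mul1e.
rewrite layer_cake_weighted//; apply: eq_integral => t _.
by rewrite integral_cst// mul1e.
Qed.

(** * The Prekopa-Leindler and Brunn-Minkowski inequalities *)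

Lemma powR_amgm (R : realType) (s u v : R) : 0 < s < 1 -> 0 <= u -> 0 <= v ->
  u `^ s * v `^ (1 - s) <= s * u + (1 - s) * v.
Proof.
move=> /andP[s0 s1] u0 v0.
have t0 : 0 < 1 - s by rewrite subr_gt0.
have := @conjugate_powR _ (u `^ s) (v `^ (1 - s)) s^-1 (1 - s)^-1 (powR_ge0 _ _)
  (powR_ge0 _ _).
rewrite !invr_gt0 !invrK => /(_ s0 t0); rewrite addrC subrK => /(_ erefl).
by rewrite -!powRrM !divff ?gt_eqF// !powRr1// (mulrC s) (mulrC (1 - s) v).
Qed.

Lemma lebesgue_measure_shift (R : realType) (b : R) (A : set R) : measurable A ->
  lebesgue_measure [set x + b | x in A] = lebesgue_measure A :> \bar R.
Proof.
move=> mA; rewrite (_ : [set x + b | x in A] = (fun t => 1 * t - b) @^-1` A).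
  by rewrite [RHS](lebesgue_measure_affine (- b) ltr01 mA) mul1e.
apply/seteqP; split => [_ /= [x Ax <-]|x /= Ax]; first by rewrite mul1r addrK.
by exists (1 * x - b) => //; rewrite mul1r subrK.
Qed.

Lemma measurable_shift_set (R : realType) (b : R) (A : set R) : measurable A ->
  measurable [set x + b | x in A].
Proof.
move=> mA; rewrite (_ : [set x + b | x in A] = (fun t => 1 * t - b) @^-1` A).
  by rewrite -[X in measurable X]setTI; apply: (measurable_affine 1 (- b)).
apply/seteqP; split => [_ /= [x Ax <-]|x /= Ax]; first by rewrite mul1r addrK.
by exists (1 * x - b) => //; rewrite mul1r subrK.
Qed.

Lemma extremal_sum (R : realType) (x y k l : R) :
  x <= k -> l <= y -> y + k = x + l -> x + l = k + l.
Proof. by move=> *; lra. Qed.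

(** For compact K and L, the translates K + min L and L + max K lie in K + L and meet in the
    single point max K + min L, which is null; inner regularity reduces the general case to
    this one. *)
Lemma brunn_minkowski1_sum (R : realType) (A B C : set R) :
  measurable A -> measurable B -> measurable C -> A !=set0 -> B !=set0 ->
  (forall x y, A x -> B y -> C (x + y)) ->
  (lebesgue_measure A + lebesgue_measure B <= lebesgue_measure C :> \bar R)%E.
Proof.
move=> mA mB mC [a Aa] [b Bb] ABC.
have lA : (lebesgue_measure A <= lebesgue_measure C :> \bar R)%E.
  rewrite -(lebesgue_measure_shift b mA); apply: le_measure; rewrite ?inE//.
    exact: measurable_shift_set.
  by move=> _ [x Ax <-]; exact: ABC.
have lB : (lebesgue_measure B <= lebesgue_measure C :> \bar R)%E.
  rewrite -(lebesgue_measure_shift a mB); apply: le_measure; rewrite ?inE//.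
    exact: measurable_shift_set.
  by move=> _ [x Bx <-]; rewrite addrC; exact: ABC.
have [->|Cfin] := eqVneq (lebesgue_measure C : \bar R) +oo%E; first exact: leey.
have Coo : (lebesgue_measure C < +oo :> \bar R)%E by rewrite ltey.
have Aoo := le_lt_trans lA Coo; have Boo := le_lt_trans lB Coo.
have [A0|Apos] := eqVneq (lebesgue_measure A : \bar R) 0%E; first by rewrite A0 add0e.
have [B0|Bpos] := eqVneq (lebesgue_measure B : \bar R) 0%E; first by rewrite B0 adde0.
have {}Apos : (0 < lebesgue_measure A :> \bar R)%E by rewrite lt0e Apos measure_ge0.
have {}Bpos : (0 < lebesgue_measure B :> \bar R)%E by rewrite lt0e Bpos measure_ge0.
have Afin : (lebesgue_measure A : \bar R) \is a fin_num by rewrite ge0_fin_numE.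
have Bfin : (lebesgue_measure B : \bar R) \is a fin_num by rewrite ge0_fin_numE.
have inner (D : set R) e : measurable D -> (0 < lebesgue_measure D :> \bar R)%E ->
    (lebesgue_measure D < +oo :> \bar R)%E -> 0 < e ->
    exists K, [/\ compact K, K `<=` D, K !=set0 &
      (lebesgue_measure D <= lebesgue_measure K + e%:E :> \bar R)%E].
  move=> mD Dpos Doo e0.
  have Dfin : (lebesgue_measure D : \bar R) \is a fin_num by rewrite ge0_fin_numE.
  have fD : 0 < fine (lebesgue_measure D : \bar R) by rewrite fine_gt0// Dpos.
  have e'0 : 0 < Num.min e (fine (lebesgue_measure D : \bar R)).
    by rewrite lt_min e0.
  have [K [cK KD KDe]] := lebesgue_regularity_inner mD Doo e'0.
  have mK : measurable K by exact: compact_measurable.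
  have DE : (lebesgue_measure D = lebesgue_measure K + lebesgue_measure (D `\` K) :> \bar R)%E.
    rewrite -measureU//; [|exact: measurableD|by rewrite setDIK].
    by rewrite setDUK.
  exists K; split => //.
    apply/set0P/eqP => K0; move: KDe; rewrite K0 setD0 => h.
    suff : (lebesgue_measure D < lebesgue_measure D :> \bar R)%E by rewrite ltxx.
    by apply: lt_le_trans h _; rewrite -[leRHS](fineK Dfin) lee_fin ge_min lexx orbT.
  rewrite DE leeD2l// (le_trans (ltW KDe))// lee_fin ge_min lexx//.
apply/lee_addgt0Pr => e e0.
have e20 : 0 < e / 2 by rewrite divr_gt0.
have [K [cK KA K0 Ke]] := inner A _ mA Apos Aoo e20.
have [L [cL LB L0 Le]] := inner B _ mB Bpos Boo e20.
have cid : forall D : set R, {within D, continuous (@idfun R)}.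
  by move=> D; apply: continuous_subspaceT => x; exact: cvg_id.
have [k Kk kmax] := compact_EVT_max K0 cK (cid K).
have [l Ll lmin] := compact_EVT_min L0 cL (cid L).
rewrite inE in Kk; rewrite inE in Ll.
have mK : measurable K by exact: compact_measurable.
have mL : measurable L by exact: compact_measurable.
(* K' and L' lie in K + L and meet at k + l only *)
pose K' := [set x + l | x in K]; pose L' := [set x + k | x in L].
have mK' : measurable K' by exact: measurable_shift_set.
have mL' : measurable L' by exact: measurable_shift_set.
pose P : set R := [set k + l].
have ml : measurable P by exact: measurable_set1.
have KLC : (lebesgue_measure K + lebesgue_measure L <= lebesgue_measure C :> \bar R)%E.
  have LE : (lebesgue_measure L = lebesgue_measure (L' `\` P) :> \bar R)%E.
    rewrite -(lebesgue_measure_shift k mL) -/L'.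
    have := @measureDI _ _ _ (@lebesgue_measure R) L' P mL' ml.
    move=> E; rewrite [LHS]E [X in (_ + X)%E](_ : _ = 0%E) ?adde0//.
    apply/eqP; rewrite eq_le measure_ge0 andbT.
    rewrite -(lebesgue_measure_set1 (k + l)).
    by apply: le_measure; rewrite ?inE//; exact: measurableI.
  rewrite LE -(lebesgue_measure_shift l mK) -/K'.
  rewrite -[leLHS](@measureU _ _ _ (@lebesgue_measure R))//; last 2 first.
    exact: measurableD.
    apply/seteqP; split => // _ [[x Kx <-]] [[y Ly /= yE] /= ne]; apply: ne.
    have := kmax x; rewrite inE => /(_ Kx) xk.
    have := lmin y; rewrite inE => /(_ Ly) ly.
    by rewrite /P/=; exact: (@extremal_sum R _ _ _ _ xk ly yE).
  apply: le_measure; rewrite ?inE//.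
    by apply: measurableU => //; exact: measurableD.
  move=> _ [[x Kx <-]|[[y Ly <-] _]]; first by apply: ABC; [exact: KA|exact: LB].
  by rewrite addrC; apply: ABC; [exact: KA|exact: LB].
apply: (@le_trans _ _ ((lebesgue_measure K + (e / 2)%:E) + (lebesgue_measure L + (e / 2)%:E))%E).
  exact: leeD.
by rewrite addeACA -EFinD -splitr leeD2r.
Qed.

(** Stated with an arbitrary measurable C containing the combination of A and B, since that
    combination need not be measurable. *)
Lemma brunn_minkowski1 (R : realType) (s : R) (A B C : set R) : 0 < s < 1 ->
  measurable A -> measurable B -> measurable C -> A !=set0 -> B !=set0 ->
  (forall x y, A x -> B y -> C (s * x + (1 - s) * y)) ->
  (s%:E * lebesgue_measure A + (1 - s)%:E * lebesgue_measure B <=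
   lebesgue_measure C :> \bar R)%E.
Proof.
move=> /andP[s0 s1] mA mB mC [a Aa] [b Bb] ABC.
have t0 : 0 < 1 - s by rewrite subr_gt0.
have dilate (c : R) (D : set R) : 0 < c -> measurable D ->
    measurable ((fun t => c^-1 * t + 0) @^-1` D) /\
    (c%:E * lebesgue_measure D =
     lebesgue_measure ((fun t => c^-1 * t + 0)%R @^-1` D) :> \bar R)%E.
  move=> c0 mD; have ci0 : 0 < c^-1 by rewrite invr_gt0.
  split; first by rewrite -[X in measurable X]setTI; apply: (measurable_affine c^-1 0).
  rewrite (lebesgue_measure_affine 0 ci0 mD) muleA -EFinM divff ?mul1e//.
  by rewrite gt_eqF.
have [mA' ->] := dilate s A s0 mA; have [mB' ->] := dilate (1 - s) B t0 mB.
apply: brunn_minkowski1_sum => //.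
- by exists (s * a); rewrite /= addr0 mulrA mulVf ?mul1r// gt_eqF.
- by exists ((1 - s) * b); rewrite /= addr0 mulrA mulVf ?mul1r// gt_eqF.
- move=> x y /= Ax By; have := ABC _ _ Ax By.
  by rewrite !addr0 !mulrA !divff ?mul1r// gt_eqF.
Qed.

(** The hypothesis of the Prekopa-Leindler inequality,
    f(x)^s g(y)^(1 - s) <= h(comb x y), is stated through real lower bounds of f(x) and g(y):
    f, g and h take the value +oo when they are themselves integrals of slices.  With a
    trivial comb it is the conclusion of the inequality as well. *)
Definition log_convex_below (R : realType) (V : Type) (comb : V -> V -> V) (s : R)
    (f g h : V -> \bar R) :=
  forall x y (a b : R), 0 <= a -> 0 <= b -> (a%:E <= f x)%E -> (b%:E <= g y)%E ->
    ((a `^ s * b `^ (1 - s))%:E <= h (comb x y))%E.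

Section prekopa_leindler_line.
Context (R : realType) (s : R) (s01 : 0 < s < 1).
Local Notation leb := (@lebesgue_measure R).
Local Notation comb := (fun x y : R => s * x + (1 - s) * y).

Let s0 : 0 < s. Proof. by case/andP: s01. Qed.
Let t0 : 0 < 1 - s. Proof. by rewrite subr_gt0; case/andP: s01. Qed.

Lemma measurable_superlevel d (T : measurableType d) (f : T -> R) (t : R) :
  measurable_fun setT f -> measurable [set x | t < f x].
Proof.
move=> mf; rewrite (_ : mkset _ = setT `&` f @^-1` `]t, +oo[%classic); first exact: mf.
by apply/seteqP; split => x /=; rewrite in_itv/= andbT; [split|case].
Qed.

(** After division of f and g by their suprema, the superlevel sets of both are nonempty
    for all levels below 1, and the one-dimensional Brunn-Minkowski inequality compares them
    with those of h; the integrals then satisfy a linear inequality, which is stronger than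
    the geometric one by [powR_amgm]. *)
Lemma prekopa_leindler_bounded (f g : R -> R) (h : R -> \bar R) (k : R) :
  measurable_fun setT f -> measurable_fun setT g -> measurable_fun setT h ->
  (forall x, 0 <= f x <= k) -> (forall x, 0 <= g x <= k) -> (forall x, 0 <= h x)%E ->
  log_convex_below comb s (EFin \o f) (EFin \o g) h ->
  log_convex_below (fun _ _ => tt) s (fun=> \int[leb]_x (f x)%:E)%E
    (fun=> \int[leb]_x (g x)%:E)%E (fun=> \int[leb]_x h x)%E.
Proof.
move=> mf mg mh fk gk h0 fgh _ _ a b a0 b0 af bg.
have supP (u : R -> R) : (forall x, 0 <= u x <= k) -> has_sup (range u).
  by move=> uk; split; [exists (u 0), 0|exists k => _ [x _ <-]; case/andP: (uk x)].
set M := sup (range f); set M' := sup (range g).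
have fM x : f x <= M by apply: sup_upper_bound; [exact: supP|exists x].
have gM x : g x <= M' by apply: sup_upper_bound; [exact: supP|exists x].
have int_h0 : (0 <= \int[leb]_x h x)%E by exact: integral_ge0.
have [a00|a00] := eqVneq a 0.
  by rewrite a00 powR0 ?mul0r// gt_eqF.
have [b00|b00] := eqVneq b 0.
  by rewrite b00 powR0 ?mulr0// gt_eqF.
have posM (u : R -> R) (c : R) : (forall x, 0 <= u x <= k) ->
    (c%:E <= \int[leb]_x (u x)%:E)%E -> c != 0 -> 0 <= c -> 0 < sup (range u).
  move=> uk cu c0 c0'; rewrite ltNge; apply/negP => uM.
  move: cu; rewrite (_ : (fun x => _) = cst 0%E); last first.
    apply/funext => x /=; congr EFin; apply/eqP; rewrite eq_le.
    have /andP[-> _] := uk x; rewrite andbT (le_trans _ uM)//.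
    by apply: sup_upper_bound; [exact: supP|exists x].
  by rewrite integral0 lee_fin => c0''; case/negP: c0; rewrite eq_le c0'' c0'.
have M0 : 0 < M by apply: posM af a00 a0.
have M'0 : 0 < M' by apply: posM bg b00 b0.
set m := M `^ s * M' `^ (1 - s).
have m0 : 0 < m by rewrite mulr_gt0// powR_gt0.
pose f1 x := M^-1 * f x; pose g1 x := M'^-1 * g x.
have mf1 : measurable_fun setT f1 by exact: measurable_funM.
have mg1 : measurable_fun setT g1 by exact: measurable_funM.
have f10 x : 0 <= f1 x.
  by rewrite mulr_ge0// ?invr_ge0 ?(ltW M0)//; case/andP: (fk x).
have g10 x : 0 <= g1 x.
  by rewrite mulr_ge0// ?invr_ge0 ?(ltW M'0)//; case/andP: (gk x).
(* truncation at 1: the levels of f1 and g1 do not exceed 1 *)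
pose h1 (x : R) : R := fine (mine (m^-1%:E * h x)%E 1%E).
have h1E x : (h1 x)%:E = mine (m^-1%:E * h x)%E 1%E.
  rewrite /h1 fineK// fin_numE; apply/andP; split.
    by rewrite gt_eqF// (@lt_le_trans _ _ 0%E)// le_min lee01 andbT mule_ge0// lee_fin invr_ge0 ltW.
  by rewrite lt_eqF// gt_min ltry orbT.
have h10 x : 0 <= h1 x.
  by rewrite -lee_fin h1E le_min lee01 andbT mule_ge0// lee_fin invr_ge0 ltW.
have mh1 : measurable_fun setT h1.
  apply/measurable_EFinP; rewrite (_ : EFin \o h1 = (fun x : R => mine (m^-1%:E * h x)%E 1%E)).
    by apply: measurable_mine => //; apply: measurable_funeM.
  by apply/funext => x; rewrite /= h1E.
have key : (s%:E * (\int[leb]_x (f1 x)%:E) + (1 - s)%:E * (\int[leb]_x (g1 x)%:E)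
    <= \int[leb]_x (h1 x)%:E)%E.
  have lc := @layer_cake R _ _ leb.
  rewrite (lc f1)// (lc g1)// (lc h1)//.
  have mlay (u : R -> R) : measurable_fun setT u ->
      (forall x, 0 <= u x) -> measurable_fun setT (fun t : measurableTypeR R => leb [set x | t < u x]).
    move=> mu u0.
    have := @measurable_layer R _ _ leb u (cst 1%E) mu _ _.
    rewrite (_ : (fun t => _) = (fun t : measurableTypeR R => leb [set x | t < u x])); first by apply.
    by apply/funext => t; rewrite integral_cst ?mul1e//; exact: measurable_superlevel.
  have mlf := mlay f1 mf1 f10; have mlg := mlay g1 mg1 g10; have mlh := mlay h1 mh1 h10.
  have zl (c : R) (F : R -> \bar R) : 0 < c ->
      measurable_fun setT (F : measurableTypeR R -> \bar R) -> (forall t, 0 <= F t)%E ->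
      (c%:E * \int[leb]_(t in `[0%R, +oo[) F t = \int[leb]_(t in `[0%R, +oo[) (c%:E * F t))%E.
    move=> c0 mF F0; rewrite ge0_integralZl//; first exact: measurable_funTS.
    by rewrite lee_fin ltW.
  rewrite !zl//.
  rewrite -ge0_integralD//; last 4 first.
  - by move=> t _; rewrite mule_ge0// lee_fin ltW.
  - by apply: measurable_funeM; exact: measurable_funTS.
  - by move=> t _; rewrite mule_ge0// lee_fin ltW.
  - by apply: measurable_funeM; exact: measurable_funTS.
  apply: ge0_le_integral => //.
  - by move=> t _; rewrite adde_ge0// mule_ge0// lee_fin ltW.
  - by apply: emeasurable_funD; apply: measurable_funeM; exact: measurable_funTS.
  - exact: measurable_funTS.
  move=> t; rewrite /= in_itv/= andbT => tt0.
  have le1 (u : R -> R) : (forall x, u x <= sup (range u)) -> 0 < sup (range u) ->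
      1 <= t -> [set x | t < (sup (range u))^-1 * u x] = set0.
    move=> uM u0 t1; apply/seteqP; split => // x /=; apply/negP; rewrite -leNgt.
    by rewrite (le_trans _ t1)// mulrC ler_pdivrMr// mul1r.
  have [t1|t1] := leP 1 t.
    by rewrite !le1// measure0 !mule0 adde0.
  apply: brunn_minkowski1 => //; [exact: measurable_superlevel..| | |].
  - have [|_ [x _ <-] Mx] := @sup_adherent _ (range f) ((1 - t) * M) _ (supP _ fk).
      by rewrite mulr_gt0// subr_gt0.
    by exists x; rewrite /= /f1 mulrC ltr_pdivlMr//; move: Mx; rewrite -/M; lra.
  - have [|_ [x _ <-] Mx] := @sup_adherent _ (range g) ((1 - t) * M') _ (supP _ gk).
      by rewrite mulr_gt0// subr_gt0.
    by exists x; rewrite /= /g1 mulrC ltr_pdivlMr//; move: Mx; rewrite -/M'; lra.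
  - move=> x y /= fx gy; rewrite -lte_fin h1E lt_min lte_fin t1 andbT.
    have /andP[fx0 _] := fk x; have /andP[gy0 _] := gk y.
    apply: lt_le_trans (_ : (m^-1%:E * (f x `^ s * g y `^ (1 - s))%:E <= _)%E); last first.
      by apply: lee_wpmul2l; [rewrite lee_fin invr_ge0 ltW|exact: fgh].
    rewrite -EFinM lte_fin mulrC ltr_pdivlMr//.
    have -> : t * m = (t * M) `^ s * (t * M') `^ (1 - s).
      rewrite (@powRM _ _ _ s tt0 (ltW M0)) (@powRM _ _ _ (1 - s) tt0 (ltW M'0)).
      rewrite [in RHS]mulrACA -powRD; last by rewrite addrC subrK oner_eq0.
      by rewrite addrC subrK powRr1.
    have h1' : t * M < f x by rewrite -ltr_pdivlMr// mulrC.
    have h2' : t * M' < g y by rewrite -ltr_pdivlMr// mulrC.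
    have tM : 0 <= t * M by rewrite mulr_ge0// ltW.
    have tM' : 0 <= t * M' by rewrite mulr_ge0// ltW.
    by apply: ltr_pM; rewrite ?powR_ge0//; apply: gt0_ltr_powR; rewrite ?nnegrE.
have intZ (c : R) (u : R -> R) : 0 <= c -> measurable_fun setT u ->
    (forall x, 0 <= u x) ->
    (\int[leb]_x (c * u x)%:E = c%:E * \int[leb]_x (u x)%:E)%E.
  move=> c0 mu u0; under eq_integral do rewrite EFinM.
  rewrite ge0_integralZl_EFin//; first by move=> x _; rewrite lee_fin.
  exact/measurable_EFinP.
have fx0 x : 0 <= f x by case/andP: (fk x).
have gx0 x : 0 <= g x by case/andP: (gk x).
have lef : ((a / M)%:E <= \int[leb]_x (f1 x)%:E)%E.
  rewrite /f1 intZ// ?invr_ge0 ?(ltW M0)//.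
  by rewrite mulrC EFinM lee_wpmul2l// lee_fin invr_ge0 ltW.
have leg : ((b / M')%:E <= \int[leb]_x (g1 x)%:E)%E.
  rewrite /g1 intZ// ?invr_ge0 ?(ltW M'0)//.
  by rewrite mulrC EFinM lee_wpmul2l// lee_fin invr_ge0 ltW.
have leh : (\int[leb]_x (h1 x)%:E <= m^-1%:E * \int[leb]_x h x)%E.
  rewrite -ge0_integralZl//; last by rewrite lee_fin invr_ge0 ltW.
  apply: ge0_le_integral => //.
  - by move=> x _; rewrite lee_fin.
  - exact/measurable_EFinP.
  - by apply: measurable_funeM.
  - by move=> x _; rewrite h1E ge_min lexx.
suff : ((m^-1 * (a `^ s * b `^ (1 - s)))%:E <= m^-1%:E * \int[leb]_x h x)%E.
  by rewrite EFinM lee_pmul2l// ?lte_fin ?invr_gt0.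
apply: le_trans leh; apply: le_trans key.
apply: (@le_trans _ _ (s * (a / M) + (1 - s) * (b / M'))%:E); last first.
  rewrite EFinD (EFinM s) (EFinM (1 - s)).
  by apply: leeD; apply: lee_wpmul2l => //; rewrite lee_fin ltW.
rewrite lee_fin; apply: (le_trans _ (powR_amgm s01 _ _)); last 2 first.
- by rewrite divr_ge0// ltW.
- by rewrite divr_ge0// ltW.
have Mi : 0 <= M^-1 by rewrite invr_ge0 ltW.
have M'i : 0 <= M'^-1 by rewrite invr_ge0 ltW.
rewrite (@powRM _ _ _ s a0 Mi) (@powRM _ _ _ (1 - s) b0 M'i).
have inv u (r : R) : 0 < u -> u^-1 `^ r = (u `^ r)^-1.
  by move=> u0; rewrite -[u^-1](powR_inv1 (ltW u0)) -powRrM mulN1r powRN.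
by rewrite !inv// /m invfM [leLHS]mulrC [leRHS]mulrACA.
Qed.

(** Reduction of the Prekopa-Leindler inequality to bounded functions. *)
Lemma integral_truncation (u : R -> \bar R) (c : R) :
  measurable_fun setT u -> (forall x, 0 <= u x)%E ->
  (c%:E < \int[leb]_x u x)%E ->
  exists k, forall l, (k <= l)%N -> (c%:E <= \int[leb]_x (mine (u x) l%:R%:E))%E.
Proof.
move=> mu u0 cu.
have mn n : measurable_fun setT (fun x : measurableTypeR R => mine (u x) n%:R%:E).
  exact: measurable_mine.
have nd x : {homo (fun n => mine (u x) n%:R%:E) : n p / (n <= p)%N >-> (n <= p)%E}.
  move=> n p np /=; rewrite le_min ge_min lexx/= ge_min; apply/orP; right.
  by rewrite lee_fin ler_nat.
have lim x : limn (fun n => mine (u x) n%:R%:E) = u x.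
  apply/cvg_lim => //; have [ux|ux] := eqVneq (u x) +oo%E.
    rewrite ux (_ : (fun n => _) = (fun n => n%:R%:E)); last first.
      by apply/funext => n; rewrite min_r// leey.
    exact/cvgenyP.
  have uf : u x \is a fin_num by rewrite ge0_fin_numE// ltey.
  apply: cvg_near_cst; near=> n.
  rewrite min_l//.
  rewrite -(fineK uf) lee_fin ltW// (lt_le_trans (truncnS_gt _))// ler_nat.
  by near: n; exact: nbhs_infty_ge.
have := @cvg_monotone_convergence _ _ _ leb setT measurableT
  (fun n x => mine (u x) n%:R%:E) mn _ _.
move=> /(_ _ _)/wrap[].
- by move=> n x _; rewrite le_min u0/= lee_fin.
- by move=> x _ n p np; exact: nd.
under eq_integral do rewrite lim.
move=> cv.
have ndI : nondecreasing_seq (fun n => \int[leb]_x (mine (u x) n%:R%:E))%E.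
  move=> n p np; apply: ge0_le_integral => //; last by move=> x _; exact: nd.
  by move=> x _; rewrite le_min u0/= lee_fin.
have [] := lte_lim (M := c) ndI.
- by apply/cvg_ex; eexists; exact: cv.
- by rewrite (cvg_lim _ cv).
by move=> k _ hk; exists k => l kl; exact: hk.
Unshelve. all: by end_near. Qed.

Lemma prekopa_leindler1 (f g h : R -> \bar R) :
  measurable_fun setT f -> measurable_fun setT g -> measurable_fun setT h ->
  (forall x, 0 <= f x)%E -> (forall x, 0 <= g x)%E -> (forall x, 0 <= h x)%E ->
  log_convex_below comb s f g h ->
  log_convex_below (fun _ _ => tt) s (fun=> \int[leb]_x f x)%E
    (fun=> \int[leb]_x g x)%E (fun=> \int[leb]_x h x)%E.
Proof.
move=> mf mg mh f0 g0 h0 fgh _ _ a b a0 b0 af bg.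
have int_h0 : (0 <= \int[leb]_x h x)%E by exact: integral_ge0.
have [a00|a00] := eqVneq a 0.
  by rewrite a00 powR0 ?mul0r// gt_eqF.
have [b00|b00] := eqVneq b 0.
  by rewrite b00 powR0 ?mulr0// gt_eqF.
set X := a `^ s * b `^ (1 - s).
have H c : 0 < c < 1 -> ((c * X)%:E <= \int[leb]_x h x)%E.
  move=> /andP[c0 c1].
  have ca : ((c * a)%:E < \int[leb]_x f x)%E.
    by apply: lt_le_trans af; rewrite lte_fin gtr_pMl// lt_def a00.
  have cb : ((c * b)%:E < \int[leb]_x g x)%E.
    by apply: lt_le_trans bg; rewrite lte_fin gtr_pMl// lt_def b00.
  have [k1 k1f] := integral_truncation mf f0 ca.
  have [k2 k2g] := integral_truncation mg g0 cb.
  pose k := maxn k1 k2.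
  have trE (u : R -> \bar R) x : (forall x, 0 <= u x)%E ->
      (fine (mine (u x) k%:R%:E))%:E = mine (u x) k%:R%:E.
    move=> u0; rewrite fineK// ge0_fin_numE; first by rewrite gt_min ltry orbT.
    by rewrite le_min u0 lee_fin ler0n.
  have trk (u : R -> \bar R) x : (forall x, 0 <= u x)%E ->
      0 <= fine (mine (u x) k%:R%:E) <= k%:R.
    by move=> u0; rewrite -!lee_fin trE// le_min u0 lee_fin ler0n ge_min lexx orbT.
  have mtr (u : R -> \bar R) : (forall x, 0 <= u x)%E -> measurable_fun setT u ->
      measurable_fun setT (fun x => fine (mine (u x) k%:R%:E)).
    move=> u0 mu; apply/measurable_EFinP.
    rewrite (_ : EFin \o _ = (fun x => mine (u x) k%:R%:E)); first exact: measurable_mine.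
    by apply/funext => x; rewrite /= trE.
  have cX : c * X = (c * a) `^ s * (c * b) `^ (1 - s).
    rewrite (@powRM _ _ _ s (ltW c0) a0) (@powRM _ _ _ (1 - s) (ltW c0) b0).
    rewrite mulrACA -powRD; last by rewrite addrC subrK oner_eq0.
    by rewrite addrC subrK powRr1// ltW.
  rewrite cX.
  apply: (@prekopa_leindler_bounded (fun x => fine (mine (f x) k%:R%:E))
    (fun x => fine (mine (g x) k%:R%:E)) h k%:R _ _ _ _ _ _ _ tt tt).
  - exact: mtr.
  - exact: mtr.
  - by [].
  - by move=> x; exact: trk.
  - by move=> x; exact: trk.
  - by [].
  - move=> x y u v u0 v0 /= uf vg; apply: fgh => //.
      by apply: le_trans uf _; rewrite trE// ge_min lexx.
    by apply: le_trans vg _; rewrite trE// ge_min lexx.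
  - by rewrite mulr_ge0// ltW.
  - by rewrite mulr_ge0// ltW.
  - by under eq_integral do rewrite trE//; apply: k1f; rewrite leq_maxl.
  - by under eq_integral do rewrite trE//; apply: k2g; rewrite leq_maxr.
have [hoo|hoo] := eqVneq (\int[leb]_x h x)%E +oo%E; first by rewrite hoo leey.
have hfin : (\int[leb]_x h x)%E \is a fin_num by rewrite ge0_fin_numE// ltey.
rewrite -(fineK hfin) lee_fin; rewrite -(fineK hfin) in H.
have cvX : c * X @[c --> 1^'-] --> 1 * X.
  by apply: cvg_at_left_filter; apply: cvgM; [exact: cvg_id|exact: cvg_cst].
rewrite -[leLHS]mul1r; apply: (cvgr_to_le cvX).
near=> c; rewrite -lee_fin; apply: H; apply/andP; split.
  by near: c; exact: nbhs_left_gt.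
by near: c; exact: nbhs_left_lt.
Unshelve. all: by end_near. Qed.

(** Induction on the dimension: for fixed first coordinates the slices satisfy the
    hypothesis in dimension n, hence the integrals of the slices satisfy it on the line. *)
Lemma prekopa_leindler n (f g h : 'rV[R]_n -> \bar R) :
  measurable_fun setT f -> measurable_fun setT g -> measurable_fun setT h ->
  (forall x, 0 <= f x)%E -> (forall x, 0 <= g x)%E -> (forall x, 0 <= h x)%E ->
  log_convex_below (fun x y => s *: x + (1 - s) *: y) s f g h ->
  log_convex_below (fun _ _ => tt) s (fun=> \int[lebesgue_row R n]_x f x)%E
    (fun=> \int[lebesgue_row R n]_x g x)%E (fun=> \int[lebesgue_row R n]_x h x)%E.
Proof.
elim: n f g h => [|n IH] f g h mf mg mh f0 g0 h0 fgh.
  rewrite !integral_row0// => _ _ a b a0 b0 fa gb.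
  have := fgh 0 0 a b a0 b0 fa gb.
  by rewrite !scaler0 addr0.
rewrite !integral_row_cons//.
have mu1 (u : 'rV[R]_n.+1 -> \bar R) : measurable_fun setT u -> (forall x, 0 <= u x)%E ->
    measurable_fun setT (fun a : measurableTypeR R => \int[lebesgue_row R n]_x u (row_cons (a, x)))%E.
  move=> mu u0; apply: (@measurable_fun_fubini_tonelli_F _ _ _ _ _ _ (u \o @row_cons R n)).
    exact: measurableT_comp mu (@measurable_row_cons R n).
  by move=> p; exact: u0.
have msl (u : 'rV[R]_n.+1 -> \bar R) a : measurable_fun setT u ->
    measurable_fun setT (fun x : 'rV[R]_n => u (row_cons (a, x))).
  move=> mu; exact: (measurableT_comp (measurableT_comp mu (@measurable_row_cons R n))
    (pair1_measurable a)).
apply: prekopa_leindler1; [exact: mu1..| | | |].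
- by move=> a; exact: integral_ge0.
- by move=> a; exact: integral_ge0.
- by move=> a; exact: integral_ge0.
move=> x1 y1 a b a0 b0 af bg.
apply: (IH (fun x => f (row_cons (x1, x))) (fun y => g (row_cons (y1, y)))
  (fun z => h (row_cons (s * x1 + (1 - s) * y1, z))) _ _ _ _ _ _ _ tt tt) => //.
- exact: msl.
- exact: msl.
- exact: msl.
move=> x y u v u0 v0 uf vg.
have E : s *: row_cons (x1, x) + (1 - s) *: row_cons (y1, y) =
    row_cons (s * x1 + (1 - s) * y1, s *: x + (1 - s) *: y).
  by apply/rowP => i; rewrite !mxE; case: unliftP => [j _|_] /=; rewrite ?mxE.
by have := fgh _ _ u v u0 v0 uf vg; rewrite E.
Qed.

End prekopa_leindler_line.

(** The part of the binomial expansion of (a + b)^n that is of first order in b: with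
    a = |A|^(1/n) and b the same root for the ball, it is the isoperimetric term. *)
Lemma ler_exprD_linear (R : realFieldType) (a b : R) n : 0 <= a -> 0 <= b ->
  a ^+ n.+1 + n.+1%:R * a ^+ n * b <= (a + b) ^+ n.+1.
Proof.
move=> a0 b0; elim: n => [|n IH]; first by rewrite !expr1 expr0 !mul1r.
rewrite [leRHS]exprS.
apply: (le_trans _ (ler_wpM2l (addr_ge0 a0 b0) IH)).
have p0 : 0 <= n.+1%:R * a ^+ n * b ^+ 2 by rewrite !mulr_ge0 ?exprn_ge0.
rewrite -subr_ge0 [X in 0 <= X](_ : _ = n.+1%:R * a ^+ n * b ^+ 2)//.
by rewrite !exprS -!natr1; ring.
Qed.

Section brunn_minkowski.
Context (R : realType) (n : nat) (n2 : (2 <= n)%N).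
Local Notation mu := (lebesgue_row R n).

Lemma indicator_scale_integral (c : R) (A : set 'rV[R]_n) : 0 < c -> measurable A ->
  (\int[mu]_x (\1_A (c *: x))%:E = (c^-1 ^+ n)%:E * mu A)%E.
Proof.
move=> c0 mA.
have -> : (mu A = \int[mu]_x (\1_A x)%:E)%E by rewrite integral_indic// setIT.
rewrite [in RHS](integral_affine 0 (lt0r_neq0 c0))//; last first.
  by apply/measurable_EFinP; exact: measurable_indic.
rewrite gtr0_norm// muleA -EFinM -exprMn mulVf ?gt_eqF// expr1n mul1e.
by apply: eq_integral => x _; rewrite addr0.
Qed.

Lemma measurable_indic_scale (c : R) (A : set 'rV[R]_n) : measurable A ->
  measurable_fun setT (fun x : 'rV[R]_n => (\1_A (c *: x) : R)%:E).
Proof.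
move=> mA; apply/measurable_EFinP.
rewrite (_ : (fun x : 'rV[R]_n => \1_A (c *: x)) = \1_A \o (fun x => c *: x + 0)).
  exact: measurableT_comp (measurable_indic mA) (measurable_row_affine c 0).
by apply/funext => x /=; rewrite addr0.
Qed.

(** Prekopa-Leindler for the characteristic functions of A / s and of the ball dilated by
    1 / (1 - s), where s is chosen so that both dilated sets have measure (a + b)^n. *)
Lemma brunn_minkowski_ball (A C : set 'rV[R]_n) (e : R) : 0 < e ->
  measurable A -> measurable C -> (mu A < +oo)%E ->
  (forall x h, A x -> enorm h < e -> C (x + h)) ->
  (mu A + (n%:R * e * ball_volume R n `^ n%:R^-1 * fine (mu A) `^ ((n%:R - 1) / n%:R))%:E
    <= mu C)%E.
Proof.
move=> e0 mA mC Aoo AC.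
have n0 : 0 < n%:R :> R by rewrite ltr0n (leq_trans _ n2).
have n1 : 0 < n%:R - 1 :> R by rewrite subr_gt0 ltr1n.
have Afin : mu A \is a fin_num by rewrite ge0_fin_numE.
have w0 := ball_volume_gt0 R n.
have [A0|Apos] := eqVneq (mu A) 0%E.
  by rewrite A0/= powR0 ?mulr0 ?adde0// gt_eqF// divr_gt0.
have {}Apos : 0 < fine (mu A) by rewrite fine_gt0// lt0e Apos measure_ge0.
set a := fine (mu A) `^ n%:R^-1; set b := e * ball_volume R n `^ n%:R^-1.
have a0 : 0 < a by exact: powR_gt0.
have b0 : 0 < b by rewrite mulr_gt0// powR_gt0.
have ab0 : 0 < a + b by exact: addr_gt0.
have rootK (z : R) : 0 <= z -> (z `^ n%:R^-1) ^+ n = z.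
  by move=> z0; rewrite -powR_mulrn ?powR_ge0// -powRrM mulVf ?gt_eqF// powRr1.
(* both dilations A / s and e B / (1 - s) then have measure (a + b)^n *)
set s := a / (a + b).
have s1E : 1 - s = b / (a + b) by rewrite /s; field; rewrite gt_eqF.
have s0 : 0 < s by exact: divr_gt0.
have t0 : 0 < 1 - s by rewrite s1E divr_gt0.
have s01 : 0 < s < 1 by rewrite s0 -subr_gt0.
have mB := @measurable_eball R n e.
have intf : (\int[mu]_x (\1_A (s *: x))%:E = ((a + b) ^+ n)%:E)%E.
  rewrite (indicator_scale_integral s0 mA) -[X in (_ * X)%E](fineK Afin).
  rewrite -(rootK _ (ltW Apos)) -/a -EFinM -exprMn; congr (_ ^+ _)%:E.
  by rewrite /s; field; rewrite !gt_eqF.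
have intg : (\int[mu]_x (\1_(@eball R n e) ((1 - s) *: x))%:E = ((a + b) ^+ n)%:E)%E.
  rewrite (indicator_scale_integral t0 mB) [X in (_ * X)%E](measure_eball n e0).
  rewrite -(rootK _ (ltW w0)) -exprMn -/b -EFinM -exprMn; congr (_ ^+ _)%:E.
  by rewrite s1E; field; rewrite !gt_eqF.
have abn : 0 <= (a + b) ^+ n by rewrite exprn_ge0// ltW.
have := @prekopa_leindler R s s01 n (fun x => (\1_A (s *: x))%:E)
  (fun x => (\1_(@eball R n e) ((1 - s) *: x))%:E) (fun x => (\1_C x)%:E)
  (measurable_indic_scale s mA) (measurable_indic_scale (1 - s) mB).
have mC' : measurable_fun setT (fun x : 'rV[R]_n => (\1_C x : R)%:E).
  by apply/measurable_EFinP; exact: measurable_indic.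
have i0 (D : set 'rV[R]_n) x : (0 <= (\1_D x : R)%:E)%E by rewrite lee_fin.
move=> /(_ mC' (fun x => i0 _ _) (fun x => i0 _ _) (i0 _)) PL.
have {}PL := PL _ tt tt _ _ abn abn.
rewrite intf intg integral_indic// setIT in PL.
have {}PL : (((a + b) ^+ n)%:E <= mu C)%E.
  rewrite (_ : (a + b) ^+ n = ((a + b) ^+ n) `^ s * ((a + b) ^+ n) `^ (1 - s)).
    apply: PL => //.
    move=> x y u v u0 v0; rewrite !lee_fin.
    have su : s != 0 by rewrite gt_eqF.
    have tu : 1 - s != 0 by rewrite gt_eqF.
    rewrite !indicE.
    case: (pselect (A (s *: x))) => [Ax|Ax]; last first.
      by rewrite (memNset Ax) => u0'; have -> : u = 0 by [apply/eqP; rewrite eq_le u0 u0'];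
        rewrite powR0// mul0r.
    case: (pselect (@eball R n e ((1 - s) *: y))) => [By|By]; last first.
      by rewrite (memNset By) => _ u0'; have -> : v = 0 by [apply/eqP; rewrite eq_le v0 u0'];
        rewrite powR0// mulr0.
    rewrite (mem_set Ax) (mem_set By) (mem_set (AC _ _ Ax By)) => u1 v1.
    have le1 (z r : R) : 0 <= z -> z <= 1 -> 0 < r -> z `^ r <= 1.
      move=> z0 z1 r0.
      by rewrite (le_trans (@ge0_ler_powR _ _ (ltW r0) z 1 z0 ler01 z1))// powR1.
    by rewrite -[leRHS]mulr1; apply: ler_pM; rewrite ?powR_ge0//; exact: le1.
  rewrite -powRD; last by rewrite addrC subrK oner_eq0.
  by rewrite (addrC s) subrK powRr1.
apply: le_trans PL.
rewrite -[in leLHS](fineK Afin) -EFinD lee_fin.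
have := @ler_exprD_linear R a b n.-1 (ltW a0) (ltW b0).
rewrite prednK ?(leq_trans _ n2)// => h; apply: le_trans h.
rewrite {1}/a (rootK _ (ltW Apos)) lerD2l.
rewrite (_ : a ^+ n.-1 = fine (mu A) `^ ((n%:R - 1) / n%:R)).
  by rewrite /b le_eqVlt; apply/orP; left; apply/eqP; ring.
have n1E : n.-1%:R = n%:R - 1 :> R by rewrite -subn1 natrB// (leq_trans _ n2).
rewrite -(powR_mulrn n.-1 (ltW a0)) n1E.
by rewrite -[LHS]powRrM (mulrC n%:R^-1).
Qed.

End brunn_minkowski.

(** * Mollifiers on the line *)

Section bump_line.
Context {R : realType}.

(** Differentiability of the bump at the two points where its formula changes. *)
Lemma is_derive_sq_bound (f : R -> R) (t0 C : R) :
  f t0 = 0 -> (forall t, `|f t| <= C * (t - t0) ^+ 2) -> is_derive t0 1 f 0.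
Proof.
move=> f0 fC.
have cv : (fun h : R => h^-1 *: ((f \o shift t0) (h *: 1) - f t0)) @ 0^' --> (0 : R).
  apply/cvgrPdist_le => e e0.
  have C0 : 0 < `|C| + 1 by rewrite ltr_wpDl.
  near=> h.
  have h0 : h != 0 by near: h; exact: nbhs_dnbhs_neq.
  rewrite sub0r normrN /= f0 subr0 [_%:A]mulr1 normrM normfV.
  rewrite mulrC ler_pdivrMr ?normr_gt0//.
  apply: le_trans (fC _) _; rewrite addrK.
  have hE : `|h| <= e / (`|C| + 1).
    near: h; apply: dnbhs0_le; exact: divr_gt0.
  rewrite -real_normK ?num_real// expr2 mulrA ler_wpM2r//.
  apply: (@le_trans _ _ ((`|C| + 1) * `|h|)).
    by rewrite ler_wpM2r// (le_trans (ler_norm _))// lerDl.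
  by rewrite mulrC -ler_pdivlMr.
by apply: DeriveDef; [apply/cvg_ex; exists 0|exact: cvg_lim cv].
Unshelve. all: by end_near. Qed.

Definition gap (t : R) : R := 1 - t ^+ 2.

(** The functions P(t) / (1 - t^2)^m exp(-1 / (1 - t^2)) on ]-1, 1[, extended by zero:
    the smallest family that contains the classical bump and its derivatives. *)
Definition flat (p : {poly R}) (m : nat) (t : R) : R :=
  if `|t| < 1 then p.[t] * (gap t)^-1 ^+ m * expR (- (gap t)^-1) else 0.

Definition dflat (p : {poly R}) (m : nat) : {poly R} :=
  p^`() * (1 - 'X^2) ^+ 2 + m%:R *: ('X *+ 2 * p * (1 - 'X^2)) - 'X *+ 2 * p.

Lemma gap_gt0 t : `|t| < 1 -> 0 < gap t.
Proof.
move=> t1; rewrite subr_gt0 -real_normK ?num_real//.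
by rewrite expr_lt1.
Qed.

(** The exponential beats any power of 1 / (1 - t^2), by its own power series. *)
Lemma flat_bound p m : exists2 C, 0 <= C &
  forall t, `|flat p m t| <= C * gap t ^+ 2 /\ (`|t| < 1 -> gap t <= 1).
Proof.
have [M M0 pM] : exists2 M, 0 <= M & forall t, `|t| <= 1 -> `|p.[t]| <= M.
  exists (\sum_(i < size p) `|p`_i|); first exact: sumr_ge0.
  move=> t t1; rewrite horner_coef; apply: le_trans (ler_norm_sum _ _ _) _.
  apply: ler_sum => i _; rewrite normrM normrX -[leRHS]mulr1 ler_wpM2l//.
  exact: exprn_ile1.
exists (M * (m + 2)`!%:R); first by rewrite mulr_ge0.
move=> t; split; last by move=> t1; rewrite /gap gerBl sqr_ge0.
rewrite /flat; case: ifPn => t1; last first.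
  by rewrite normr0 mulr_ge0 ?sqr_ge0// mulr_ge0.
have g0 := gap_gt0 t1.
rewrite !normrM -!mulrA ler_pM ?mulr_ge0//; first by rewrite pM// ltW.
rewrite normrX normfV (gtr0_norm g0) (gtr0_norm (expR_gt0 _)) expRN.
have gi0 : 0 <= (gap t)^-1 by rewrite invr_ge0 ltW.
have := expR_ge1Dxn m.+1 gi0; rewrite addn2.
set F := m.+2`!%:R => h.
have F0 : 0 < F :> R by rewrite ltr0n fact_gt0.
have {}h : (gap t)^-1 ^+ m.+2 / F <= expR (gap t)^-1.
  by apply: le_trans h; rewrite lerDr.
rewrite ler_pdivrMr ?expR_gt0//.
apply: (@le_trans _ _ (F * gap t ^+ 2 * ((gap t)^-1 ^+ m.+2 / F))).
  rewrite le_eqVlt; apply/orP; left; apply/eqP.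
  by rewrite !exprS !exprVn; field; rewrite expf_eq0 !gt_eqF ?andbF.
by rewrite ler_wpM2l// mulr_ge0 ?(ltW F0)// sqr_ge0.
Qed.

Lemma flat_out p m t : 1 <= `|t| -> flat p m t = 0.
Proof. by rewrite /flat leNgt => /negbTE ->. Qed.

Lemma flat_derive p m (t : R) : is_derive t 1 (flat p m) (flat (dflat p m) (m + 2) t).
Proof.
have [t1|t1] := ltP `|t| 1; last first.
  rewrite (flat_out _ _ t1).
  have [C C0 fC] := flat_bound p m.
  apply: (@is_derive_sq_bound _ _ (C * 4)); first exact: flat_out.
  move=> s; have [s1|s1] := ltP `|s| 1; last by rewrite flat_out// normr0 mulr_ge0 ?sqr_ge0// mulr_ge0.
  have [+ _] := fC s; move=> /le_trans; apply.
  rewrite -mulrA ler_wpM2l//.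
  have -> : 4 * (s - t) ^+ 2 = (2 * `|s - t|) ^+ 2.
    by rewrite exprMn real_normK ?num_real// -natrX.
  rewrite ler_sqr ?nnegrE ?(ltW (gap_gt0 s1)) ?mulr_ge0//.
  apply: (@le_trans _ _ (2 * (1 - `|s|))).
    rewrite /gap -real_normK ?num_real// -subr_ge0.
    rewrite [X in 0 <= X](_ : _ = (1 - `|s|) ^+ 2) ?sqr_ge0//; ring.
  rewrite ler_pM2l// distrC (le_trans _ (lerB_dist _ _))//.
  by rewrite lerD2r.
rewrite {2}/flat t1.
have g0 := gap_gt0 t1.
have near1 : \near t, p.[t] * (gap t)^-1 ^+ m * expR (- (gap t)^-1) = flat p m t.
  have : \forall s \near t, `|s| < 1.
    apply/nbhs_ballP; exists (1 - `|t|) => /=; first by rewrite subr_gt0.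
    move=> s; rewrite /ball/= ltrBrDl distrC => ts; apply: le_lt_trans ts.
    by rewrite -{1}(subrK t s) addrC ler_normD.
  by apply: filterS => s s1; rewrite /flat s1.
apply: near_eq_is_derive near1 _.
have dg : is_derive t 1 gap (- (2 * t)).
  have -> : gap = horner (1 - 'X^2).
    by apply/funext => s; rewrite /gap !hornerE.
  apply: is_derive_eq.
  by rewrite !poly.derivE !hornerE; ring.
have dgi : is_derive t 1 (fun s => (gap s)^-1) (2 * t * (gap t)^-1 ^+ 2).
  apply: is_derive_eq; first by apply: is_deriveV; rewrite gt_eqF.
  by rewrite /GRing.scale/= exprVn; ring.
pose gi s := (gap s)^-1.
have -> : (fun s => p.[s] * (gap s)^-1 ^+ m * expR (- (gap s)^-1)) =
  (horner p * (gi ^+ m)) * (expR \o (- gi)).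
  by apply/funext => s; rewrite /= !fctE/=.
have dgi' : is_derive t 1 gi (2 * t * (gap t)^-1 ^+ 2) by exact: dgi.
apply: is_derive_eq.
rewrite /GRing.scale/= !fctE/=.
have -> : (dflat p m).[t] =
    p^`().[t] * gap t ^+ 2 + m%:R * (2 * t * p.[t] * gap t) - 2 * t * p.[t].
  rewrite /dflat !(hornerD, hornerN, hornerM, hornerZ, horner_exp, hornerMn, hornerX, hornerC).
  by rewrite /gap; ring.
have gn0 : gap t != 0 by rewrite gt_eqF.
rewrite /gi addn2; case: m => [|m] /=.
  by rewrite !expr0 !exprS expr0; field.
by rewrite !exprS; field.
Qed.

(** The classical bump exp(-1 / (1 - t^2)) and all its derivatives stay in the family
    [flat], which spares a general theory of smooth functions. *)
Definition bump_data (k : nat) : {poly R} * nat :=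
  iter k (fun pm => (dflat pm.1 pm.2, (pm.2 + 2)%N)) (1, 0%N).

Definition bump (k : nat) : R -> R := flat (bump_data k).1 (bump_data k).2.

Lemma bump_derive k (t : R) : is_derive t 1 (bump k) (bump k.+1 t).
Proof. exact: flat_derive. Qed.

Lemma bump_continuous k : continuous (bump k).
Proof.
move=> t; apply: differentiable_continuous; apply/derivable1_diffP.
by have [] := bump_derive k t.
Qed.

Lemma bump_bounded k : exists2 C, 0 <= C & forall t, `|bump k t| <= C.
Proof.
have [C C0 bC] := flat_bound (bump_data k).1 (bump_data k).2.
exists C => // t; have [t1|t1] := ltP `|t| 1; last by rewrite /bump flat_out// normr0.
have [h /(_ t1) g1] := bC t; apply: le_trans h _.
rewrite -[leRHS]mulr1 ler_wpM2l// -[leRHS](expr1n _ 2) ler_sqr ?nnegrE//.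
exact: ltW (gap_gt0 t1).
Qed.

Lemma bump_out k t : 1 <= `|t| -> bump k t = 0.
Proof. exact: flat_out. Qed.

Lemma bump0E t : bump 0 t = if `|t| < 1 then expR (- (gap t)^-1) else 0.
Proof. by rewrite /bump/flat/= hornerC expr0 !mul1r. Qed.

Lemma bump0_ge0 t : 0 <= bump 0 t.
Proof. by rewrite bump0E; case: ifP => // _; exact: expR_ge0. Qed.

Lemma bump0_even t : bump 0 (- t) = bump 0 t.
Proof. by rewrite !bump0E normrN /gap sqrrN. Qed.

Lemma bump1_odd t : bump 1 (- t) = - bump 1 t.
Proof.
have d : is_derive t 1 (bump 0 \o -%R) (bump 1 (- t) * -1).
  by apply: is_derive1_comp; first exact: bump_derive.
have E : bump 0 \o -%R = bump 0 by apply/funext => s; exact: bump0_even.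
rewrite E in d; have [_ d1] := d; have [_ d2] := bump_derive 0 t.
by rewrite -d2 d1 mulrN1 opprK.
Qed.

Local Notation leb := (@lebesgue_measure R).

Lemma measurable_bump k : measurable_fun setT (bump k).
Proof. by apply: continuous_measurable_fun; exact: bump_continuous. Qed.

Lemma bump_integral : exists2 c, 0 < c & (\int[leb]_t (bump 0 t)%:E = c%:E)%E.
Proof.
have mI (a b : R) : measurable_fun setT (fun t : R => (\1_(`[a, b]%classic : set R) t)%:E).
  by apply/measurable_EFinP; exact: measurable_indic.
have up : (\int[leb]_t (bump 0 t)%:E <= 2%:E)%E.
  apply: (@le_trans _ _ (\int[leb]_t (\1_(`[-1, 1]%classic : set R) t)%:E)%E).
    apply: ge0_le_integral => //.
    - by move=> t _; rewrite lee_fin bump0_ge0.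
    - by apply/measurable_EFinP; exact: measurable_bump.
    - exact: mI.
    move=> t _; rewrite lee_fin indic_bool/= in_itv/= -ler_norml bump0E.
    case: ltP => [t1|t1]; last by [].
    rewrite (ltW t1) -expR0 ler_expR oppr_le0 invr_ge0 ltW// gap_gt0//.
  rewrite integral_indic// setIT [X in (X <= _)%E]lebesgue_measure_itv/= lte_fin.
  by rewrite gtrN// -EFinD opprK.
have lo : ((expR (- 2) * 2^-1)%:E <= \int[leb]_t (bump 0 t)%:E)%E.
  apply: (@le_trans _ _ (\int[leb]_t ((expR (- 2))%:E * (\1_(`[0, 2^-1]%classic : set R) t)%:E)%E)%E).
    rewrite ge0_integralZl_EFin ?expR_ge0//; last exact: mI.
    rewrite integral_indic// setIT [X in (_ <= _ * X)%E]lebesgue_measure_itv/= lte_fin.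
    by rewrite invr_gt0 ltr0n/= sube0 EFinM.
  apply: ge0_le_integral => //.
  - by apply: measurable_funeM; exact: mI.
  - by apply/measurable_EFinP; exact: measurable_bump.
  move=> t _; rewrite -EFinM lee_fin indic_bool/= in_itv/=.
  case: (boolP (_ && _)) => [/andP[t0 t1]|_]; last by rewrite mulr0 bump0_ge0.
  have t1' : `|t| < 1 by rewrite ger0_norm//; lra.
  rewrite mulr1 bump0E t1' ler_expR lerN2.
  rewrite -[leRHS]invrK lef_pV2 ?posrE ?gap_gt0 ?invr_gt0//.
  by rewrite /gap; nra.
have fin : (\int[leb]_t (bump 0 t)%:E)%E \is a fin_num.
  rewrite ge0_fin_numE; first exact: le_lt_trans up (ltry _).
  by apply: integral_ge0 => t _; rewrite lee_fin bump0_ge0.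
exists (fine (\int[leb]_t (bump 0 t)%:E)%E); last by rewrite fineK.
rewrite -lte_fin fineK//; apply: lt_le_trans lo.
by rewrite lte_fin mulr_gt0 ?expR_gt0.
Qed.

(** The derivatives belong to the data, [psi k] being the k-th one: the partial derivatives of
    the kernel on R^n are products of them. *)
Definition is_mollifier (d : R) (psi : nat -> R -> R) : Prop :=
  [/\ forall k (t : R), is_derive t 1 (psi k) (psi k.+1 t),
      forall k, exists2 C, 0 <= C & forall t, `|psi k t| <= C,
      forall k t, d <= `|t| -> psi k t = 0,
      (forall t, 0 <= psi 0%N t) /\ (\int[leb]_t (psi 0%N t)%:E = 1)%E &
      (forall t, psi 0%N (- t) = psi 0%N t) /\ (forall t, psi 1%N (- t) = - psi 1%N t)].

Lemma exists_mollifier d : 0 < d -> exists psi, is_mollifier d psi.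
Proof.
move=> d0; have [c c0 cE] := bump_integral.
exists (fun k t => c^-1 * d^-1 ^+ k.+1 * bump k (d^-1 * t)); split.
- move=> k t.
  have d1 : is_derive t 1 (fun s : R => d^-1 * s) d^-1.
    have -> : (fun s : R => d^-1 * s) = d^-1 \*: id by [].
    by apply: is_derive_eq; rewrite /GRing.scale/= mulr1.
  have d2 : is_derive t 1 (bump k \o (fun s => d^-1 * s)) (bump k.+1 (d^-1 * t) * d^-1).
    by apply: is_derive1_comp; exact: bump_derive.
  have -> : (fun t => c^-1 * d^-1 ^+ k.+1 * bump k (d^-1 * t)) =
    (c^-1 * d^-1 ^+ k.+1) \*: (bump k \o (fun s => d^-1 * s)) by [].
  apply: is_derive_eq; rewrite /GRing.scale/= [in RHS]exprSr; ring.
- move=> k; have [C C0 bC] := bump_bounded k.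
  have a0 : 0 <= c^-1 * d^-1 ^+ k.+1 by rewrite mulr_ge0 ?exprn_ge0 ?invr_ge0 ?ltW.
  exists (c^-1 * d^-1 ^+ k.+1 * C); first exact: mulr_ge0.
  by move=> t; rewrite normrM ger0_norm// ler_wpM2l.
- move=> k t dt; rewrite bump_out ?mulr0// normrM gtr0_norm ?invr_gt0//.
  by rewrite mulrC ler_pdivlMr// mul1r.
- split=> [t|].
    by rewrite !mulr_ge0 ?exprn_ge0 ?invr_ge0 ?(ltW c0) ?(ltW d0)// bump0_ge0.
  under eq_integral do rewrite EFinM.
  have d10 : d^-1 != 0 by rewrite invr_eq0 gt_eqF.
  have mb : measurable_fun setT (fun t : R => (bump 0 t)%:E).
    by apply/measurable_EFinP; exact: measurable_bump.
  have b0 t : (0 <= (bump 0 t)%:E)%E by rewrite lee_fin bump0_ge0.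
  have E := integral_affine1 0 d10 mb b0.
  rewrite cE gtr0_norm ?invr_gt0// in E.
  rewrite ge0_integralZl_EFin//; last 2 first.
  - apply/measurable_EFinP.
    apply: (@measurableT_comp _ _ _ _ _ _ (bump 0) _ (fun t => d^-1 * t)).
      exact: measurable_bump.
    exact: measurable_funM.
  - by rewrite mulr_ge0 ?exprn_ge0 ?invr_ge0 ?(ltW c0) ?(ltW d0).
  have E2 : (d^-1%:E * \int[leb]_t (bump 0 (d^-1 * t))%:E = c%:E)%E.
    rewrite [RHS]E; suff -> : (fun t => (bump 0 (d^-1 * t + 0))%:E) =
      (fun t : R => (bump 0 (d^-1 * t))%:E) by [].
    by apply/funext => t; rewrite addr0.
  rewrite expr1 EFinM -muleA [X in (_ * X)%E]E2.
  by rewrite -EFinM mulVf// gt_eqF.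
- split=> t; rewrite mulrN; first by rewrite bump0_even.
  by rewrite bump1_odd mulrN.
Qed.

End bump_line.

(** * Partial derivatives and regularity *)

Section coordinatewise_mean_value.
Context {R : realType} {n : nat}.
Local Notation e_ i := (delta_mx ord0 i : 'rV[R]_n).

(** A directional derivative is a derivative on a line, where the one-variable theory
    applies. *)
Lemma is_derive_line (f : 'rV[R]_n -> R) x v (df : R) :
  is_derive x v f df <-> is_derive (0 : R) 1 (fun h : R => f (h *: v + x)) df.
Proof.
have E : (fun h : R => h^-1 *: ((f \o shift x) (h *: v) - f x)) =
   (fun h : R => h^-1 *: (((fun h : R => f (h *: v + x)) \o shift 0) (h *: 1) -
     (fun h : R => f (h *: v + x)) 0)).
  by apply/funext => h /=; rewrite addr0 scale0r add0r [_%:A]mulr1.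
by split=> -[]; rewrite /derivable /derive => h1 h2; apply: DeriveDef;
  rewrite /derivable /derive ?E// -E.
Qed.

Lemma is_derive_along (f : 'rV[R]_n -> R) (g : 'rV[R]_n -> R) v x (t : R) :
  (forall y, is_derive y v f (g y)) ->
  is_derive t 1 (fun s : R => f (s *: v + x)) (g (t *: v + x)).
Proof.
move=> fg; have /is_derive_line d := fg (t *: v + x).
have d2 : is_derive t 1 (fun s : R => s - t) 1.
  have -> : (fun s : R => s - t) = id - cst t by apply/funext.
  by apply: is_derive_eq; rewrite subr0.
have -> : (fun s : R => f (s *: v + x)) =
  (fun h : R => f (h *: v + (t *: v + x))) \o (fun s => s - t).
  by apply/funext => s /=; rewrite addrA -scalerDl subrK.
rewrite -[g _]mulr1; apply: is_derive1_comp => //.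
by rewrite subrr.
Qed.

(** The path from x to x + h follows the coordinate axes, one after the other, so that
    only partial derivatives are used and no differentiability in R^n is needed. *)
Lemma mean_value_row (f : 'rV[R]_n -> R) (g : 'I_n -> 'rV[R]_n -> R)
    (x h : 'rV[R]_n) :
  (forall i y, is_derive y (e_ i) f (g i y)) ->
  exists xi : 'I_n -> 'rV[R]_n,
    (forall i j, `|xi i ord0 j - x ord0 j| <= `|h ord0 j|) /\
    f (x + h) - f x = \sum_(i < n) h ord0 i * g i (xi i).
Proof.
move=> fg.
(* the vertices of the path along the axes from x to x + h *)
pose p (k : nat) : 'rV[R]_n := \row_j (x ord0 j + if (j < k)%N then h ord0 j else 0).
have p0 : p 0%N = x by apply/rowP => j; rewrite mxE addr0.
have pn : p n = x + h by apply/rowP => j; rewrite !mxE ltn_ord.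
have pS (i : 'I_n) : p i.+1 = h ord0 i *: e_ i + p i.
  apply/rowP => j; rewrite !mxE eqxx/= ltnS leq_eqVlt.
  have [->|ji] := eqVneq j i; first by rewrite eqxx ltnn/= mulr1 addr0 addrC.
  by rewrite val_eqE (negbTE ji)/= mulr0 add0r.
have step (i : 'I_n) : exists xi : 'rV[R]_n,
    (forall j, `|xi ord0 j - x ord0 j| <= `|h ord0 j|) /\
    f (p i.+1) - f (p i) = h ord0 i * g i xi.
  pose phi (t : R) := f (t *: (e_ i) + p i).
  pose lin (s : R) := s * h ord0 i.
  have d1 (t : R) : is_derive t 1 phi (g i (t *: e_ i + p i)).
    by apply: is_derive_along; exact: fg.
  have d2 (s : R) : is_derive s 1 (phi \o lin) (g i (lin s *: e_ i + p i) * h ord0 i).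
    apply: is_derive1_comp; have -> : lin = (h ord0 i) \*: id.
      by apply/funext => u; rewrite /lin mulrC.
    by apply: is_derive_eq; rewrite /GRing.scale/= mulr1.
  have c2 : {within `[0, 1], continuous (phi \o lin)}.
    apply: continuous_subspaceT => s; apply: differentiable_continuous.
    by apply/derivable1_diffP; have [] := d2 s.
  have [s] := @MVT_segment R _ _ 0 1 ler01 (fun s _ => d2 s) c2.
  rewrite in_itv/= => /andP[s0 s1].
  rewrite subr0 mulr1 /lin/= mul1r mul0r /phi scale0r add0r -pS => E.
  exists ((s * h ord0 i) *: e_ i + p i); split; last by rewrite E mulrC.
  move=> j; rewrite !mxE eqxx/=; have [->|ji] := eqVneq j i.
    rewrite ltnn mulr1 addr0 addrK normrM ger0_norm//.
    by rewrite -[leRHS]mul1r ler_wpM2r.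
  rewrite mulr0 add0r addrC addKr; case: ifP => // _; by rewrite normr0.
have /choice[xi xiP] := step; exists xi; split; first by move=> i; exact: (xiP i).1.
rewrite -pn -[in f x]p0 -(telescope_sumr (f \o p) (leq0n n)) big_mkord.
by apply: eq_bigr => i _; exact: (xiP i).2.
Qed.

Lemma lipschitz_of_partials (f : 'rV[R]_n -> R) (g : 'I_n -> 'rV[R]_n -> R) (C : R)
    (x h : 'rV[R]_n) :
  (forall i y, is_derive y (e_ i) f (g i y)) ->
  (forall i (y : 'rV[R]_n), (forall j, `|y ord0 j - x ord0 j| <= `|h ord0 j|) -> `|g i y| <= C) ->
  `|f (x + h) - f x| <= n%:R * C * `|h|.
Proof.
move=> fg gC; have [xi [xi1 ->]] := mean_value_row x h fg.
apply: le_trans (ler_norm_sum _ _ _) _.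
have -> : n%:R * C * `|h| = \sum_(i < n) C * `|h|.
  by rewrite sumr_const card_ord -[RHS]mulr_natl mulrA.
apply: ler_sum => i _; rewrite normrM mulrC ler_pM//; last exact: normr_coord.
exact/gC/xi1.
Qed.

Lemma continuous_of_partials (f : 'rV[R]_n -> R) (g : 'I_n -> 'rV[R]_n -> R) :
  (forall i y, is_derive y (e_ i) f (g i y)) ->
  (forall M, exists C, forall i y, cube M y -> `|g i y| <= C) ->
  continuous f.
Proof.
move=> fg gC x A /nbhs_ballP[e /= e0 xA].
have [C0 gC0] := gC (`|x| + 1).
pose C := Num.max C0 0; have CC i y : cube (`|x| + 1) y -> `|g i y| <= C.
  by move=> h; rewrite le_max gC0.
have C0' : 0 <= C by rewrite le_max lexx orbT.
have D0 : 0 < n%:R * C + 1 by rewrite ltr_wpDl// mulr_ge0.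
apply/nbhs_ballP; exists (Num.min 1 (e / (n%:R * C + 1))) => /=.
  by rewrite lt_min ltr01 divr_gt0.
move=> y; rewrite mx_norm_ball /ball_/= lt_min distrC => /andP[xy1 xye].
apply: xA; rewrite /ball/= distrC -(subrKC x y).
apply: (@le_lt_trans _ _ (n%:R * C * `|y - x|)).
  apply: (lipschitz_of_partials fg) => i z zx; apply: CC; apply/cubeP => j.
  rewrite -(subrK (x ord0 j) (z ord0 j)) (le_trans (ler_normD _ _))//.
  rewrite addrC lerD ?normr_coord//.
  by rewrite (le_trans (zx j))// (le_trans (normr_coord _ _))// ltW.
apply: (@le_lt_trans _ _ ((n%:R * C + 1) * `|y - x|)).
  by rewrite ler_wpM2r// lerDl.
by rewrite mulrC -ltr_pdivlMr.
Qed.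

End coordinatewise_mean_value.

(** * Mollification in R^n *)

Section mollifier_kernel.
Context {R : realType} {n : nat} (d : R) (psi : nat -> R -> R).
Hypothesis psiP : is_mollifier d psi.
Local Notation mu := (lebesgue_row R n).
Local Notation e_ i := (delta_mx ord0 i : 'rV[R]_n).
Implicit Types (s : seq 'I_n) (x y : 'rV[R]_n).

(** The partial derivative, along the list of coordinates [s], of the product
    mollifier. *)
Definition kern s x : R := \prod_(i < n) psi (count_mem i s) (x ord0 i).

Lemma kern_derive s i x : is_derive x (e_ i) (kern s) (kern (i :: s) x).
Proof.
have [dpsi _ _ _ _] := psiP.
apply/is_derive_line.
pose c := \prod_(j < n | j != i) psi (count_mem j s) (x ord0 j).
have -> : (fun h : R => kern s (h *: e_ i + x)) =
  c \*: (psi (count_mem i s) \o (fun h => h + x ord0 i)).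
  apply/funext => h; rewrite /kern (bigD1 i)//= mulrC; congr (_ * _).
    by apply: eq_bigr => j ji; rewrite !mxE eqxx (negbTE ji) mulr0 add0r.
  by rewrite !mxE !eqxx mulr1.
have -> : kern (i :: s) x = c * (psi (count_mem i s).+1 (0 + x ord0 i) * 1).
  rewrite /kern (bigD1 i)//= mulrC eqxx add0r mulr1 add1n; congr (_ * _).
  by apply: eq_bigr => j ji; rewrite (eq_sym i j) (negbTE ji) add0n.
have D : is_derive (0 : R) 1 (psi (count_mem i s) \o (fun h => h + x ord0 i))
    (psi (count_mem i s).+1 (0 + x ord0 i) * 1); last exact: is_deriveZ.
  have D1 := dpsi (count_mem i s) (0 + x ord0 i).
  apply: (@is_derive1_comp _ _ (fun h : R => h + x ord0 i) 0 _ _ D1).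
  have -> : (fun h : R => h + x ord0 i) = id + cst (x ord0 i) by apply/funext.
  by apply: is_derive_eq; rewrite addr0.
Qed.

Lemma kern_bounded s : exists2 C, 0 <= C & forall x, `|kern s x| <= C.
Proof.
have [_ bpsi _ _ _] := psiP.
have /choice[C CP] : forall k, exists C, 0 <= C /\ forall t, `|psi k t| <= C.
  by move=> k; have [C C0 pC] := bpsi k; exists C.
exists (\prod_(i < n) C (count_mem i s)).
  by apply: prodr_ge0 => i _; exact: (CP _).1.
move=> x; rewrite /kern normr_prod; apply: ler_prod => i _.
by rewrite normr_ge0/=; exact: (CP _).2.
Qed.

Lemma kern_out s x i : d <= `|x ord0 i| -> kern s x = 0.
Proof.
have [_ _ opsi _ _] := psiP.
by move=> dx; rewrite /kern (bigD1 i)//= opsi// mul0r.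
Qed.

Lemma kern_supp s x : kern s x != 0 -> forall i, `|x ord0 i| < d.
Proof.
move=> k0 i; rewrite ltNge; apply/negP => dx.
by rewrite (kern_out _ dx) eqxx in k0.
Qed.

Lemma kern_continuous s : continuous (kern s).
Proof.
apply: (continuous_of_partials (kern_derive s)) => M.
have /choice[C CP] : forall i : 'I_n, exists C, 0 <= C /\ forall x, `|kern (i :: s) x| <= C.
  by move=> i; have [C C0 pC] := kern_bounded (i :: s); exists C.
exists (\sum_(i < n) C i) => i y _; apply: le_trans ((CP i).2 y) _.
by rewrite (bigD1 i)//= lerDl sumr_ge0// => j _; exact: (CP j).1.
Qed.

Lemma measurable_kern s : measurable_fun setT (kern s).
Proof. by apply: continuous_measurable_row; exact: kern_continuous. Qed.

Lemma kern0_ge0 x : 0 <= kern [::] x.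
Proof.
have [_ _ _ [p0 _] _] := psiP.
by apply: prodr_ge0 => i _; exact: p0.
Qed.

Lemma kern1_odd i x : kern [:: i] (- x) = - kern [:: i] x.
Proof.
have [_ _ _ _ [ev od]] := psiP.
rewrite /kern (bigD1 i)//= [in RHS](bigD1 i)//= eqxx mxE od mulNr; congr (- (_ * _)).
by apply: eq_bigr => j ji; rewrite (eq_sym i j) (negbTE ji) mxE ev.
Qed.

End mollifier_kernel.

Lemma kern0_integral {R : realType} {n : nat} (d : R) psi :
  is_mollifier d psi ->
  (\int[lebesgue_row R n]_x (kern psi [::] x)%:E = 1)%E.
Proof.
move=> psiP; elim: n => [|n IH].
  have mk := @measurable_kern R 0 d psi psiP [::].
  by rewrite integral_row0; [rewrite /kern big_ord0|exact/measurable_EFinP].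
have mk := @measurable_kern R n.+1 d psi psiP [::].
have mk' := @measurable_kern R n d psi psiP [::].
rewrite integral_row_cons; last 2 first.
- exact/measurable_EFinP.
- by move=> x; rewrite lee_fin; exact: kern0_ge0 psiP _.
have [_ _ _ [p0 p1] _] := psiP.
rewrite -[RHS]p1; apply: eq_integral => a _.
rewrite -[RHS]mule1 -IH -ge0_integralZl_EFin//.
- apply: eq_integral => x _; rewrite -EFinM /kern big_ord_recl; congr (_ * _)%:E.
    by rewrite mxE unlift_none.
  by apply: eq_bigr => i _; rewrite mxE liftK.
- by move=> x _; rewrite lee_fin; exact: kern0_ge0 psiP _.
- exact/measurable_EFinP.
Qed.

Section convolution.
Context {R : realType} {n : nat} (d : R) (psi : nat -> R -> R).
Hypothesis psiP : is_mollifier d psi.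
Local Notation mu := (lebesgue_row R n).
Local Notation e_ i := (delta_mx ord0 i : 'rV[R]_n).
Local Notation kern := (kern psi).
Implicit Types (s : seq 'I_n) (x y : 'rV[R]_n) (w u v : 'rV[R]_n -> R).

(** Local integrability tested on cubes, which are measurable and exhaust R^n. *)
Definition locally_integrable_cube w :=
  forall M, mu.-integrable (@cube R n M) (EFin \o w).

Definition cut w (M : R) y : R := w y * \1_(@cube R n M) y.

Lemma integrable_cut w M : locally_integrable_cube w ->
  mu.-integrable setT (EFin \o cut w M).
Proof.
move=> /(_ M) /(integrable_mkcond _ (@measurable_cube R n M)).
congr (integrable _ _ _); apply/funext => y.
by rewrite /patch /cut/= indicE; case: ifP => _; rewrite ?mulr1 ?mulr0.
Qed.

(** Mollification, and its partial derivatives along the list s. *)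
Definition conv s w x : R := (\int[mu]_y (kern s (x - y) * w y))%R.

Lemma convE s w x : conv s w x = (\int[mu]_y (kern s (x - y) * w y))%R.
Proof. by []. Qed.

Lemma measurable_kern_sub s x : measurable_fun setT (fun y => kern s (x - y)).
Proof.
rewrite (_ : (fun _ => _) = kern s \o (fun y => -1 *: y + x)).
  exact: measurableT_comp (measurable_kern psiP s) (measurable_row_affine (-1) x).
by apply/funext => y /=; rewrite scaleN1r addrC.
Qed.

Lemma kern_cut s w M x y : (forall i, `|x ord0 i| <= M) ->
  kern s (x - y) * w y = kern s (x - y) * cut w (M + d) y.
Proof.
move=> xM; have [->|k0] := eqVneq (kern s (x - y)) 0; first by rewrite !mul0r.
congr (_ * _); rewrite /cut indicE mem_set ?mulr1//.
apply/cubeP => i; have := kern_supp psiP k0 i; rewrite !mxE => xy.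
have -> : y ord0 i = x ord0 i - (x ord0 i - y ord0 i) by rewrite subKr.
by rewrite (le_trans (ler_normB _ _))// lerD// ltW.
Qed.

Lemma integrable_conv s w x : measurable_fun setT w -> locally_integrable_cube w ->
  mu.-integrable setT (fun y => (kern s (x - y) * w y)%:E).
Proof.
move=> mw lw; have [C C0 kC] := kern_bounded psiP s.
have iw := integrableZl measurableT C (integrable_cut (`|x| + d) lw).
apply: le_integrable iw => //.
  by apply/measurable_EFinP; apply: measurable_funM => //; exact: measurable_kern_sub.
move=> y _; rewrite (kern_cut s w y (normr_coord x)) /= lee_fin !normrM.
by rewrite ler_wpM2r// (le_trans (kC _))// ler_norm.
Qed.

Lemma conv_EFin s w x : measurable_fun setT w -> locally_integrable_cube w ->
  (conv s w x)%:E = (\int[mu]_y (kern s (x - y) * w y)%:E)%E.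
Proof.
move=> mw lw; rewrite /conv /Rintegral fineK//.
by apply: integrable_fin_num => //; exact: integrable_conv.
Qed.

Lemma conv_bounded s w M : measurable_fun setT w -> locally_integrable_cube w ->
  exists C, forall x, @cube R n M x -> `|conv s w x| <= C.
Proof.
move=> mw lw; have [C C0 kC] := kern_bounded psiP s.
have iw := integrable_cut (M + d) lw.
have iaw : mu.-integrable setT (fun y => (`|cut w (M + d) y|)%:E).
  have := integrable_abse iw.
  by congr (integrable _ _ _); apply/funext => y.
exists (C * fine (\int[mu]_y (`|cut w (M + d) y|)%:E)%E) => x /cubeP xM.
have fin : (\int[mu]_y (`|cut w (M + d) y|)%:E)%E \is a fin_num.
  exact: integrable_fin_num.
rewrite -lee_fin EFinM fineK//.
have iK := integrable_conv s x mw lw.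
rewrite (_ : (`|conv s w x|)%:E = `|(conv s w x)%:E|%E)// conv_EFin//.
have mK : measurable_fun setT (fun y => (kern s (x - y) * w y)%:E).
  exact: measurable_int iK.
apply: le_trans (le_abse_integral mu measurableT mK) _.
rewrite -ge0_integralZl_EFin//; last exact: measurable_int iaw.
apply: ge0_le_integral => //.
- exact: measurableT_comp.
- by apply: measurable_funeM; exact: measurable_int iaw.
move=> y _; rewrite (kern_cut s w y xM) /= lee_fin normrM.
by rewrite ler_wpM2r.
Qed.

(** Differentiation under the integral sign, dominated by a multiple of |w| on a cube: the
    derivative falls on the kernel, and w is only locally integrable. *)
Lemma conv_derive s i w x : measurable_fun setT w -> locally_integrable_cube w ->
  is_derive x (e_ i) (conv s w) (conv (i :: s) w x).
Proof.
move=> mw lw; have [C C0 kC] := kern_bounded psiP (i :: s).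
pose f (h : R) y := kern s (h *: e_ i + x - y) * w y.
have df (h : R) y : is_derive h 1 (f ^~ y) (kern (i :: s) (h *: e_ i + x - y) * w y).
  have D : is_derive h 1 (fun h : R => kern s (h *: e_ i + (x - y)))
      (kern (i :: s) (h *: e_ i + (x - y))).
    by apply: is_derive_along => z; exact: (kern_derive psiP).
  have -> : f ^~ y = w y \*: (fun h : R => kern s (h *: e_ i + (x - y))).
    by apply/funext => t; rewrite /f/= mulrC addrA.
  by rewrite -addrA mulrC; exact: is_deriveZ.
have d1f h y : partial1of2 f h y = kern (i :: s) (h *: e_ i + x - y) * w y.
  by rewrite partial1of2E; have [_ ->] := df h y.
(* only w on this cube is seen by the kernels centred at distance less than 1 from x *)
pose M := `|x| + 1 + d.
pose G y := C * `|cut w M y|.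
have G0 y : 0 <= G y by rewrite mulr_ge0.
have iG : mu.-integrable setT (EFin \o G).
  have := integrableZl measurableT C (integrable_abse (integrable_cut M lw)).
  by congr (integrable _ _ _); apply/funext => y.
have I0 : `]-1, 1[%classic (0 : R) by rewrite /= in_itv/= oppr_lt0 ltr01.
have If h : `]-1, 1[%classic h -> mu.-integrable setT (EFin \o f h).
  by move=> _; exact: integrable_conv.
have Gub (h : R) y : `]-1, 1[%classic h -> setT y -> `|partial1of2 f h y| <= G y.
  rewrite /= in_itv/= -ltr_norml => h1 _; rewrite d1f.
  rewrite (@kern_cut _ w (`|x| + 1)); last first.
    move=> j; rewrite !mxE eqxx/= addrC (le_trans (ler_normD _ _))// lerD ?normr_coord//.
    by rewrite normrM normr_nat; case: (j == i); rewrite ?mulr1 ?mulr0// ltW.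
  by rewrite normrM ler_wpM2r.
have der h y : `]-1, 1[%classic h -> setT y -> derivable (f ^~ y) h 1.
  by move=> _ _; have [] := df h y.
have D1 := @derivable_under_integral R _ _ mu f setT measurableT 0 (-1) 1 I0 If der G G0 iG Gub.
have D2 := @differentiation_under_integral R _ _ mu f setT measurableT 0 (-1) 1 I0 If der G G0 iG Gub.
apply/is_derive_line; apply: DeriveDef; first exact: D1.
rewrite -derive1E; apply: etrans D2 _.
by apply: eq_Rintegral => y _; rewrite d1f scale0r add0r.
Qed.

Lemma conv_continuous s w : measurable_fun setT w -> locally_integrable_cube w ->
  continuous (conv s w).
Proof.
move=> mw lw.
apply: (continuous_of_partials (fun i x => conv_derive s i x mw lw)) => M.
have /choice[C CP] : forall i : 'I_n, exists C, forall x, @cube R n M x -> `|conv (i :: s) w x| <= C.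
  by move=> i; exact: conv_bounded.
exists (\sum_(i < n) `|C i|) => i y yM; apply: le_trans (CP i y yM) _.
by rewrite (le_trans (ler_norm _))// (bigD1 i)//= lerDl sumr_ge0.
Qed.

Lemma measurable_conv s w : measurable_fun setT w -> locally_integrable_cube w ->
  measurable_fun setT (conv s w).
Proof. by move=> mw lw; apply: continuous_measurable_row; exact: conv_continuous. Qed.

Lemma conv_out s w M x : (forall y, ~ @cube R n M y -> w y = 0) ->
  ~ @cube R n (M + d) x -> conv s w x = 0.
Proof.
move=> w0 xM; rewrite /conv (_ : (fun y => _) = cst 0).
  by rewrite /Rintegral integral0.
apply/funext => y /=; have [yM|/w0 ->] := pselect (@cube R n M y); last by rewrite mulr0.
have [->|k0] := eqVneq (kern s (x - y)) 0; first by rewrite mul0r.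
exfalso; apply: xM; apply/cubeP => i.
move/cubeP : yM => /(_ i) yM; have := kern_supp psiP k0 i; rewrite !mxE => xy.
by rewrite -(subrK (y ord0 i) (x ord0 i)) (le_trans (ler_normD _ _))// addrC lerD// ltW.
Qed.

Lemma measurable_prod_kern_sub s : measurable_fun setT
  (fun p : 'rV[R]_n * 'rV[R]_n => kern s (p.1 - p.2)).
Proof.
apply: (measurableT_comp (measurable_kern psiP s)).
apply: measurable_fun_row => i.
rewrite (_ : (fun _ => _) = (fun p : 'rV[R]_n * 'rV[R]_n => row_coord i p.1 - row_coord i p.2)).
  by apply: measurable_funB; apply: measurableT_comp => //; exact: measurable_row_coord.
by apply/funext => p; rewrite /row_coord !mxE.
Qed.

(** The derivative falls on the kernel, which is odd in that direction: no
    integration by parts is involved. *)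
Lemma conv_adjoint i u v (M K : R) : measurable_fun setT u -> locally_integrable_cube u ->
  measurable_fun setT v -> (forall y, `|v y| <= K) ->
  (forall y, ~ @cube R n M y -> v y = 0) ->
  (\int[mu]_x (u x * conv [:: i] v x)%:E = - \int[mu]_y (v y * conv [:: i] u y)%:E)%E.
Proof.
move=> mu_ lu mv vK v0.
have lv : locally_integrable_cube v.
  move=> L; apply: measurable_bounded_integrable => //.
  - exact: measurable_cube.
  - exact: measure_cube_lty.
  - exact: measurable_funTS.
  - exists K; split; first exact: num_real.
    by move=> z Kz y _; exact: le_trans (vK y) (ltW Kz).
have [C C0 kC] := kern_bounded psiP [:: i].
pose F (p : 'rV[R]_n * 'rV[R]_n) : \bar R := (u p.1 * (kern [:: i] (p.1 - p.2) * v p.2))%:E.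
have mF : measurable_fun setT F.
  apply/measurable_EFinP; apply: measurable_funM.
    exact: measurableT_comp mu_ measurable_fst.
  apply: measurable_funM; first exact: measurable_prod_kern_sub.
  exact: measurableT_comp mv measurable_snd.
have vcut : v = cut v M.
  apply/funext => y; rewrite /cut indicE.
  have [yM|yM] := pselect (@cube R n M y); first by rewrite mem_set ?mulr1.
  by rewrite v0 ?mul0r.
have iu := integrable_cut (M + d) lu.
have iv : mu.-integrable setT (EFin \o v) by rewrite vcut; exact: integrable_cut.
have Fle x y : (`|F (x, y)| <= C%:E * (`|(cut u (M + d) x)%:E| * `|(v y)%:E|))%E.
  rewrite /F/= lee_fin [in leLHS]normrM [in leLHS]normrM.
  have [->|vy] := eqVneq (v y) 0; first by rewrite normr0 !mulr0.
  have [->|k0] := eqVneq (kern [:: i] (x - y)) 0.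
    by rewrite normr0 mul0r mulr0 !mulr_ge0.
  have -> : cut u (M + d) x = u x.
    rewrite /cut indicE mem_set ?mulr1//; apply/cubeP => j.
    have yM : @cube R n M y by apply: contrapT => /v0 /eqP; apply/negP.
    move/cubeP : yM => /(_ j) yM; have := kern_supp psiP k0 j; rewrite !mxE => xy.
    by rewrite -(subrK (y ord0 j) (x ord0 j)) (le_trans (ler_normD _ _))// addrC lerD// ltW.
  by rewrite [leRHS]mulrCA ler_wpM2l// ler_wpM2r.
have iF : (mu \x mu)%E.-integrable setT F.
  apply/(integrable12ltyP _ _ mF).
  apply: (@le_lt_trans _ _ (\int[mu]_x ((C%:E * `|(cut u (M + d) x)%:E|) * \int[mu]_y `|(v y)%:E|))%E).
    apply: ge0_le_integral => //.
    - by move=> x _; exact: integral_ge0.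
    - apply: (@measurable_fun_fubini_tonelli_F _ _ _ _ _ _ (abse \o F)) => //.
        exact: measurableT_comp.
      by move=> p; exact: abse_ge0.
    - apply: emeasurable_funM => //; apply: measurable_funeM.
      by apply: measurableT_comp => //; exact: measurable_int iu.
    move=> x _; rewrite -ge0_integralZl//; last 2 first.
    - by apply: measurableT_comp => //; exact: measurable_int iv.
    - by rewrite mule_ge0// lee_fin.
    apply: ge0_le_integral => //.
    - apply: measurableT_comp => //.
      exact: (measurableT_comp mF (pair1_measurable x)).
    - by apply: measurable_funeM; apply: measurableT_comp => //; exact: measurable_int iv.
    by move=> y _; rewrite -muleA; exact: Fle.
  have /integrableP[_ iu'] := iu; have /integrableP[_ iv'] := iv.
  rewrite ge0_integralZr//; last 3 first.
  - apply: measurable_funeM; apply: measurableT_comp => //; exact: measurable_int iu.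
  - by move=> x _; rewrite mule_ge0// lee_fin.
  - exact: integral_ge0.
  rewrite ge0_integralZl_EFin//; last first.
    by apply: measurableT_comp => //; exact: measurable_int iu.
  apply: lte_mul_pinfty => //.
  - by rewrite mule_ge0//; exact: integral_ge0.
  - rewrite ge0_fin_numE; first by apply: lte_mul_pinfty.
    by rewrite mule_ge0//; exact: integral_ge0.
have FE := Fubini iF.
transitivity (\int[mu]_x \int[mu]_y F (x, y))%E.
  apply: eq_integral => x _; rewrite EFinM conv_EFin// -integralZl//; last exact: integrable_conv.
rewrite FE.
transitivity (\int[mu]_y (- (v y * conv [:: i] u y)%:E))%E; last first.
  apply: integralN => /=; apply: integrable_add_def; first exact: measurableT.
  have [C' C'P] := conv_bounded [:: i] M mu_ lu.
  have iv' := integrableZl measurableT C' iv.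
  apply: le_integrable iv' => //.
    by apply/measurable_EFinP; apply: measurable_funM => //; exact: measurable_conv.
  move=> y _ /=; rewrite lee_fin.
  have [yM|/v0 ->] := pselect (@cube R n M y); last by rewrite mul0r normr0.
  by rewrite !normrM mulrC ler_wpM2r// (le_trans (C'P _ yM))// ler_norm.
apply: eq_integral => y _; rewrite -EFinN.
have -> : - (v y * conv [:: i] u y) = (- v y) * conv [:: i] u y by rewrite mulNr.
rewrite EFinM conv_EFin// -integralZl//; last exact: integrable_conv.
apply: eq_integral => x _; rewrite /F/= -EFinM -(opprB y x) (kern1_odd psiP)//.
by congr (_%:E); ring.
Qed.

End convolution.

(** * The total variation bounds the gradients of the mollifications *)

Section test_fields.
Context {R : realType} {n : nat} (d : R) (psi : nat -> R -> R).
Hypothesis psiP : is_mollifier d psi.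
Local Notation mu := (lebesgue_row R n).
Local Notation e_ i := (delta_mx ord0 i : 'rV[R]_n).
Local Notation kern := (kern psi).
Local Notation conv := (conv psi).
Implicit Types (s : seq 'I_n) (x y : 'rV[R]_n) (w u : 'rV[R]_n -> R)
  (v : 'I_n -> 'rV[R]_n -> R).

Lemma conv_scale s (a : R) w x : measurable_fun setT w -> locally_integrable_cube w ->
  conv s (fun y => a * w y) x = a * conv s w x.
Proof.
move=> mw lw; rewrite !convE.
under eq_Rintegral do rewrite mulrCA.
by rewrite RintegralZl//; exact: (integrable_conv psiP).
Qed.

Lemma locally_integrable_bounded w (K : R) : measurable_fun setT w ->
  (forall y, `|w y| <= K) -> locally_integrable_cube w.
Proof.
move=> mw wK L; apply: measurable_bounded_integrable.
- exact: measurable_cube.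
- exact: measure_cube_lty.
- exact: measurable_funTS.
- exists K; split; first exact: num_real.
  by move=> z Kz y _; exact: le_trans (wK y) (ltW Kz).
Qed.

Lemma conv_sum s v (a : 'I_n -> R) x : (forall j, measurable_fun setT (v j)) ->
  (forall j, locally_integrable_cube (v j)) ->
  conv s (fun y => \sum_(j < n) a j * v j y) x = \sum_(j < n) a j * conv s (v j) x.
Proof.
move=> mv lv; apply: EFin_inj.
have mS : measurable_fun setT (fun y => \sum_(j < n) a j * v j y).
  by apply: measurable_sum => j; exact: measurable_funM.
have ij j : mu.-integrable setT (fun y => (a j)%:E * (kern s (x - y) * v j y)%:E)%E.
  by apply: integrableZl => //; exact: (integrable_conv psiP).
have E y : (kern s (x - y) * (\sum_(j < n) a j * v j y))%:E =
   (\sum_(j < n) (a j)%:E * (kern s (x - y) * v j y)%:E)%E.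
  by rewrite mulr_sumr -sumEFin; apply: eq_bigr => j _; rewrite mulrCA.
rewrite (conv_EFin psiP)//; last first.
  move=> M; rewrite (_ : EFin \o _ = (fun y => \sum_(j < n) (a j)%:E * (v j y)%:E)%E).
    apply: integrable_sum; first exact: measurable_cube.
    by move=> j _; apply: integrableZl; [exact: measurable_cube|exact: lv].
  by apply/funext => y; rewrite /= -sumEFin.
under eq_integral do rewrite E.
rewrite integral_sum//= -sumEFin; apply: eq_bigr => j _.
by rewrite EFinM (conv_EFin psiP)// integralZl//; exact: (integrable_conv psiP).
Qed.

Lemma integral_kern_sub x : (\int[mu]_y (kern [::] (x - y))%:E = 1)%E.
Proof.
rewrite -(kern0_integral (n := n) psiP).
apply: (integral_reflect x (f := fun y => (kern [::] y)%:E)).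
  by apply/measurable_EFinP; exact: (measurable_kern psiP).
by move=> y; rewrite lee_fin (kern0_ge0 psiP).
Qed.

Lemma conv_le_cst w (c : R) x : measurable_fun setT w -> locally_integrable_cube w ->
  (forall y, w y <= c) -> conv [::] w x <= c.
Proof.
move=> mw lw wc.
have lc : locally_integrable_cube (cst c : 'rV[R]_n -> R).
  by apply: (@locally_integrable_bounded _ `|c|).
have -> : c = conv [::] (cst c) x.
  rewrite convE /Rintegral.
  under eq_integral do rewrite mulrC EFinM.
  rewrite integralZl//; last first.
    apply/integrableP; split.
      by apply/measurable_EFinP; exact: (measurable_kern_sub psiP).
    under eq_integral do rewrite gee0_abs ?lee_fin ?(kern0_ge0 psiP)//.
    by rewrite integral_kern_sub ltry.
  by rewrite integral_kern_sub mule1.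
apply: le_Rintegral => //; [exact: (integrable_conv psiP)..|].
by move=> y _; rewrite ler_wpM2l// (kern0_ge0 psiP).
Qed.

Definition mollified_field v : 'rV[R]_n -> 'rV[R]_n :=
  fun x => \row_j conv [::] (v j) x.

(** Bounded measurable fields supported in a cube: their mollifications are the test fields
    that are fed to the definition of the total variation. *)
Definition raw_field v (M K : R) : Prop :=
  [/\ forall j, measurable_fun setT (v j),
      forall y, enorm (\row_j v j y) <= K &
      forall j y, ~ @cube R n M y -> v j y = 0].

Lemma raw_field_bounded v (M K : R) j y : raw_field v M K -> `|v j y| <= K.
Proof.
move=> [_ v1 _]; apply: le_trans (v1 y).
by have := normr_coord_enorm (\row_j v j y) j; rewrite mxE.
Qed.

Lemma raw_field_locally_integrable v (M K : R) j : raw_field v M K -> locally_integrable_cube (v j).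
Proof.
move=> rv; have [mv _ _] := rv.
by apply: (@locally_integrable_bounded _ K) => // y; exact: raw_field_bounded rv.
Qed.

Lemma row_continuous (g : 'I_n -> 'rV[R]_n -> R) :
  (forall j, continuous (g j)) -> continuous (fun x => \row_j g j x).
Proof.
move=> gc x A /nbhs_rowP[e e0 xA].
have : \forall y \near x, forall j, `|g j y - g j x| < e.
  apply: (@filter_forall _ _ _ (nbhs x) (nbhs_filter x)) => j; have /cvgrPdist_lt/(_ e e0) := gc j x.
  by apply: filterS => y; rewrite distrC.
apply: filterS => y h; apply: xA => i; rewrite !mxE; exact: h.
Qed.

Lemma partial_row (g dg : 'I_n -> 'rV[R]_n -> R) i :
  (forall j x, is_derive x (e_ i) (g j) (dg j x)) ->
  (forall x, derivable (fun x => \row_j g j x) x (e_ i)) /\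
  partial i (fun x => \row_j g j x) = (fun x => \row_j dg j x).
Proof.
move=> gd.
have D x : derivable (fun x => \row_j g j x) x (e_ i).
  apply/derivable_mxP => a j; rewrite (_ : (fun _ => _) = g j); first by have [] := gd j x.
  by apply/funext => y; rewrite mxE.
split=> //; apply/funext => x; rewrite /partial derive_mx//.
apply/matrixP => a j; rewrite !mxE.
rewrite (_ : (fun _ => _) = g j); first by have [_ ->] := gd j x.
by apply/funext => y; rewrite mxE.
Qed.

Lemma mollified_field_partials v (M K : R) s : raw_field v M K ->
  foldr (@partial R n) (mollified_field v) s = (fun x => \row_j conv s (v j) x).
Proof.
move=> rv; elim: s => [|i s IH] //=; rewrite IH.
have [mv _ _] := rv.
have := @partial_row (fun j => conv s (v j)) (fun j => conv (i :: s) (v j)) i.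
case=> // j x; apply: (conv_derive psiP) => //; exact: raw_field_locally_integrable rv.
Qed.

Lemma mollified_field_smooth v (M K : R) : raw_field v M K -> smooth (mollified_field v).
Proof.
move=> rv s; have [mv _ _] := rv.
have lv j := raw_field_locally_integrable j rv.
rewrite (mollified_field_partials s rv); split.
  by apply: row_continuous => j; exact: (conv_continuous psiP).
move=> i x.
have [] := @partial_row (fun j => conv s (v j)) (fun j => conv (i :: s) (v j)) i; last by [].
by move=> j y; apply: (conv_derive psiP).
Qed.

Lemma mollified_field_supp v (M K : R) : raw_field v M K ->
  compactly_supported (mollified_field v).
Proof.
move=> [_ _ v0].
have cc : closed (@cube R n (M + d)).
  by apply: compact_closed; [exact: norm_hausdorff|exact: compact_cube].
apply: (subclosed_compact (@closed_closure _ _) (@compact_cube R n (M + d))).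
rewrite [X in _ `<=` X]((closure_id _).1 cc); apply: closureS => x /= wx.
apply: contrapT => xM; move/eqP: wx; apply; apply/rowP => j; rewrite !mxE.
by apply: (conv_out psiP) xM; exact: v0.
Qed.

Lemma mollified_field_divergence v (M K : R) x : raw_field v M K ->
  divergence (mollified_field v) x = \sum_(i < n) conv [:: i] (v i) x.
Proof.
move=> rv; apply: eq_bigr => i _.
have := mollified_field_partials [:: i] rv => /= ->.
by rewrite mxE.
Qed.

(** Mollification does not increase the Euclidean norm: pair the mollified vector with
    itself and apply the Cauchy-Schwarz inequality under the integral. *)
Lemma mollified_field_le v (M K : R) x : raw_field v M K ->
  enorm (mollified_field v x) <= K.
Proof.
move=> rv; have [mv vK _] := rv; have lv j := raw_field_locally_integrable j rv.
set r := mollified_field v x.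
have [r0|r0] := eqVneq (enorm r) 0; first by rewrite r0 (le_trans _ (vK 0))// enorm_ge0.
have rp : 0 < enorm r by rewrite lt_def r0 enorm_ge0.
suff : enorm r ^+ 2 <= enorm r * K by rewrite expr2 ler_pM2l.
rewrite enorm_sqr.
have -> : \sum_(i < n) r ord0 i ^+ 2 = conv [::] (fun y => \sum_(j < n) r ord0 j * v j y) x.
  by rewrite conv_sum//; apply: eq_bigr => i _; rewrite expr2 {2}/r mxE.
have le1 y : `|\sum_(j < n) r ord0 j * v j y| <= \sum_(j < n) `|r ord0 j| * K.
  apply: le_trans (ler_norm_sum _ _ _) _; apply: ler_sum => j _.
  by rewrite normrM ler_wpM2l// (raw_field_bounded _ _ rv).
have mS : measurable_fun setT (fun y => \sum_(j < n) r ord0 j * v j y).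
  by apply: measurable_sum => j; exact: measurable_funM.
apply: conv_le_cst => //; first exact: locally_integrable_bounded le1.
move=> y; have := cauchy_schwarz r (\row_j v j y).
under eq_bigr do rewrite mxE.
by move=> /le_trans; apply; rewrite ler_wpM2l// enorm_ge0.
Qed.

End test_fields.

Lemma measurable_inv_ge0 (R : realType) d (T : measurableType d) (f : T -> R) :
  measurable_fun setT f -> (forall x, 0 <= f x) ->
  measurable_fun setT (fun x => (f x)^-1).
Proof.
move=> mf f0; rewrite (_ : (fun _ => _) = (@powR R ^~ (-1)) \o f).
  exact: measurableT_comp (measurable_powR (-1)) mf.
by apply/funext => x /=; rewrite powR_inv1.
Qed.

Section bv_dual.
Context {R : realType} {n : nat}.
Local Notation mu := (lebesgue_row R n).
Implicit Types (x y : 'rV[R]_n) (u w : 'rV[R]_n -> R) (v : 'I_n -> 'rV[R]_n -> R).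

Lemma raw_field_scale v (M K a : R) : raw_field v M K ->
  raw_field (fun j y => a * v j y) M (`|a| * K).
Proof.
move=> [mv vK v0]; split.
- by move=> j; exact: measurable_funM.
- move=> y; rewrite (_ : (\row_j _) = a *: (\row_j v j y)).
    by rewrite enormZ ler_wpM2l.
  by apply/rowP => j; rewrite !mxE.
- by move=> j y yM; rewrite v0// mulr0.
Qed.

Section with_mollifier.
Context (d : R) (psi : nat -> R -> R).
Hypothesis psiP : is_mollifier d psi.
Local Notation conv := (conv psi).
Local Notation W := (mollified_field psi).

Lemma integrable_mul_conv u s w (M K : R) : measurable_fun setT u ->
  locally_integrable_cube u -> measurable_fun setT w -> (forall y, `|w y| <= K) ->
  (forall y, ~ @cube R n M y -> w y = 0) ->
  mu.-integrable setT (fun x => (u x * conv s w x)%:E).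
Proof.
move=> mu_ lu mw wK w0.
have lw : locally_integrable_cube w by exact: locally_integrable_bounded wK.
have [C CP] := conv_bounded psiP s (M + d) mw lw.
have iu := integrableZl measurableT C (integrable_cut (M + d) lu).
apply: le_integrable iu => //.
  by apply/measurable_EFinP; apply: measurable_funM => //; exact: (measurable_conv psiP).
move=> x _ /=; rewrite lee_fin /cut indicE.
have [xM|xM] := pselect (@cube R n (M + d) x).
  rewrite mem_set// mulr1 !normrM mulrC ler_wpM2r//.
  by rewrite (le_trans (CP x xM))// ler_norm.
by rewrite (@conv_out R n d psi psiP s w M x w0 xM) mulr0 normr0.
Qed.

(** The mollification and the derivative are moved from the test field to u; the sign comes
    from the oddness of the derived kernel. *)
Lemma pairing u v (M K : R) : measurable_fun setT u -> locally_integrable_cube u ->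
  raw_field v M K ->
  mu.-integrable setT (fun x => (u x * divergence (W v) x)%:E) /\
  (\int[mu]_x (u x * divergence (W v) x)%:E =
   \int[mu]_y (- \sum_(i < n) v i y * conv [:: i] u y)%:E)%E.
Proof.
move=> mu_ lu rv; have [mv vK v0] := rv.
have bv i y := raw_field_bounded i y rv.
have lv i := raw_field_locally_integrable i rv.
have ii i := integrable_mul_conv [:: i] mu_ lu (mv i) (bv i) (v0 i).
have E x : (u x * divergence (W v) x)%:E =
    (\sum_(i < n) (u x * conv [:: i] (v i) x)%:E)%E.
  by rewrite (mollified_field_divergence psiP x rv) mulr_sumr sumEFin.
have bvK i y : `|- v i y| <= K by rewrite normrN.
have ci i : mu.-integrable setT (fun y => (- (v i y * conv [:: i] u y))%:E).
  have [C CP] := conv_bounded psiP [:: i] M mu_ lu.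
  have iv : mu.-integrable setT (EFin \o v i).
    have := integrable_cut M (lv i); congr (integrable _ _ _).
    apply/funext => y /=; rewrite /cut indicE.
    have [yM|yM] := pselect (@cube R n M y); first by rewrite mem_set ?mulr1.
    by rewrite v0 ?mul0r.
  have iv' := integrableZl measurableT C iv.
  apply: le_integrable iv' => //.
    apply/measurable_EFinP; apply: measurableT_comp => //.
    by apply: measurable_funM => //; exact: (measurable_conv psiP).
  move=> y _ /=; rewrite lee_fin normrN.
  have [yM|/v0 ->] := pselect (@cube R n M y); last by rewrite mul0r normr0.
  by rewrite !normrM mulrC ler_wpM2r// (le_trans (CP _ yM))// ler_norm.
split.
  rewrite (_ : (fun x => _) = (fun x => \sum_(i < n) (u x * conv [:: i] (v i) x)%:E)%E).
    by apply: integrable_sum => // i _; exact: ii.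
  exact/funext.
under eq_integral do rewrite E.
rewrite integral_sum//.
under [RHS]eq_integral do rewrite -sumrN -sumEFin.
rewrite integral_sum//; apply: eq_bigr => i _.
rewrite (conv_adjoint psiP i mu_ lu (mv i) (bv i) (v0 i)).
rewrite -integralN; last first.
  apply: integrable_add_def => //.
  have := integrableN (ci i); congr (integrable _ _ _).
  by apply/funext => y /=; rewrite opprK.
by apply: eq_integral => y _; rewrite EFinN.
Qed.

Lemma mollified_field_scale v (M K a : R) x : raw_field v M K ->
  W (fun j y => a * v j y) x = a *: W v x.
Proof.
move=> rv; have [mv _ _] := rv; apply/rowP => j; rewrite !mxE.
by apply: (conv_scale psiP) => //; exact: raw_field_locally_integrable rv.
Qed.

Lemma divergence_scale v (M K a : R) x : raw_field v M K ->
  divergence (W (fun j y => a * v j y)) x = a * divergence (W v) x.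
Proof.
move=> rv; have [mv _ _] := rv.
rewrite (mollified_field_divergence psiP x rv).
rewrite (mollified_field_divergence psiP x (raw_field_scale a rv)) mulr_sumr.
apply: eq_bigr => i _; apply: (conv_scale psiP) => //.
exact: raw_field_locally_integrable rv.
Qed.

(** Test fields have sup norm exactly 1, so a mollified field is divided by its sup norm c,
    which is positive since the field does not vanish. *)
Lemma bv_ge_rescaled u v (M K : R) : measurable_fun setT u -> locally_integrable_cube u ->
  raw_field v M K -> (exists x, W v x != 0) ->
  exists c, [/\ 0 < c, c <= K &
    (\int[mu]_x (u x * divergence (W v) x)%:E <= c%:E * bv_seminorm u)%E].
Proof.
move=> mu_ lu rv [x0 x0P].
pose A := range (fun x => enorm (W v x)).
have AK z : A z -> z <= K by move=> [x _ <-]; exact: (mollified_field_le psiP x rv).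
have A0 : A !=set0 by exists (enorm (W v x0)), x0.
have supA : has_sup A by split => //; exists K.
pose c := sup A.
have lec x : enorm (W v x) <= c by apply: sup_upper_bound => //; exists x.
have c0 : 0 < c.
  apply: lt_le_trans (lec x0); rewrite lt_def enorm_ge0 andbT.
  by apply: contraNneq x0P => /enorm_eq0 ->.
have cK : c <= K by apply: sup_le_ub.
exists c; split => //.
have rcv := raw_field_scale c^-1 rv.
have sn : sup_norm (W (fun j y => c^-1 * v j y)) = 1%E.
  have E x : enorm (W (fun j y => c^-1 * v j y) x) = c^-1 * enorm (W v x).
    by rewrite (mollified_field_scale _ _ rv) enormZ gtr0_norm// invr_gt0.
  apply/eqP; rewrite eq_le; apply/andP; split.
    apply: ge_ereal_sup => _ [x _ <-]; rewrite lee_fin E.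
    by rewrite mulrC ler_pdivrMr// mul1r.
  rewrite leNgt; apply/negP => s1.
  have lb x : ((c^-1 * enorm (W v x))%:E <= sup_norm (W (fun j y => (c^-1 * v j y)%R)))%E.
    by apply: ereal_sup_ubound; exists x => //; rewrite E.
  have sfin : sup_norm (W (fun j y => c^-1 * v j y)) \is a fin_num.
    rewrite ge0_fin_numE; first exact: lt_trans s1 (ltry _).
    by apply: le_trans (lb x0); rewrite lee_fin mulr_ge0 ?enorm_ge0// invr_ge0 ltW.
  move: s1 lb; rewrite -(fineK sfin); set t := fine _; rewrite lte_fin => t1 lb.
  have : c <= t * c.
    apply: sup_le_ub => // _ [x _ <-].
    by have := lb x; rewrite lee_fin mulrC ler_pdivrMr.
  by rewrite leNgt gtr_pMl// t1.
have [ip _] := pairing mu_ lu rv.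
have ub : (\int[mu]_x (u x * divergence (W (fun j y => (c^-1 * v j y)%R)) x)%:E <=
    bv_seminorm u)%E.
  apply: ereal_sup_ubound; exists (W (fun j y => c^-1 * v j y)) => //; split => //.
    exact: (mollified_field_smooth psiP rcv).
  exact: (mollified_field_supp psiP rcv).
rewrite -(@lee_pmul2l _ c^-1%:E) ?lte_fin ?invr_gt0//.
rewrite muleA -EFinM mulVf ?gt_eqF// mul1e.
apply: le_trans ub; rewrite -integralZl//.
rewrite le_eqVlt; apply/orP; left; apply/eqP.
apply: eq_integral => x _; rewrite -EFinM (divergence_scale _ _ rv).
by rewrite mulrCA.
Qed.

End with_mollifier.

(** A nonzero mollified field and its opposite are both admissible after rescaling.  The sign
    matters because the field of [integral_gradient_conv] may have a sup norm below 1. *)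
Lemma bv_seminorm_ge0 u : (0 < n)%N -> measurable_fun setT u ->
  locally_integrable_cube u -> (0 <= bv_seminorm u)%E.
Proof.
move=> n0 mu_ lu; have [psi psiP] := @exists_mollifier R 1 ltr01.
pose j0 : 'I_n := Ordinal n0.
pose v (j : 'I_n) (y : 'rV[R]_n) : R := (j == j0)%:R * \1_(@cube R n 1) y.
have rv : raw_field v 1 1.
  split.
  - move=> j; apply: measurable_funM => //; apply: measurable_indic; exact: measurable_cube.
  - move=> y; rewrite enorm_le_sqr// expr1n (bigD1 j0)//= big1 ?addr0.
      rewrite mxE /v eqxx mul1r indicE; case: (_ \in _); rewrite ?expr1n// expr0n//.
    by move=> i ij; rewrite mxE /v (negbTE ij) mul0r expr0n.
  - by move=> j y yM; rewrite /v indicE memNset// mulr0.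
have W0 : mollified_field psi v 0 != 0.
  apply/eqP => /rowP /(_ j0); rewrite !mxE => E.
  have [mv _ v0] := rv.
  have := conv_EFin psiP [::] 0 (mv j0) (raw_field_locally_integrable j0 rv).
  rewrite E => E'; have := integral_kern_sub psiP (0 : 'rV[R]_n).
  rewrite (_ : (fun y => _) = (fun y => (kern psi [::] (0 - y) * v j0 y)%:E)); last first.
    apply/funext => y; congr EFin.
    have [->|k0] := eqVneq (kern psi [::] (0 - y)) 0; first by rewrite mul0r.
    rewrite /v eqxx mul1r indicE mem_set ?mulr1//; apply/cubeP => i.
    by have := kern_supp psiP k0 i; rewrite !mxE sub0r normrN => /ltW.
  by rewrite -E' => /eqP; rewrite eqe eq_sym oner_eq0.
have exW : exists x, mollified_field psi v x != 0 by exists 0.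
have [c [c0 _ cP]] := bv_ge_rescaled psiP mu_ lu rv exW.
have rv' := raw_field_scale (-1) rv.
have W0' : mollified_field psi (fun j y => -1 * v j y) 0 != 0.
  by rewrite (mollified_field_scale psiP _ _ rv) scaleN1r oppr_eq0.
have exW' : exists x, mollified_field psi (fun j y => -1 * v j y) x != 0 by exists 0.
have [c' [c'0 _ c'P]] := bv_ge_rescaled psiP mu_ lu rv' exW'.
have [ip _] := pairing psiP mu_ lu rv.
have E : (\int[mu]_x (u x * divergence (mollified_field psi (fun j y => (-1 * v j y)%R)) x)%:E
    = - \int[mu]_x (u x * divergence (mollified_field psi v) x)%:E)%E.
  rewrite -integralN; last exact: integrable_add_def.
  apply: eq_integral => x _; rewrite (divergence_scale psiP _ _ rv) -EFinN.
  by rewrite mulN1r mulrN.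
rewrite E in c'P.
rewrite leNgt; apply/negP => bn.
have n1 : (c%:E * bv_seminorm u < 0)%E by rewrite pmule_rlt0.
have n2 : (c'%:E * bv_seminorm u < 0)%E by rewrite pmule_rlt0.
have := lt_trans (le_lt_trans cP n1) _; have := le_lt_trans c'P n2.
rewrite oppe_lt0 => h /(_ _ h); by rewrite ltxx.
Qed.

(** On a large cube the raw field - grad f / |grad f|, with f the mollification of u, pairs
    with u to the integral of |grad f|. *)
Lemma integral_gradient_conv u (d : R) psi : (0 < n)%N -> is_mollifier d psi ->
  measurable_fun setT u -> locally_integrable_cube u ->
  (\int[mu]_y (enorm (\row_i conv psi [:: i] u y))%:E <= bv_seminorm u)%E.
Proof.
move=> n0 psiP mu_ lu.
pose G y := enorm (\row_i conv psi [:: i] u y).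
have mc i : measurable_fun setT (conv psi [:: i] u) by exact: (measurable_conv psiP).
have mG : measurable_fun setT G.
  apply: measurableT_comp (@measurable_enorm R n) _.
  by apply: measurable_fun_row => i; under eq_fun do rewrite mxE; exact: mc.
have bv0 := bv_seminorm_ge0 n0 mu_ lu.
have bound (M : nat) : (\int[mu]_(y in @cube R n M%:R) (G y)%:E <= bv_seminorm u)%E.
  (* where the gradient vanishes, 0^-1 = 0 makes v vanish as well *)
  pose v (i : 'I_n) (y : 'rV[R]_n) : R := - ((G y)^-1 * conv psi [:: i] u y * \1_(@cube R n M%:R) y).
  have rv : raw_field v M%:R 1.
    split.
    - move=> i; apply: measurableT_comp => //; apply: measurable_funM; last first.
        by apply: measurable_indic; exact: measurable_cube.
      apply: measurable_funM => //; apply: measurable_inv_ge0 => // y; exact: enorm_ge0.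
    - move=> y; rewrite (_ : \row_j _ = (- (G y)^-1 * \1_(@cube R n M%:R) y) *:
          (\row_i conv psi [:: i] u y)); last first.
        by apply/rowP => j; rewrite !mxE /v; ring.
      rewrite enormZ normrM normrN normfV -/(G y) (ger0_norm (enorm_ge0 _)) ger0_norm//.
      rewrite mulrAC.
      have [->|Gn0] := eqVneq (G y) 0; first by rewrite mulr0 mul0r.
      by rewrite mulVf// mul1r indicE; case: (_ \in _).
    - by move=> j y yM; rewrite /v indicE memNset// mulr0 oppr0.
  have [ip pE] := pairing psiP mu_ lu rv.
  have -> : (\int[mu]_(y in @cube R n M%:R) (G y)%:E =
      \int[mu]_x (u x * divergence (mollified_field psi v) x)%:E)%E.
    rewrite pE integral_mkcond; apply: eq_integral => y _.
    rewrite /patch; transitivity ((G y * \1_(@cube R n M%:R) y)%:E).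
      by rewrite indicE; case: (_ \in _); rewrite ?mulr1 ?mulr0.
    congr EFin; rewrite -sumrN.
    rewrite (eq_bigr (fun i => ((G y)^-1 * \1_(@cube R n M%:R) y) *
        ((\row_i conv psi [:: i] u y) ord0 i) ^+ 2)); last first.
      by move=> i _; rewrite mxE /v; ring.
    rewrite -mulr_sumr -enorm_sqr -/(G y).
    have [->|Gn0] := eqVneq (G y) 0; first by rewrite expr0n/= mulr0 mul0r.
    by field.
  have [exW|noW] := pselect (exists x, mollified_field psi v x != 0).
    have [c [c0 c1 cP]] := bv_ge_rescaled psiP mu_ lu rv exW.
    apply: le_trans cP _; rewrite -[leRHS]mul1e.
    by apply: lee_wpmul2r => //; rewrite lee_fin.
  rewrite (_ : (fun x => _) = cst 0%E) ?integral0//.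
  apply/funext => x; congr EFin; rewrite /divergence big1 ?mulr0// => i _.
  rewrite /partial (_ : mollified_field psi v = cst 0).
    by rewrite derive_cst mxE.
  by apply/funext => y; apply: contrapT => /eqP h; apply: noW; exists y.
have cv := @ge0_nondecreasing_set_cvg_integral _ _ R (fun k : nat => @cube R n k%:R)
  (EFin \o G) mu _ _ _ _.
have {}cv : (\int[mu]_(x in @cube R n i%:R) (G x)%:E @[i --> \oo] -->
    \int[mu]_(x in \bigcup_i @cube R n i%:R) (G x)%:E)%E.
  apply: cv.
  - move=> k l kl; apply/subsetPset => x /cubeP xk; apply/cubeP => i.
    by rewrite (le_trans (xk i))// ler_nat.
  - by move=> k; exact: measurable_cube.
  - by move=> k; apply: measurable_funTS; exact/measurable_EFinP.
  - by move=> k x _; rewrite lee_fin enorm_ge0.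
have bT : \bigcup_i @cube R n i%:R = setT.
  apply/seteqP; split => // x _; exists (Num.truncn `|x|).+1 => //; apply/cubeP => i.
  by rewrite (le_trans (normr_coord _ _))// ltW// truncnS_gt.
rewrite bT in cv.
rewrite -(cvg_lim _ cv)//; apply: lime_le.
  by apply/cvg_ex; eexists; exact: cv.
by apply: nearW => k; exact: bound.
Qed.

End bv_dual.

(** * The isoperimetric inequality for smooth functions *)

(** By the coarea formula and the isoperimetric inequality this is, up to the isoperimetric
    constant, the total variation of the symmetric decreasing rearrangement of u; it is also
    a Lorentz norm with indices p and 1. *)
Definition level_integral (R : realType) (n : nat) (u : 'rV[R]_n -> R) : \bar R :=
  (\int[lebesgue_measure]_(t in `[0%R, +oo[)
     (lebesgue_row R n [set x | (t < `|u x|)%R] `^ ((n%:R - 1) / n%:R)))%E.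

Section level_measures.
Context {R : realType} {n : nat}.
Local Notation mu := (lebesgue_row R n).
Local Notation leb := (@lebesgue_measure R).
Local Notation alpha := ((n%:R - 1) / n%:R : R).
Implicit Types u : 'rV[R]_n -> R.

Lemma measurable_level u t : measurable_fun setT u -> measurable [set x | t < `|u x|].
Proof. by move=> mu_; apply: measurable_superlevel; exact: measurableT_comp. Qed.

Lemma measurable_level_measure u : measurable_fun setT u ->
  measurable_fun setT (fun t : measurableTypeR R => mu [set x | t < `|u x|]).
Proof.
move=> mu_.
have mu' : measurable_fun setT (fun x => `|u x|) by exact: measurableT_comp.
have := @measurable_layer R _ _ mu (fun x => `|u x|) (cst 1%E) mu' _ _.
rewrite (_ : (fun t => _) = (fun t : measurableTypeR R => mu [set x | t < `|u x|])).
  by apply.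
by apply/funext => t; rewrite integral_cst ?mul1e//; exact: measurable_level.
Qed.

Lemma measurable_level_power u : measurable_fun setT u ->
  measurable_fun setT (fun t : measurableTypeR R => mu [set x | (t < `|u x|)%R] `^ alpha)%E.
Proof.
move=> mu_; exact: (measurableT_comp (measurable_poweR alpha) (measurable_level_measure mu_)).
Qed.

Lemma integral_shift_ray (phi : R -> \bar R) (c : R) :
  measurable_fun setT (phi : measurableTypeR R -> \bar R) -> (forall t, 0 <= phi t)%E ->
  (\int[leb]_(t in `[0%R, +oo[) phi (c + t)%R = \int[leb]_(t in `[c, +oo[) phi t)%E.
Proof.
move=> mphi phi0.
have mp : measurable_fun setT (phi \_ `[c, +oo[%classic : R -> \bar R).
  by apply/(measurable_restrictT _ _).1 => //; exact: measurable_funTS.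
rewrite [RHS]integral_mkcond (integral_affine1 c (oner_neq0 R) mp).
  rewrite normr1 mul1e [LHS]integral_mkcond; apply: eq_integral => t _.
  rewrite /patch !mem_setE/= !in_itv/= !andbT mul1r lerDr.
  by case: ifP => // _; rewrite addrC.
by move=> t; rewrite /patch; case: ifP.
Qed.

Lemma integral_ray_le (phi : R -> \bar R) (B : \bar R) :
  measurable_fun setT (phi : measurableTypeR R -> \bar R) -> (forall t, 0 <= phi t)%E ->
  (forall c, (0 < c)%R -> (\int[leb]_(t in `[c, +oo[) phi t <= B)%E) ->
  (\int[leb]_(t in `[0%R, +oo[) phi t <= B)%E.
Proof.
move=> mphi phi0 H.
rewrite -integral_itv_obnd_cbnd; last exact: measurable_funTS.
pose F (k : nat) : set R := `[k.+1%:R^-1, +oo[%classic.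
have FE : \bigcup_k F k = `]0, +oo[%classic.
  apply/seteqP; split => [t [k _]|t] /=; rewrite ?in_itv/= ?andbT.
    by rewrite /F/= !in_itv/= !andbT; apply: lt_le_trans; rewrite invr_gt0.
  move=> t0; have [k] := ltr_add_invr t0; rewrite add0r => kt.
  by exists k => //; rewrite /F/= in_itv/= andbT ltW.
rewrite -FE.
have cv : (\int[leb]_(t in F k) phi t @[k --> \oo] --> \int[leb]_(t in \bigcup_k F k) phi t)%E.
  apply: ge0_nondecreasing_set_cvg_integral => //.
  - move=> k l kl; apply/subsetPset => t; rewrite /F/= !in_itv/= !andbT.
    by apply: le_trans; rewrite lef_pV2 ?posrE// ler_nat.
  - by move=> k; exact: measurable_itv.
  - by move=> k; exact: measurable_funTS.
rewrite -(cvg_lim _ cv)//; apply: lime_le.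
  by apply/cvg_ex; eexists; exact: cv.
by apply: nearW => k; apply: H; rewrite invr_gt0.
Qed.

End level_measures.

Section isoperimetric_smooth.
Context {R : realType} {n : nat} (n2 : (2 <= n)%N).
Local Notation mu := (lebesgue_row R n).
Local Notation leb := (@lebesgue_measure R).
Local Notation alpha := ((n%:R - 1) / n%:R : R).
Local Notation e_ i := (delta_mx ord0 i : 'rV[R]_n).

Definition isoperimetric_constant : R := n%:R * ball_volume R n `^ n%:R^-1.
Local Notation S := isoperimetric_constant.

Lemma isoperimetric_constant_gt0 : 0 < S.
Proof.
by rewrite mulr_gt0 ?powR_gt0 ?ball_volume_gt0// ltr0n (leq_trans _ n2).
Qed.

Section taylor.
Variables (f : 'rV[R]_n -> R) (g : 'I_n -> 'rV[R]_n -> R)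
  (gg : 'I_n -> 'I_n -> 'rV[R]_n -> R) (C : R).
Hypotheses (fg : forall i y, is_derive y (e_ i) f (g i y))
  (ggg : forall i j y, is_derive y (e_ j) (g i) (gg i j y))
  (ggC : forall i j y, `|gg i j y| <= C).

(** Second order Taylor bound at x with the Euclidean norm of the gradient in the linear
    term, as the sharp constant requires. *)
Lemma taylor_bound (x h : 'rV[R]_n) :
  `|f (x + h)| <= `|f x| + enorm h * enorm (\row_i g i x) + n%:R ^+ 2 * C * enorm h ^+ 2.
Proof.
have C0 (i : 'I_n) : 0 <= C by apply: le_trans (ggC i i 0).
rewrite -[f (x + h)](subrKC (f x)) -[leRHS]addrA (le_trans (ler_normD _ _))// lerD2l.
have [xi [xi1 ->]] := mean_value_row x h fg.
have -> : \sum_(i < n) h ord0 i * g i (xi i) =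
    \sum_(i < n) h ord0 i * (\row_i g i x) ord0 i +
    \sum_(i < n) h ord0 i * (g i (xi i) - g i x).
  by rewrite -big_split/=; apply: eq_bigr => i _; rewrite mxE; ring.
apply: le_trans (ler_normD _ _) _; apply: lerD.
  rewrite ler_norml cauchy_schwarz andbT lerNl.
  have := cauchy_schwarz (- h) (\row_i g i x); rewrite enormN; apply: le_trans.
  by rewrite -sumrN le_eqVlt; apply/orP; left; apply/eqP; apply: eq_bigr => i _;
    rewrite !mxE mulNr.
apply: le_trans (ler_norm_sum _ _ _) _.
have -> : n%:R ^+ 2 * C * enorm h ^+ 2 = \sum_(i < n) enorm h * (n%:R * C * enorm h).
  by rewrite sumr_const card_ord -[RHS]mulr_natl; ring.
apply: ler_sum => i _; rewrite normrM ler_pM//; first exact: normr_coord_enorm.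
rewrite -{1}(subrKC x (xi i)).
apply: le_trans (lipschitz_of_partials (C := C) (ggg i) _) _.
  by move=> j y _; exact: ggC.
rewrite ler_wpM2l ?mulr_ge0 ?C0//.
apply: le_trans (norm_le_enorm h).
apply/row_norm_le => // j; rewrite !mxE; apply: le_trans (xi1 i j) _.
exact: normr_coord.
Qed.

End taylor.

(** If |f(x)| > t and |h| < e, then q(x + h) > t for
    q = |f| + e |grad f| + K e^2, by Taylor's formula at x + h.  Brunn-Minkowski therefore
    bounds |{q > t}| - |{|f| > t}| from below by e S |{|f| > t}|^(1/p).  Integration over
    t >= t0, division by e and e -> 0 give the claim; the error K e^2 is integrated over the
    set {|f| > t0 / 2}, of finite measure, which is why the levels stay above t0 > 0. *)
Lemma isoperimetric_smooth_ray (f : 'rV[R]_n -> R) (g : 'I_n -> 'rV[R]_n -> R)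
    (gg : 'I_n -> 'I_n -> 'rV[R]_n -> R) (C B t0 : R) : 0 < t0 ->
  (forall i y, is_derive y (e_ i) f (g i y)) ->
  (forall i j y, is_derive y (e_ j) (g i) (gg i j y)) ->
  (forall i j y, `|gg i j y| <= C) ->
  measurable_fun setT f -> (forall i, measurable_fun setT (g i)) ->
  (forall y, `|f y| <= B) -> (forall y, enorm (\row_i g i y) <= B) ->
  (forall t, (0 < t)%R -> (mu [set x | (t < `|f x|)%R] < +oo)%E) ->
  (S%:E * \int[leb]_(t in `[t0, +oo[) (mu [set x | (t < `|f x|)%R] `^ alpha) <=
    \int[mu]_y (enorm (\row_i g i y))%:E)%E.
Proof.
move=> t00 fg ggg ggC mf mg fB gB lev.
have n0 : 0 < n%:R :> R by rewrite ltr0n (leq_trans _ n2).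
have n1 : 0 < n%:R - 1 :> R by rewrite subr_gt0 ltr1n.
pose G y := enorm (\row_i g i y).
have mG : measurable_fun setT G.
  apply: measurableT_comp (@measurable_enorm R n) _.
  by apply: measurable_fun_row => i; under eq_fun do rewrite mxE; exact: mg.
have G0 y : 0 <= G y by exact: enorm_ge0.
have [->|Ifin] := eqVneq (\int[mu]_y (G y)%:E)%E +oo%E; first exact: leey.
have {}Ifin : (\int[mu]_y (G y)%:E)%E \is a fin_num.
  by rewrite ge0_fin_numE ?ltey// integral_ge0// => y _; rewrite lee_fin.
pose i0 : 'I_n := Ordinal (leq_trans (ltnSn 0) (ltnW n2)).
have C0 : 0 <= C by apply: le_trans (ggC i0 i0 0).
have B0 : 0 <= B by apply: le_trans (fB 0).
have S0 := isoperimetric_constant_gt0.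
pose K : R := n%:R ^+ 2 * C.
have K0 : 0 <= K by rewrite mulr_ge0 ?exprn_ge0// ltW.
pose m := mu [set x | (t0 / 2 < `|f x|)%R].
have mfin : m \is a fin_num.
  by rewrite ge0_fin_numE /m//; apply: lev; rewrite divr_gt0.
have m0 : 0 <= fine m by apply: fine_ge0; exact: measure_ge0.
pose L : \bar R := (\int[leb]_(t in `[t0, +oo[) (mu [set x | (t < `|f x|)%R] `^ alpha))%E.
pose F x : R := Num.max (`|f x| - t0) 0.
have F0 x : 0 <= F x by rewrite le_max lexx orbT.
have mF : measurable_fun setT F.
  apply: measurable_maxr => //; apply: measurable_funB => //; exact: measurableT_comp.
have Flev t : 0 <= t -> [set x | t < F x] = [set x | t0 + t < `|f x|].
  by move=> tt0; apply/seteqP; split => x; rewrite /= /F lt_max ltrBrDl [in X in _ || X]ltNge tt0 orbF.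
have mlf := measurable_level_measure mf.
have mlp := measurable_level_power mf.
have key e : 0 < e -> e * B + K * e ^+ 2 <= t0 / 2 ->
    (S%:E * L <= (fine (\int[mu]_y (G y)%:E)%E + K * e * fine m)%:E)%E.
  move=> e0 eB.
  (* the superlevel sets of q contain the e-neighbourhoods of those of |f| *)
  pose q x : R := `|f x| + e * G x + K * e ^+ 2.
  have mq : measurable_fun setT q.
    apply: measurable_funD => //; apply: measurable_funD.
      exact: measurableT_comp.
    exact: measurable_funM.
  pose Q x : R := Num.max (q x - t0) 0.
  have Q0 x : 0 <= Q x by rewrite le_max lexx orbT.
  have mQ : measurable_fun setT Q.
    by apply: measurable_maxr => //; exact: measurable_funB.
  have Qlev t : 0 <= t -> [set x | t < Q x] = [set x | t0 + t < q x].
    by move=> tt0; apply/seteqP; split => x; rewrite /= /Q lt_max ltrBrDl [in X in _ || X]ltNge tt0 orbF.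
  have qle x : t0 < q x -> t0 / 2 < `|f x|.
    have : e * G x <= e * B by rewrite ler_pM2l//; exact: gB.
    by rewrite /q; move: eB; set a := e * G x; set b := e * B; set c := K * _ => *; lra.
  have bm t : 0 < t -> (mu [set x | (t < `|f x|)%R] +
      (e * S)%:E * (mu [set x | (t < `|f x|)%R] `^ alpha) <= mu [set x | (t < q x)%R])%E.
    move=> tt0; have fin := lev t tt0.
    have finn : mu [set x | (t < `|f x|)%R] \is a fin_num by rewrite ge0_fin_numE.
    have mA : measurable [set x | t < `|f x|] by exact: measurable_level.
    have mC : measurable [set x | t < q x] by exact: measurable_superlevel.
    have := brunn_minkowski_ball n2 e0 mA mC fin.
    rewrite -[X in (_ * (X `^ _))%E](fineK finn) poweR_EFin -EFinM => h.
    have -> : e * S * fine (mu [set x | (t < `|f x|)%R]) `^ alpha =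
       n%:R * e * ball_volume R n `^ n%:R^-1 * fine (mu [set x | (t < `|f x|)%R]) `^ alpha.
      by rewrite /isoperimetric_constant; ring.
    apply: h => x h /= tf he; apply: lt_le_trans tf _.
    have := taylor_bound fg ggg ggC (x + h) (- h).
    rewrite addrK enormN => /le_trans; apply.
    have h0 := enorm_ge0 h; rewrite /q -/(G (x + h)); apply: lerD.
      by rewrite lerD2l ler_wpM2r// ltW.
    by rewrite -/K ler_wpM2l// ler_sqr ?nnegrE// ltW.
  have intFE : (\int[mu]_x (F x)%:E =
      \int[leb]_(t in `[t0, +oo[) mu [set x | (t < `|f x|)%R])%E.
    rewrite layer_cake// -(integral_shift_ray t0 mlf)//.
    apply: eq_integral => t; rewrite inE/= in_itv/= andbT => tt0.
    by rewrite Flev.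
  have mlq : measurable_fun setT (fun t : measurableTypeR R => mu [set x | (t < q x)%R]).
    have q0 x : 0 <= q x by rewrite !addr_ge0// ?mulr_ge0// ?exprn_ge0// ltW.
    have := measurable_level_measure mq.
    rewrite (_ : (fun t => _) = (fun t : measurableTypeR R => mu [set x | (t < q x)%R]))//.
    by apply/funext => t; congr (mu _); apply/seteqP; split => x /=; rewrite ger0_norm.
  have intQE : (\int[mu]_x (Q x)%:E =
      \int[leb]_(t in `[t0, +oo[) mu [set x | (t < q x)%R])%E.
    rewrite layer_cake// -(integral_shift_ray t0 mlq)//.
    apply: eq_integral => t; rewrite inE/= in_itv/= andbT => tt0.
    by rewrite Qlev.
  have eS0 : 0 <= e * S by rewrite mulr_ge0 ?ltW.
  have low : (\int[mu]_x (F x)%:E + (e * S)%:E * L <= \int[mu]_x (Q x)%:E)%E.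
    rewrite intFE intQE /L -ge0_integralZl_EFin//; last first.
    - exact: measurable_funTS.
    - by move=> t _; exact: poweR_ge0.
    rewrite -ge0_integralD//; last 3 first.
    - exact: measurable_funTS.
    - by move=> t _; rewrite mule_ge0 ?lee_fin ?poweR_ge0.
    - by apply: measurable_funeM; exact: measurable_funTS.
    apply: ge0_le_integral => //.
    - by move=> t _; rewrite adde_ge0// mule_ge0 ?lee_fin ?poweR_ge0.
    - apply: emeasurable_funD; first exact: measurable_funTS.
      by apply: measurable_funeM; exact: measurable_funTS.
    - exact: measurable_funTS.
    move=> t; rewrite /= in_itv/= andbT => tt0; apply: bm.
    exact: lt_le_trans t00 tt0.
  have mlt : measurable [set x | t0 / 2 < `|f x|] by exact: measurable_level.
  have int1 : (\int[mu]_x (\1_[set x | (t0 / 2 < `|f x|)%R] x)%:E = m)%E.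
    by rewrite integral_indic// setIT.
  have mi : measurable_fun setT (fun x => (\1_[set x | (t0 / 2 < `|f x|)%R] x : R)%:E).
    by apply/measurable_EFinP; exact: measurable_indic.
  have i0' x : (0 <= (\1_[set x | (t0 / 2 < `|f x|)%R] x : R)%:E)%E by rewrite lee_fin.
  have Ffin : (\int[mu]_x (F x)%:E)%E \is a fin_num.
    rewrite ge0_fin_numE; last by apply: integral_ge0 => x _; rewrite lee_fin.
    apply: (@le_lt_trans _ _ (\int[mu]_x (B%:E * (\1_[set x | (t0 / 2 < `|f x|)%R] x)%:E))%E).
      apply: ge0_le_integral => //.
      - by move=> x _; rewrite lee_fin.
      - exact/measurable_EFinP.
      - exact: measurable_funeM.
      move=> x _; rewrite -EFinM lee_fin indic_bool /F ge_max.
      have [ff|ff] := ltP (t0 / 2) `|f x|.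
        by rewrite mulr1 B0 andbT (le_trans _ (fB x))// lerBlDr lerDl ltW.
      rewrite mulr0 lexx andbT subr_le0 (le_trans ff)//.
      by rewrite ler_pdivrMr// ler_pMr// ler1n.
    rewrite ge0_integralZl_EFin// int1 lte_mul_pinfty//.
    by rewrite ltey_eq mfin.
  have up : (\int[mu]_x (Q x)%:E <= \int[mu]_x (F x)%:E + (e%:E * \int[mu]_x (G x)%:E +
      (K * e ^+ 2)%:E * m))%E.
    have Ke : 0 <= K * e ^+ 2 by rewrite mulr_ge0// exprn_ge0// ltW.
    have eG0 x : (0 <= (G x)%:E)%E by rewrite lee_fin.
    have meG : measurable_fun setT (fun x => (G x)%:E) by exact/measurable_EFinP.
    have e0' := ltW e0.
    have E1 : (e%:E * \int[mu]_x (G x)%:E = \int[mu]_x (e%:E * (G x)%:E))%E.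
      by rewrite ge0_integralZl_EFin.
    have E2 : ((K * e ^+ 2)%:E * m =
        \int[mu]_x ((K * e ^+ 2)%:E * (\1_[set x | (t0 / 2 < `|f x|)%R] x)%:E))%E.
      by rewrite ge0_integralZl_EFin// int1.
    have p1 x : (0 <= e%:E * (G x)%:E)%E by rewrite mule_ge0// lee_fin.
    have p2 x : (0 <= (K * e ^+ 2)%:E * (\1_[set x | (t0 / 2 < `|f x|)%R] x : R)%:E)%E.
      by rewrite mule_ge0// lee_fin.
    have m1 : measurable_fun setT (fun x => e%:E * (G x)%:E)%E by exact: measurable_funeM.
    have m2 : measurable_fun setT (fun x => (K * e ^+ 2)%:E *
      (\1_[set x | (t0 / 2 < `|f x|)%R] x : R)%:E)%E by exact: measurable_funeM.
    have mF' : measurable_fun setT (fun x => (F x)%:E) by exact/measurable_EFinP.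
    have F0' x : (0 <= (F x)%:E)%E by rewrite lee_fin.
    rewrite E1 E2 -ge0_integralD// -ge0_integralD//; last 2 first.
    - by move=> x _; exact: adde_ge0.
    - exact: emeasurable_funD.
    apply: ge0_le_integral => //.
    - by move=> x _; rewrite lee_fin.
    - exact/measurable_EFinP.
    - by do 2 apply: emeasurable_funD => //.
    move=> x _; rewrite -!EFinM -!EFinD lee_fin indic_bool.
    have [qx|qx] := ltP t0 (q x).
      rewrite (qle x qx) mulr1 /Q ge_max; apply/andP; split; last first.
        by rewrite !addr_ge0// mulr_ge0.
      have : `|f x| - t0 <= F x by rewrite le_max lexx.
      by rewrite /q; set a := e * G x; set b := K * _; lra.
    rewrite /Q (max_idPr _) ?subr_le0//.
    by rewrite !addr_ge0// ?mulr_ge0.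
  have := le_trans low up; rewrite -(fineK Ffin) -(fineK Ifin) -(fineK mfin).
  rewrite -EFinM -EFinM -!EFinD.
  have L0 : (0 <= L)%E by apply: integral_ge0 => t _; exact: poweR_ge0.
  have [Lfin|] := boolP (L \is a fin_num); last first.
    rewrite ge0_fin_numE// -leNgt leye_eq => /eqP ->.
    rewrite (@gt0_muley _ (e * S)%:E); first by rewrite addey// leye_eq.
    by rewrite lte_fin mulr_gt0.
  rewrite -(fineK Lfin) -!EFinM -!EFinD !lee_fin lerD2l => h.
  rewrite -(ler_pM2l e0); apply: le_trans (_ : _ <= e * S * fine L) _; first by rewrite mulrA.
  apply: le_trans h _; rewrite le_eqVlt; apply/orP; left; apply/eqP; ring.
rewrite -(fineK Ifin); apply/lee_addgt0Pr => eps eps0.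
pose e1 := Num.min 1 (t0 / 2 / (B + K + 1)).
have BK : 0 < B + K + 1 by rewrite ltr_wpDl// addr_ge0.
have e10 : 0 < e1 by rewrite lt_min ltr01 !divr_gt0.
have Km : 0 < K * fine m + 1 by rewrite ltr_wpDl// mulr_ge0.
pose e := Num.min e1 (eps / (K * fine m + 1)).
have e0 : 0 < e by rewrite lt_min e10 divr_gt0.
have ee1 : e <= 1 by rewrite /e /e1 !ge_min lexx.
have ee2 : e * (B + K + 1) <= t0 / 2.
  by rewrite -ler_pdivlMr// /e /e1 !ge_min lexx !orbT.
have ee3 : e * (K * fine m + 1) <= eps.
  by rewrite -ler_pdivlMr// /e ge_min lexx !orbT.
apply: le_trans (key e e0 _) _.
  have : K * e ^+ 2 <= K * e by rewrite ler_wpM2l// expr2 -[leRHS]mulr1 ler_wpM2l// ltW.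
  by nra.
rewrite -EFinD lee_fin lerD2l; have := ee3; rewrite mulrDr mulr1.
by move: e0; rewrite (mulrC K e) -mulrA; lra.
Qed.

Lemma isoperimetric_smooth (f : 'rV[R]_n -> R) (g : 'I_n -> 'rV[R]_n -> R)
    (gg : 'I_n -> 'I_n -> 'rV[R]_n -> R) (C B : R) :
  (forall i y, is_derive y (e_ i) f (g i y)) ->
  (forall i j y, is_derive y (e_ j) (g i) (gg i j y)) ->
  (forall i j y, `|gg i j y| <= C) ->
  measurable_fun setT f -> (forall i, measurable_fun setT (g i)) ->
  (forall y, `|f y| <= B) -> (forall y, enorm (\row_i g i y) <= B) ->
  (forall t, (0 < t)%R -> (mu [set x | (t < `|f x|)%R] < +oo)%E) ->
  (S%:E * level_integral f <= \int[mu]_y (enorm (\row_i g i y))%:E)%E.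
Proof.
move=> fg ggg ggC mf mg fB gB lev.
have S0 := isoperimetric_constant_gt0.
have mlp := measurable_level_power mf.
rewrite /level_integral -ge0_integralZl_EFin ?(ltW S0)//; last 2 first.
- by move=> t _; exact: poweR_ge0.
- exact: measurable_funTS.
apply: integral_ray_le.
- exact: measurable_funeM.
- by move=> t; apply: mule_ge0; [rewrite lee_fin ltW|exact: poweR_ge0].
move=> t0 t00; rewrite ge0_integralZl_EFin ?(ltW S0)//; last 2 first.
- by move=> t _; exact: poweR_ge0.
- exact: measurable_funTS.
exact: isoperimetric_smooth_ray ggC _ _ _ _ _.
Qed.

End isoperimetric_smooth.

(** * Mollifications converge in the mean *)

(** The open sets form a pi-system that generates the Borel sets, as the Dynkin argument of
    [mean_recovered_set] requires. *)
Lemma measurable_row_open (R : realType) (n : nat) :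
  (@measurable _ 'rV[R]_n) = <<s [set U : set 'rV[R]_n | open U] >>.
Proof.
apply/seteqP; split => A.
  apply: smallest_sub; first exact: smallest_sigma_algebra.
  rewrite -bigcup_seq => _ [i _ [Y mY <-]]; rewrite setTI.
  have : preimage_set_system setT (@row_coord R n i)
      ((@RGenOpens.G R).-sigma.-measurable) (row_coord i @^-1` Y).
    by exists Y; rewrite ?setTI// -RGenOpens.measurableE.
  rewrite -g_sigma_preimageE; apply: smallest_sub; first exact: smallest_sigma_algebra.
  move=> _ [_ [a [b ->]] <-]; apply: sub_sigma_algebra.
  rewrite setTI /=; apply: open_comp => // x _.
  exact: coord_continuous.
apply: smallest_sub; first exact: sigma_algebra_measurable.
by move=> U; exact: open_measurable_row.
Qed.

Section approximate_identity.
Context {R : realType} {n : nat} (psis : nat -> nat -> R -> R).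
Hypothesis psisP : forall k, is_mollifier k.+1%:R^-1 (psis k).
Local Notation mu := (lebesgue_row R n).
Local Notation T k := (conv (n := n) (psis k) [::]).
Implicit Types w v : 'rV[R]_n -> R.

Lemma integrable_locally w : mu.-integrable setT (EFin \o w) -> locally_integrable_cube w.
Proof. by move=> iw M; apply: integrableS iw => //; exact: measurable_cube. Qed.

Definition integrable_fun w := measurable_fun setT w /\ mu.-integrable setT (EFin \o w).

Lemma mollified_measurable k w : integrable_fun w -> measurable_fun setT (T k w).
Proof.
by move=> [mw iw]; apply: (measurable_conv (psisP k)) => //; exact: integrable_locally.
Qed.

(** Tonelli's theorem, the kernel having mass 1 in either variable. *)
Lemma mollified_L1_contraction k w : integrable_fun w ->
  (\int[mu]_x `|(T k w x)%:E| <= \int[mu]_x `|(w x)%:E|)%E.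
Proof.
move=> [mw iw]; have psiP := psisP k.
have lw := integrable_locally iw.
have mK := measurable_prod_kern_sub psiP (Nil 'I_n).
have k0 x := kern0_ge0 psiP (x : 'rV[R]_n).
pose F (p : 'rV[R]_n * 'rV[R]_n) : \bar R :=
  ((kern (psis k) [::] (p.1 - p.2))%:E * `|(w p.2)%:E|)%E.
have F0 p : (0 <= F p)%E by rewrite mule_ge0// lee_fin.
have mF : measurable_fun setT F.
  apply: emeasurable_funM; first exact/measurable_EFinP.
  apply: measurableT_comp => //; apply/measurable_EFinP.
  exact: measurableT_comp mw measurable_snd.
apply: (@le_trans _ _ (\int[mu]_x \int[mu]_y F (x, y))%E).
  apply: ge0_le_integral => //.
  - apply: measurableT_comp => //; apply/measurable_EFinP.
    exact: mollified_measurable.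
  - exact: measurable_fun_fubini_tonelli_F.
  move=> x _; rewrite (conv_EFin psiP)//.
  have iK := integrable_conv psiP [::] x mw lw.
  apply: le_trans (le_abse_integral mu measurableT (measurable_int _ iK)) _.
  rewrite le_eqVlt; apply/orP; left; apply/eqP; apply: eq_integral => y _.
  by rewrite /F/= normrM ger0_norm.
rewrite (fubini_tonelli F mF F0).
rewrite le_eqVlt; apply/orP; left; apply/eqP; apply: eq_integral => y _.
rewrite /F/= ge0_integralZr//; last 2 first.
- apply/measurable_EFinP.
  rewrite (_ : (fun x => _) = kern (psis k) [::] \o (fun x => 1 *: x + (- y))).
    exact: measurableT_comp (measurable_kern psiP _) (measurable_row_affine 1 (- y)).
  by apply/funext => x /=; rewrite scale1r.
- by move=> x _; rewrite lee_fin.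
have := @integral_translate R n (- y) (fun x => (kern (psis k) [::] x)%:E).
rewrite (kern0_integral psiP) => ->; rewrite ?mul1e//.
by apply/measurable_EFinP; exact: (measurable_kern psiP).
Qed.

(** The functions with this property are closed under linear combinations and under limits
    in the mean, so that it spreads from the characteristic functions of open sets to all
    integrable functions. *)
Definition mean_recovered w : Prop := forall e : R, 0 < e ->
  exists N, forall k, (N <= k)%N -> (\int[mu]_x `|(T k w x - w x)%:E| <= e%:E)%E.

Lemma integrable_funD w v : integrable_fun w -> integrable_fun v ->
  integrable_fun (fun x => w x + v x).
Proof.
move=> [mw iw] [mv iv]; split; first exact: measurable_funD.
have := integrableD measurableT iw iv; congr (integrable _ _ _).
Qed.

Lemma integrable_funZ (a : R) w : integrable_fun w -> integrable_fun (fun x => a * w x).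
Proof.
move=> [mw iw]; split; first exact: measurable_funM.
have := integrableZl measurableT a iw; congr (integrable _ _ _).
Qed.

Lemma integrable_funB w v : integrable_fun w -> integrable_fun v ->
  integrable_fun (fun x => w x - v x).
Proof.
move=> iw iv; have := integrable_funD iw (integrable_funZ (-1) iv).
by congr (integrable_fun _); apply/funext => x; rewrite mulN1r.
Qed.

Lemma mollifiedB k w v x : integrable_fun w -> integrable_fun v ->
  T k (fun y => w y - v y) x = T k w x - T k v x.
Proof.
move=> [mw iw] [mv iv]; rewrite /conv.
under eq_Rintegral do rewrite mulrBr.
by rewrite RintegralB//; apply: (integrable_conv (psisP k)) => //;
  exact: integrable_locally.
Qed.

Lemma mollifiedD k w v x : integrable_fun w -> integrable_fun v ->
  T k (fun y => w y + v y) x = T k w x + T k v x.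
Proof.
move=> [mw iw] [mv iv]; rewrite /conv.
under eq_Rintegral do rewrite mulrDr.
by rewrite RintegralD//; apply: (integrable_conv (psisP k)) => //;
  exact: integrable_locally.
Qed.

Lemma measurable_L1 w : measurable_fun setT w -> measurable_fun setT (fun x => `|(w x)%:E|%E).
Proof. by move=> mw; apply: measurableT_comp => //; exact/measurable_EFinP. Qed.

Lemma L1_triangle w v : measurable_fun setT w -> measurable_fun setT v ->
  (\int[mu]_x `|(w x + v x)%:E| <= \int[mu]_x `|(w x)%:E| + \int[mu]_x `|(v x)%:E|)%E.
Proof.
move=> mw mv; have mw' := measurable_L1 mw; have mv' := measurable_L1 mv.
rewrite -ge0_integralD//; apply: ge0_le_integral => //.
- by apply: measurable_L1; exact: measurable_funD.
- exact: emeasurable_funD.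
by move=> x _; rewrite EFinD; exact: lee_abs_add.
Qed.

Lemma mean_recoveredD w v : integrable_fun w -> integrable_fun v ->
  mean_recovered w -> mean_recovered v -> mean_recovered (fun x => w x + v x).
Proof.
move=> iw iv rw rv e e0; have e2 : 0 < e / 2 by rewrite divr_gt0.
have [N1 H1] := rw _ e2; have [N2 H2] := rv _ e2.
exists (maxn N1 N2) => k; rewrite geq_max => /andP[k1 k2].
have mw := mollified_measurable k iw; have mv := mollified_measurable k iv.
rewrite (_ : (fun x => _) = (fun x => `|((T k w x - w x) + (T k v x - v x))%:E|%E)); last first.
  by apply/funext => x; rewrite mollifiedD//; congr (`|_%:E|%E); ring.
apply: le_trans (L1_triangle _ _) _.
- by apply: measurable_funB => //; case: iw.
- by apply: measurable_funB => //; case: iv.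
by rewrite [e]splitr EFinD; apply: leeD; [exact: H1|exact: H2].
Qed.

Lemma mean_recoveredZ (a : R) w : integrable_fun w ->
  mean_recovered w -> mean_recovered (fun x => a * w x).
Proof.
move=> iw rw e e0; have a0 : 0 < `|a| + 1 by rewrite ltr_wpDl.
have ea : 0 < e / (`|a| + 1) by rewrite divr_gt0.
have [N H] := rw _ ea; exists N => k Nk.
have mw := mollified_measurable k iw.
rewrite (_ : (fun x => _) = (fun x => `|a|%:E * `|(T k w x - w x)%:E|)%E); last first.
  apply/funext => x; rewrite (conv_scale (psisP k)); first by rewrite -mulrBr EFinM abseM.
    by case: iw.
  by apply: integrable_locally; case: iw.
rewrite ge0_integralZl_EFin//; last first.
  by apply: measurable_L1; apply: measurable_funB => //; case: iw.
apply: (@le_trans _ _ (`|a|%:E * (e / (`|a| + 1))%:E)%E).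
  by apply: lee_wpmul2l; [rewrite lee_fin|exact: H].
rewrite -EFinM lee_fin mulrA ler_pdivrMr// mulrC ler_wpM2l ?(ltW e0)//.
by rewrite lerDl.
Qed.

(** Mollification contracts the distance in the mean: an error of e / 3 in the
    approximation of w by v costs at most twice that much. *)
Lemma mean_recovered_close w : integrable_fun w ->
  (forall e : R, 0 < e -> exists v, [/\ integrable_fun v, mean_recovered v &
     (\int[mu]_x `|(w x - v x)%:E| <= e%:E)%E]) ->
  mean_recovered w.
Proof.
move=> iw H e e0; have e3 : 0 < e / 3 by rewrite divr_gt0.
have [v [iv rv wv]] := H _ e3; have [N Nv] := rv _ e3; exists N => k Nk.
have mw := mollified_measurable k iw; have mv := mollified_measurable k iv.
have iwv := integrable_funB iw iv.
have mwv := mollified_measurable k iwv.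
have [mw' _] := iw; have [mv' _] := iv; have [mwv' _] := iwv.
rewrite (_ : (fun x => _) = (fun x => `|(T k (fun y => (w y - v y)%R) x +
    ((T k v x - v x) + -1 * (w x - v x)))%:E|%E)); last first.
  by apply/funext => x; rewrite mollifiedB//; congr (`|_%:E|%E); ring.
apply: le_trans (L1_triangle _ _) _ => //.
  by apply: measurable_funD; [exact: measurable_funB|exact: measurable_funM].
have -> : e%:E = ((e / 3)%:E + ((e / 3)%:E + (e / 3)%:E))%E.
  by rewrite -!EFinD; congr EFin; field.
apply: leeD; first exact: le_trans (mollified_L1_contraction k iwv) wv.
apply: le_trans (L1_triangle _ _) _ => //.
- exact: measurable_funB.
- exact: measurable_funM.
apply: leeD; first exact: Nv.
by under eq_integral do rewrite mulN1r EFinN abseN.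
Qed.

Lemma integrable_fun_indic (A : set 'rV[R]_n) : measurable A -> (mu A < +oo)%E ->
  integrable_fun (\1_A : 'rV[R]_n -> R).
Proof.
move=> mA Aoo; split; first exact: measurable_indic.
apply/integrableP; split; first by apply/measurable_EFinP; exact: measurable_indic.
rewrite (_ : (fun x => _) = (fun x => (\1_A x : R)%:E)); last first.
  by apply/funext => x; rewrite gee0_abs// lee_fin.
by rewrite integral_indic// setIT.
Qed.

Lemma kern_open (V : set 'rV[R]_n) x : open V -> V x ->
  exists N, forall k, (N <= k)%N -> T k (\1_V) x = 1.
Proof.
move=> oV Vx; have /nbhs_rowP[e e0 xV] : nbhs x V by exact: open_nbhs_nbhs.
have [N Ne] := ltr_add_invr e0; rewrite add0r in Ne.
exists N => k Nk; have psiP := psisP k.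
have ke : k.+1%:R^-1 < e.
  by apply: le_lt_trans Ne; rewrite lef_pV2 ?posrE// ler_nat.
rewrite /conv /Rintegral -[RHS](congr1 fine (integral_kern_sub psiP x)).
congr fine; apply: eq_integral => y _; congr EFin.
have [->|k0] := eqVneq (kern (psis k) [::] (x - y)) 0; first by rewrite mul0r.
rewrite indicE mem_set ?mulr1//; apply: xV => i; rewrite distrC.
by have := kern_supp psiP k0 i; rewrite !mxE => /lt_trans; apply.
Qed.

(** The mollifications of the characteristic function of an open set V converge to 1 at
    every point of V.  Their total mass is at most |V|, so whatever they lose inside V bounds
    what they carry outside. *)
Lemma mean_recovered_open (V : set 'rV[R]_n) : open V -> (mu V < +oo)%E ->
  mean_recovered (\1_V).
Proof.
move=> oV Voo; have mV : measurable V by exact: open_measurable_row.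
have iV := integrable_fun_indic mV Voo.
have lV : locally_integrable_cube (\1_V : 'rV[R]_n -> R).
  by apply: integrable_locally; case: iV.
have i1 x : 0 <= (\1_V x : R) <= 1 by rewrite indicE; case: (_ \in _); rewrite ?lexx ler01.
have T1 k x : T k (\1_V) x <= 1.
  by apply: (conv_le_cst (psisP k)) => // y; case/andP: (i1 y).
have T0 k x : 0 <= T k (\1_V) x.
  apply: Rintegral_ge0 => y _; rewrite mulr_ge0 ?(kern0_ge0 (psisP k))//.
pose h k x : R := \1_V x * (1 - T k (\1_V) x).
have h0 k x : 0 <= h k x by rewrite mulr_ge0 ?subr_ge0//.
have mT k := mollified_measurable k iV.
have mh k : measurable_fun setT (h k).
  by apply: measurable_funM => //; exact: measurable_funB.
have hcv : (\int[mu]_x (h k x)%:E @[k --> \oo] --> \int[mu]_x (cst 0%E x))%E.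
  have i2 : mu.-integrable setT (fun x => (\1_V x : R)%:E) by case: iV.
  have := @dominated_cvg _ _ _ mu setT measurableT (fun k x => (h k x)%:E) (cst 0%E)
    (fun x => (\1_V x : R)%:E) _ _ _ i2 _.
  apply.
  - by move=> k; exact/measurable_EFinP.
  - move=> x _; apply: cvg_near_cst.
    have [Vx|Vx] := pselect (V x); last first.
      by apply: nearW => k; rewrite /h indicE memNset// mul0r.
    have [N NP] := kern_open oV Vx; exists N => // k /= Nk.
    by rewrite /h NP// subrr mulr0.
  - by [].
  - move=> k x _; rewrite gee0_abs ?lee_fin// /h -[leRHS]mulr1 ler_wpM2l//.
    by rewrite gerBl.
rewrite integral0 in hcv.
move=> e e0; have e2 : 0 < e / 2 by rewrite divr_gt0.
have [N _ NP] : \forall k \near \oo, (\int[mu]_x (h k x)%:E < (e / 2)%:E)%E.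
  have nb : nbhs 0%E [set y : \bar R | (y < (e / 2)%:E)%E].
    by apply: open_nbhs_nbhs; split; [exact: open_ereal_lt_ereal|rewrite /= lte_fin].
  exact: (hcv _ nb).
exists N => k Nk; have {NP} hk := NP k Nk.
have mTk : measurable_fun setT (fun x => (T k (\1_V) x)%:E) by exact/measurable_EFinP.
have m1 : measurable_fun setT (fun x => (\1_V x : R)%:E) by exact/measurable_EFinP.
have mhk : measurable_fun setT (fun x => (h k x)%:E) by exact/measurable_EFinP.
have E : (\int[mu]_x `|(T k (\1_V) x - \1_V x)%:E| + mu V =
    \int[mu]_x (T k (\1_V) x)%:E + 2%:E * \int[mu]_x (h k x)%:E)%E.
  have -> : mu V = (\int[mu]_x (\1_V x)%:E)%E by rewrite integral_indic// setIT.
  have h0' x : (0 <= (h k x)%:E)%E by rewrite lee_fin.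
  have T0' x : (0 <= (T k (\1_V) x)%:E)%E by rewrite lee_fin.
  have i0' x : (0 <= (\1_V x : R)%:E)%E by rewrite lee_fin; case/andP: (i1 x).
  have h2 x : (0 <= 2%:E * (h k x)%:E)%E by rewrite mule_ge0// lee_fin.
  have m2 : measurable_fun setT (fun x => 2%:E * (h k x)%:E)%E by exact: measurable_funeM.
  have m3 : measurable_fun setT (fun x => `|(T k (\1_V) x - \1_V x)%:E|%E).
    by apply: measurable_L1; exact: measurable_funB.
  rewrite -ge0_integralZl_EFin// -!ge0_integralD//.
  apply: eq_integral => x _; rewrite -EFinM -!EFinD /h; congr EFin.
  rewrite indicE; case: (_ \in _); rewrite /=.
    by rewrite ler0_norm ?subr_le0//; ring.
  by rewrite subr0 ger0_norm//; ring.
have TV : (\int[mu]_x (T k (\1_V) x)%:E <= mu V)%E.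
  have := mollified_L1_contraction k iV.
  under eq_integral do rewrite gee0_abs ?lee_fin//.
  under [X in (_ <= X)%E -> _]eq_integral do rewrite gee0_abs ?lee_fin//.
  by rewrite integral_indic// setIT.
have Vfin : mu V \is a fin_num by rewrite ge0_fin_numE.
rewrite -(leeD2rE _ _ Vfin) E addeC; apply: leeD => //.
apply: (@le_trans _ _ (2%:E * (e / 2)%:E)%E).
  by apply: lee_wpmul2l; [rewrite lee_fin|exact: ltW].
by rewrite -EFinM mulrC divfK.
Qed.

End approximate_identity.

Section recover_cut.
Context {R : realType} {n : nat} (psis : nat -> nat -> R -> R).
Hypothesis psisP : forall k, is_mollifier k.+1%:R^-1 (psis k).
Local Notation mu := (lebesgue_row R n).
Local Notation T k := (conv (n := n) (psis k) [::]).
Local Notation rec := (mean_recovered (n := n) psis).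
Variable M : R.

Let Q : set 'rV[R]_n := [set x | forall i, `|x ord0 i| < M].

Let oQ : open Q.
Proof.
rewrite openE => x Qx; apply/nbhs_rowP.
have [n0|] := eqVneq n 0%N.
  exists 1 => // y _ i; exfalso; have := ltn_ord i; rewrite {2}n0; done.
rewrite -lt0n => n0; pose i0 := Ordinal n0.
have M0 : 0 < M - \big[Num.max/`|x ord0 i0|]_(i < n) `|x ord0 i|.
  rewrite subr_gt0; apply/bigmax_ltP; split; [exact: Qx|by move=> i _; exact: Qx].
exists (M - \big[Num.max/`|x ord0 i0|]_(i < n) `|x ord0 i|) => // y xy i.
rewrite -(subrK (x ord0 i) (y ord0 i)) (le_lt_trans (ler_normD _ _))//.
rewrite -ltrBrDr; apply: lt_le_trans (xy i) _; rewrite lerD2l lerN2.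
exact: (le_bigmax _ (fun i => `|x ord0 i|) i).
Qed.

Let mQ : measurable Q. Proof. exact: open_measurable_row. Qed.

Let Qoo : (mu Q < +oo)%E.
Proof.
apply: le_lt_trans (measure_cube_lty n M); apply: le_measure; rewrite ?inE//.
  exact: measurable_cube.
by move=> x Qx; apply/cubeP => i; exact: ltW.
Qed.

Let QI A : measurable A -> integrable_fun (\1_(A `&` Q) : 'rV[R]_n -> R).
Proof.
move=> mA; apply: integrable_fun_indic; first exact: measurableI.
by apply: le_lt_trans Qoo; apply: le_measure; rewrite ?inE//; exact: measurableI.
Qed.

(** Dynkin's pi-lambda theorem.  The intersection with the bounded set Q keeps the
    measures finite, as complements and monotone limits require. *)
Lemma mean_recovered_set (A : set 'rV[R]_n) : measurable A -> rec (\1_(A `&` Q)).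
Proof.
move=> mA; have sA : <<s [set U : set 'rV[R]_n | open U] >> A.
  by rewrite -measurable_row_open.
pose P (A : set 'rV[R]_n) := rec (\1_(A `&` Q)).
apply: (@dynkin_induction _ 'rV[R]_n [set U | open U] P _ _ _ _ _ _ A sA).
- exact: measurable_row_open.
- by move=> U V; exact: openI.
- by rewrite /P setTI; exact: mean_recovered_open.
- move=> U oU; apply: mean_recovered_open => //; first exact: openI.
  apply: le_lt_trans Qoo; apply: le_measure; rewrite ?inE//.
  by apply: measurableI => //; exact: open_measurable_row.
- rewrite /P => B mB rB.
  have -> : \1_(~` B `&` Q) = (fun x => \1_(setT `&` Q) x + -1 * \1_(B `&` Q) x) :> ('rV[R]_n -> R).
    apply/funext => x; rewrite !indicE !in_setI in_setC in_setT/=.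
    by case: (x \in B); case: (x \in Q); rewrite /=; ring.
  apply: mean_recoveredD => //; [exact: QI|exact/integrable_funZ/QI| |].
    by rewrite setTI; exact: mean_recovered_open.
  by apply: mean_recoveredZ => //; exact: QI.
- rewrite /P => F mF tF rF.
  have mU : measurable (\bigcup_k F k) by exact: bigcupT_measurable.
  apply: mean_recovered_close => //; first exact: QI.
  move=> e e0.
  pose G (k : nat) := (\big[setU/set0]_(i < k) F i) `&` Q.
  have mG k : measurable (G k) by apply: measurableI => //; exact: bigsetU_measurable.
  have GU : \bigcup_k G k = (\bigcup_k F k) `&` Q.
    rewrite -setI_bigcupl; congr (_ `&` _); apply/seteqP; split => x.
      move=> [k _]; rewrite -bigcup_mkord => -[i _ Fi]; by exists i.
    by move=> [k _ Fk]; exists k.+1 => //; rewrite -bigcup_mkord; exists k => //=.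
  have cv : mu (G k) @[k --> \oo] --> mu (\bigcup_k G k).
    apply: nondecreasing_cvg_mu => //; first exact: bigcupT_measurable.
    move=> k l kl; apply/subsetPset => x [xk xQ]; split => //.
    move: xk; rewrite -!bigcup_mkord => -[i /= ik Fi]; exists i => //=.
    exact: leq_trans ik kl.
  have Ufin : mu (\bigcup_k G k) \is a fin_num.
    rewrite ge0_fin_numE// GU; apply: le_lt_trans Qoo.
    by apply: le_measure; rewrite ?inE//; exact: measurableI.
  have [k _ kP] : \forall k \near \oo, (mu (\bigcup_k G k) - e%:E < mu (G k))%E.
    have nb : nbhs (mu (\bigcup_k G k)) [set y | (mu (\bigcup_k G k) - e%:E < y)%E].
      apply: open_nbhs_nbhs; split; first exact: open_ereal_gt_ereal.
      by rewrite /=; case: (mu _) Ufin => // r _; rewrite -EFinB lte_fin ltrBlDr ltrDl.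
    exact: (cv _ nb).
  have {}kP := kP k (leqnn k).
  exists (\1_(G k)); split.
  - by apply: QI; exact: bigsetU_measurable.
  - rewrite /G; elim: k {kP} => [|k IH].
      rewrite big_ord0 set0I.
      have -> : \1_set0 = (fun x => 0 * \1_(setT `&` Q) x) :> ('rV[R]_n -> R).
        by apply/funext => x; rewrite mul0r indicE in_set0.
      apply: mean_recoveredZ => //; first exact: QI.
      by rewrite setTI; exact: mean_recovered_open.
    have -> : \1_((\big[setU/set0]_(i < k.+1) F i) `&` Q) = (fun x =>
        \1_((\big[setU/set0]_(i < k) F i) `&` Q) x + \1_(F k `&` Q) x) :> ('rV[R]_n -> R).
      apply/funext => x; rewrite !indicE !in_setI big_ord_recr/= in_setU.
      have [xF|xF] := boolP (x \in F k); last by rewrite orbF addr0.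
      have -> : (x \in \big[setU/set0]_(i < k) F i) = false.
        apply/negP; rewrite inE -bigcup_mkord => -[i /= ik Fi].
        rewrite inE in xF.
        have /trivIsetP/(_ i k Logic.I Logic.I) := tF.
        by rewrite ltn_eqF// => /(_ isT) /seteqP[/(_ x (conj Fi xF))].
      by rewrite orbT add0r.
    apply: mean_recoveredD => //; [|exact: QI].
    by apply: QI; exact: bigsetU_measurable.
  - have sub : G k `<=` \bigcup_k G k by move=> x Gx; exists k.
    rewrite -GU (_ : (fun x => _) = (fun x => (\1_((\bigcup_k G k) `\` G k) x)%:E)).
      rewrite integral_indic//; last by apply: measurableD => //; exact: bigcupT_measurable.
      rewrite setIT measureD//; last 2 first.
      + exact: bigcupT_measurable.
      + by rewrite -ge0_fin_numE.
      rewrite setIidr// leeBlDr; last first.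
        by rewrite ge0_fin_numE// (le_lt_trans _ (_ : mu (\bigcup_k G k) < +oo)%E)//;
          [apply: le_measure; rewrite ?inE//; exact: bigcupT_measurable|rewrite -ge0_fin_numE].
      by rewrite addeC -leeBlDr// ltW.
    apply/funext => x; rewrite !indicE in_setD.
    have [xG|xG] := boolP (x \in G k); last by rewrite subr0 andbT/= ger0_norm.
    rewrite inE in xG; rewrite (mem_set (sub x xG)) /=.
    by rewrite subrr normr0.
Qed.

(** Approximation in the mean by simple functions. *)
Lemma mean_recovered_cut (w : 'rV[R]_n -> R) : integrable_fun w ->
  (forall x, ~ Q x -> w x = 0) -> rec w.
Proof.
move=> iw w0; have [mw iw'] := iw.
apply: mean_recovered_close => // e e0.
have [g [ig _ gw]] := approximation_sfun_integrable measurableT iw'.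
have [k _ kP] : \forall k \near \oo, (\int[mu]_z `|(EFin \o w) z - (g k z)%:E| < e%:E)%E.
  have nb : nbhs 0%E [set y : \bar R | (y < e%:E)%E].
    by apply: open_nbhs_nbhs; split; [exact: open_ereal_lt_ereal|rewrite /= lte_fin].
  exact: (gw _ nb).
have {}kP := kP k (leqnn k).
pose l : seq R := finmap.enum_fset (fset_set (range (g k))).
have gE x : g k x * \1_Q x = \sum_(c <- l) (c * \1_((g k @^-1` [set c]) `&` Q) x).
  rewrite fimfunE fsbig_finite//= mulr_suml; apply: eq_bigr => c _.
  by rewrite -mulrA indicI.
have mpre (c : R) : measurable (g k @^-1` [set c]).
  by rewrite -[X in measurable X]setTI; apply: measurable_funP.
exists (fun x => g k x * \1_Q x).
rewrite (_ : (fun x => g k x * \1_Q x) = (fun x => \sum_(c <- l) (c * \1_((g k @^-1` [set c]) `&` Q) x))); last exact/funext.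
have H : forall (r : seq R), integrable_fun (fun x => \sum_(c <- r) (c * \1_((g k @^-1` [set c]) `&` Q) x)) /\
    rec (fun x => \sum_(c <- r) (c * \1_((g k @^-1` [set c]) `&` Q) x)).
  elim=> [|i r [IH1 IH2]].
    have -> : (fun x => \sum_(c <- [::]) (c * \1_((g k @^-1` [set c]) `&` Q) x)) =
        (fun x => 0 * \1_(setT `&` Q) x).
      by apply/funext => x; rewrite big_nil mul0r.
    split; first exact/integrable_funZ/QI.
    by apply: mean_recoveredZ => //; [exact: QI|exact: mean_recovered_set].
  have -> : (fun x => \sum_(c <- i :: r) (c * \1_((g k @^-1` [set c]) `&` Q) x)) =
      (fun x => i * \1_((g k @^-1` [set i]) `&` Q) x +
        \sum_(c <- r) (c * \1_((g k @^-1` [set c]) `&` Q) x)).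
    by apply/funext => x; rewrite big_cons.
  have i1 := integrable_funZ i (QI (mpre i)).
  split; first exact: integrable_funD.
  apply: mean_recoveredD => //; apply: mean_recoveredZ => //; first exact: QI.
  exact: mean_recovered_set.
have [H1 H2] := H l.
split => //.
apply: le_trans (ltW kP); apply: ge0_le_integral => //.
- apply: measurable_L1; apply: measurable_funB => //; apply: measurable_funM.
    exact: measurable_funPT.
  exact: measurable_indic.
- apply: measurableT_comp => //; apply: emeasurable_funB; exact/measurable_EFinP.
move=> x _; rewrite lee_fin.
have [Qx|Qx] := pselect (Q x); first by rewrite indicE mem_set// mulr1.
by rewrite indicE memNset// mulr0 w0// subrr normr0.
Qed.

End recover_cut.

Section recover_integrable.
Context {R : realType} {n : nat} (psis : nat -> nat -> R -> R).
Hypothesis psisP : forall k, is_mollifier k.+1%:R^-1 (psis k).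
Local Notation mu := (lebesgue_row R n).

Lemma measurable_cut (w : 'rV[R]_n -> R) M : measurable_fun setT w ->
  measurable_fun setT (cut w M).
Proof.
by move=> mw; apply: measurable_funM => //; apply: measurable_indic; exact: measurable_cube.
Qed.

Lemma mean_recovered_integrable (w : 'rV[R]_n -> R) : integrable_fun w ->
  mean_recovered psis w.
Proof.
move=> iw; have [mw iw'] := iw; apply: mean_recovered_close => // e e0.
have aw : mu.-integrable setT (fun x => `|(w x)%:E|%E) by exact: integrable_abse iw'.
have cv : (\int[mu]_x `|(w x - cut w k%:R x)%:E|)%E @[k --> \oo] -->
    (\int[mu]_x (cst 0%E x : \bar R))%E.
  apply: (dominated_cvg measurableT (g := fun x => `|(w x)%:E|%E)) => //.
  - move=> k; apply: measurable_L1; apply: measurable_funB => //; exact: measurable_cut.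
  - move=> x _; apply: cvg_near_cst; exists (Num.truncn `|x|).+1 => // k /= xk.
    rewrite /cut indicE mem_set ?mulr1 ?subrr ?normr0//; apply/cubeP => i.
    rewrite (le_trans (normr_coord _ _))// ltW// (lt_le_trans (truncnS_gt _))//.
    by rewrite ler_nat.
  - move=> k x _; rewrite abse_id lee_fin /cut indicE.
    by case: (_ \in _); rewrite ?mulr1 ?mulr0 ?subrr ?subr0 ?normr0.
rewrite integral0 in cv.
have [k _ kP] : \forall k \near \oo, (\int[mu]_x `|(w x - cut w k%:R x)%:E| < e%:E)%E.
  have nb : nbhs 0%E [set y : \bar R | (y < e%:E)%E].
    by apply: open_nbhs_nbhs; split; [exact: open_ereal_lt_ereal|rewrite /= lte_fin].
  exact: (cv _ nb).
have {}kP := kP k (leqnn k).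
have ic : integrable_fun (cut w k%:R).
  by split; [exact: measurable_cut|exact/integrable_cut/integrable_locally].
exists (cut w k%:R); split => //; last exact: ltW.
apply: (mean_recovered_cut psisP (M := k%:R + 1)) => // x xQ.
rewrite /cut indicE memNset ?mulr0// => /cubeP xk; apply: xQ => i.
by rewrite (le_lt_trans (xk i))// ltrDl.
Qed.

End recover_integrable.

(** * The isoperimetric inequality for functions of bounded variation *)

Section conv_bounds.
Context {R : realType} {n : nat} (d : R) (psi : nat -> R -> R).
Hypothesis psiP : is_mollifier d psi.
Local Notation mu := (lebesgue_row R n).
Local Notation kern := (kern psi).
Local Notation conv := (conv psi).
Implicit Types (s : seq 'I_n) (w v : 'rV[R]_n -> R).

Lemma conv_add s w v x : measurable_fun setT w -> measurable_fun setT v ->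
  locally_integrable_cube w -> locally_integrable_cube v ->
  conv s (fun y => w y + v y) x = conv s w x + conv s v x.
Proof.
move=> mw mv lw lv; rewrite !convE.
under eq_Rintegral do rewrite mulrDr.
by rewrite RintegralD//; exact: (integrable_conv psiP).
Qed.

Lemma conv_norm_le s w x : measurable_fun setT w -> locally_integrable_cube w ->
  (`|conv s w x|%:E <= \int[mu]_y (`|kern s (x - y)| * `|w y|)%:E)%E.
Proof.
move=> mw lw; rewrite -abse_EFin (conv_EFin psiP)//.
have mk := measurable_kern_sub psiP s x.
apply: le_trans (le_abse_integral _ _ _) _ => //.
  by apply/measurable_EFinP; exact: measurable_funM.
by under eq_integral do rewrite abse_EFin normrM.
Qed.

Lemma conv_bounded_integrable s w : integrable_fun w ->
  exists B, forall x, `|conv s w x| <= B.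
Proof.
move=> [mw iw]; have [C C0 kC] := kern_bounded (n := n) psiP s.
have lw := integrable_locally iw.
have iaw := integrable_abse iw.
have fin : (\int[mu]_y (`|w y|)%:E)%E \is a fin_num by exact: integrable_fin_num iaw.
exists (C * fine (\int[mu]_y (`|w y|)%:E)%E) => x.
rewrite -lee_fin EFinM fineK//; apply: le_trans (conv_norm_le s x mw lw) _.
have maw : measurable_fun setT (fun y => (`|w y|)%:E).
  by apply/measurable_EFinP; exact: measurableT_comp.
have mk := measurable_kern_sub psiP s x.
rewrite -ge0_integralZl_EFin//; apply: ge0_le_integral => //.
- by apply/measurable_EFinP; apply: measurable_funM; exact: measurableT_comp.
- exact: measurable_funeM.
by move=> y _; rewrite -EFinM lee_fin ler_wpM2r.
Qed.

Lemma conv_bounded_bounded s w (K : R) : measurable_fun setT w ->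
  (forall y, `|w y| <= K) -> exists B, forall x, `|conv s w x| <= B.
Proof.
move=> mw wK; have [C C0 kC] := kern_bounded (n := n) psiP s.
have lw := locally_integrable_bounded mw wK.
have K0 : 0 <= K by exact: le_trans (wK 0).
have fin : mu (@cube R n d) \is a fin_num by rewrite ge0_fin_numE// measure_cube_lty.
exists (K * (C * fine (mu (@cube R n d)))) => x.
rewrite -lee_fin EFinM EFinM fineK//; apply: le_trans (conv_norm_le s x mw lw) _.
have mk := measurable_kern psiP s.
have mks := measurable_kern_sub psiP s x.
have mK : measurable_fun setT (fun y => (`|kern s y|)%:E).
  by apply/measurable_EFinP; exact: measurableT_comp.
apply: (@le_trans _ _ (K%:E * \int[mu]_y (`|kern s y|)%:E)%E).
  rewrite -(integral_reflect x mK)//.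
  rewrite -ge0_integralZl_EFin//; last by apply/measurable_EFinP; exact: measurableT_comp.
  apply: ge0_le_integral => //.
  - by apply/measurable_EFinP; apply: measurable_funM; exact: measurableT_comp.
  - by apply: measurable_funeM; apply/measurable_EFinP; exact: measurableT_comp.
  by move=> y _; rewrite -EFinM lee_fin mulrC ler_wpM2r.
apply: lee_wpmul2l; first by rewrite lee_fin.
rewrite -(setIT (@cube R n d)) -integral_indic//; last exact: measurable_cube.
rewrite -ge0_integralZl_EFin//; last first.
  by apply/measurable_EFinP; apply: measurable_indic; exact: measurable_cube.
apply: ge0_le_integral => //.
- by apply: measurable_funeM; apply/measurable_EFinP; apply: measurable_indic; exact: measurable_cube.
move=> y _; rewrite -EFinM lee_fin.
have [->|k0] := eqVneq (kern s y) 0; first by rewrite normr0 mulr_ge0.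
rewrite indicE mem_set ?mulr1//; apply/cubeP => i.
exact: ltW (kern_supp psiP k0 i).
Qed.

End conv_bounds.

Section clipping.
Context {R : realType} {T : Type}.
Implicit Types (u : T -> R) (t : R).

(** The values of u are split at the level t: the clipped part is moved by at most t under
    mollification, and the excess is integrable as soon as u lies in some L^p with p >= 1. *)
Definition clip t u x : R := Num.max (- t) (Num.min t (u x)).

Definition excess t u x : R := u x - clip t u x.

Lemma clip_le t u x : 0 <= t -> `|clip t u x| <= t.
Proof.
move=> t0; rewrite /clip ler_norml le_max lexx/= ge_max ge_min lexx/= andbT.
by rewrite (le_trans _ t0)// oppr_le0.
Qed.

Lemma clip_excess t u x : clip t u x + excess t u x = u x.
Proof. by rewrite /excess subrKC. Qed.

Lemma excess_norm t u x : 0 <= t -> `|excess t u x| = Num.max 0 (`|u x| - t).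
Proof.
move=> t0; rewrite /excess /clip.
have [h1|h1] := leP t (u x).
  have -> : Num.max (- t) t = t by apply/max_idPr; rewrite (le_trans _ t0)// oppr_le0.
  rewrite !ger0_norm ?subr_ge0//; last exact: le_trans h1.
  by apply/esym/max_idPr; rewrite subr_ge0.
have [h2|h2] := leP (- t) (u x).
  rewrite subrr normr0; apply/esym/max_idPl.
  by rewrite subr_le0 ler_norml h2 ltW.
rewrite !ltr0_norm ?subr_lt0//; last by rewrite (lt_le_trans h2)// oppr_le0.
rewrite opprB [- t - _]addrC; apply/esym/max_idPr.
by rewrite subr_ge0 lerNr ltW.
Qed.

End clipping.

(** Absorbs a small error in measure into a small error of its power. *)
Lemma powR_subadd (R : realType) (a b r : R) : 0 <= a -> 0 <= b -> 0 < r <= 1 ->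
  (a + b) `^ r <= a `^ r + b `^ r.
Proof.
move=> a0 b0 /andP[r0 r1].
have [->|an] := eqVneq a 0; first by rewrite add0r lerDr powR_ge0.
have ab : 0 < a + b by rewrite ltr_wpDr// lt_neqAle eq_sym an.
have H c : 0 <= c -> c <= a + b -> c / (a + b) <= (c / (a + b)) `^ r.
  move=> c0 cab; have [->|cn] := eqVneq c 0; first by rewrite mul0r powR_ge0.
  have q0 : 0 < c / (a + b) by rewrite divr_gt0// lt_neqAle eq_sym cn.
  rewrite -[leLHS]powRr1 ?(ltW q0)//; apply: ger_powR => //.
  by rewrite q0/= ler_pdivrMr// mul1r.
have abr : 0 < (a + b) `^ r by rewrite powR_gt0.
have E c : 0 <= c -> c `^ r = (c / (a + b)) `^ r * (a + b) `^ r.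
  by move=> c0; rewrite -powRM ?divr_ge0 ?(ltW ab)// divfK// gt_eqF.
rewrite (E a)// (E b)// -mulrDl ler_peMl ?(ltW abr)//.
apply: le_trans (_ : _ <= a / (a + b) + b / (a + b)) _.
  by rewrite -mulrDl divff// gt_eqF.
by rewrite lerD// H// ?lerDl ?lerDr.
Qed.

Lemma measure_level_markov (R : realType) (n : nat) (w : 'rV[R]_n -> R) (t : R) :
  measurable_fun setT w -> 0 < t ->
  (lebesgue_row R n [set x | (t < `|w x|)%R] <=
   t^-1%:E * \int[lebesgue_row R n]_x `|(w x)%:E|)%E.
Proof.
move=> mw t0; have mw' : measurable_fun setT (EFin \o w) by exact/measurable_EFinP.
have := le_integral_abse (lebesgue_row R n) measurableT mw' t0; rewrite setTI => H.
apply: (@le_trans _ _ (t^-1%:E * (t%:E * lebesgue_row R n [set x | (t%:E <= `|(w x)%:E|)%E]))%E).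
  rewrite muleA -EFinM mulVf ?gt_eqF// mul1e; apply: le_measure; rewrite ?inE.
  - exact: measurable_level.
  - rewrite -[X in measurable X]setTI; apply: emeasurable_fun_c_infty => //.
    exact: measurableT_comp.
  - by move=> x /= tx; rewrite lee_fin ltW.
by apply: lee_wpmul2l; rewrite ?lee_fin ?invr_ge0 ?(ltW t0).
Qed.

Lemma norm_excess_le (R : realType) T (u : T -> R) x t : 0 <= t -> `|u x| <= t + `|excess t u x|.
Proof.
move=> t0; rewrite -[in leLHS](clip_excess t u x) (le_trans (ler_normD _ _))// lerD2r.
exact: clip_le.
Qed.

Lemma level_transfer (R : realType) (s t a b c d : R) :
  s + 3 * t < `|a| -> `|b - c| <= t -> `|a| <= t + `|d| -> `|c - d| <= t -> s < `|b|.
Proof.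
move=> h1 h2 h3 h4.
have h5 : `|d| <= `|c| + `|c - d| by rewrite -{1}[d](subKr c) ler_normB.
have h6 : `|c| <= `|b| + `|b - c| by rewrite -{1}[c](subKr b) ler_normB.
lra.
Qed.

Section lower_semicontinuity.
Context {R : realType} {n : nat}.
Hypothesis n2 : (2 <= n)%N.
Local Notation mu := (lebesgue_row R n).
Local Notation leb := (@lebesgue_measure R).
Local Notation alpha := ((n%:R - 1) / n%:R : R).
Local Notation S := (@isoperimetric_constant R n).
Variable u : 'rV[R]_n -> R.
Hypothesis mu_ : measurable_fun setT u.
Hypothesis eu : forall t, 0 < t -> integrable_fun (excess t u).

Let measurable_clip t : measurable_fun setT (clip t u).
Proof. by apply: measurable_maxr => //; exact: measurable_minr. Qed.

Let lclip t : 0 < t -> locally_integrable_cube (clip t u).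
Proof.
move=> t0; apply: (@locally_integrable_bounded _ _ _ t) => //.
by move=> y; apply: clip_le; exact: ltW.
Qed.

Lemma excess_integrable_locally : locally_integrable_cube u.
Proof.
move=> M; have [mr ir] := eu ltr01.
have mC := @measurable_cube R n M.
have := integrableD mC (lclip ltr01 M) (integrable_locally ir M).
congr (integrable _ _ _); apply/funext => x /=.
by rewrite -EFinD clip_excess.
Qed.

Section one_mollifier.
Variables (d : R) (psi : nat -> R -> R).
Hypothesis psiP : is_mollifier d psi.
Local Notation conv := (conv psi).

Let conv_split s t x : 0 < t ->
  conv s u x = conv s (clip t u) x + conv s (excess t u) x.
Proof.
move=> t0; have [mr ir] := eu t0.
rewrite -(conv_add psiP)//; [|exact: lclip|exact: integrable_locally].
by congr (conv s _ x); apply/funext => y; rewrite clip_excess.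
Qed.

Lemma conv_uniformly_bounded s : exists B, forall x, `|conv s u x| <= B.
Proof.
have [B1 H1] := conv_bounded_bounded psiP s (measurable_clip 1) (fun y => clip_le u y ler01).
have [B2 H2] := conv_bounded_integrable psiP s (eu ltr01).
exists (B1 + B2) => x; rewrite (conv_split _ _ ltr01).
by rewrite (le_trans (ler_normD _ _))// lerD.
Qed.

Lemma conv_clip_le t x : 0 < t -> `|conv [::] (clip t u) x| <= t.
Proof.
move=> t0; have lt := lclip t0.
have mN : measurable_fun setT (fun y => -1 * clip t u y) by exact: measurable_funM.
have cl y : `|clip t u y| <= t by apply: clip_le; exact: ltW.
rewrite ler_norml; apply/andP; split; last first.
  by apply: (conv_le_cst psiP) => // y; rewrite (le_trans (ler_norm _)).
rewrite lerNl -mulN1r -(conv_scale psiP)//; apply: (conv_le_cst psiP) => //.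
  by apply: (@locally_integrable_bounded _ _ _ t) => // y; rewrite mulN1r normrN.
by move=> y; rewrite mulN1r (le_trans (ler_norm _))// normrN.
Qed.

Lemma conv_excess_dist t x : 0 < t ->
  `|conv [::] u x - conv [::] (excess t u) x| <= t.
Proof.
by move=> t0; rewrite (conv_split _ _ t0) addrK conv_clip_le.
Qed.

End one_mollifier.

Variable psis : nat -> nat -> R -> R.
Hypothesis psisP : forall k, is_mollifier k.+1%:R^-1 (psis k).
Local Notation T k := (conv (n := n) (psis k) [::]).

Lemma mollified_level_finite k t : 0 < t -> (mu [set x | (t < `|T k u x|)%R] < +oo)%E.
Proof.
move=> t0; have t2 : 0 < t / 2 by rewrite divr_gt0.
have iw := eu t2; have mT := mollified_measurable psisP k iw.
have mU : measurable_fun setT (T k u).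
  by apply: (measurable_conv (psisP k)) => //; exact: excess_integrable_locally.
apply: (@le_lt_trans _ _ (mu [set x | (t / 2 < `|T k (excess (t / 2) u) x|)%R])).
  apply: le_measure; rewrite ?inE; [exact: measurable_level..|].
  move=> x /= tx; have h := conv_excess_dist (psisP k) x t2.
  rewrite -(ltrD2l (t / 2)) -splitr (lt_le_trans tx)//.
  rewrite -[T k u x](subrK (T k (excess (t / 2) u) x)).
  by rewrite (le_trans (ler_normD _ _))// lerD2r.
apply: le_lt_trans (measure_level_markov mT t2) _.
have [_ iw'] := iw; have /integrableP[_ fin] := iw'.
rewrite lte_mul_pinfty ?lee_fin ?invr_ge0 ?(ltW t2)//.
exact: le_lt_trans (mollified_L1_contraction psisP k iw) fin.
Qed.

(** The bounds on f and on its derivatives that the smooth inequality asks for hold globally,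
    because u is the sum of a bounded and of an integrable function. *)
Lemma isoperimetric_conv k : (S%:E * level_integral (T k u) <= bv_seminorm u)%E.
Proof.
have lu := excess_integrable_locally; have psiP := psisP k.
have /choice[C CP] : forall ij : 'I_n * 'I_n, exists B, forall x, `|conv (psis k) [:: ij.2; ij.1] u x| <= B.
  by move=> ij; exact: conv_uniformly_bounded.
have /choice[D DP] : forall i : 'I_n, exists B, forall x, `|conv (psis k) [:: i] u x| <= B.
  by move=> i; exact: conv_uniformly_bounded.
have [B BP] := conv_uniformly_bounded psiP [::].
apply: le_trans (integral_gradient_conv (ltnW n2) psiP mu_ lu).
apply: (@isoperimetric_smooth R n n2 (T k u) (fun i => conv (psis k) [:: i] u)
  (fun i j => conv (psis k) [:: j; i] u)
  (\sum_ij `|C ij|) (Num.max B (\sum_i `|D i|))).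
- by move=> i y; exact: (conv_derive psiP).
- by move=> i j y; exact: (conv_derive psiP).
- move=> i j y; apply: le_trans (CP (i, j) y) _; rewrite (le_trans (ler_norm _))//.
  by rewrite (bigD1 (i, j))//= lerDl sumr_ge0.
- exact: (measurable_conv psiP).
- by move=> i; exact: (measurable_conv psiP).
- by move=> y; rewrite le_max BP.
- move=> y; rewrite le_max; apply/orP; right.
  apply: le_trans (enorm_le_sum _) _; apply: ler_sum => i _; rewrite mxE.
  by rewrite (le_trans (DP i y))// ler_norm.
- by move=> t; exact: mollified_level_finite.
Qed.

(** The inequality holds for the excess of u by Markov's inequality and convergence in
    the mean.  The levels shift three times by t: for the clipping of u, for that of its
    mollification, and in Markov's inequality.  The same k serves all levels s. *)
Lemma level_mollified_near (t e : R) : 0 < t -> 0 < e -> exists k, forall s,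
  (mu [set x | (s + 3 * t < `|u x|)%R] <= mu [set x | (s < `|T k u x|)%R] + e%:E)%E.
Proof.
move=> t0 e0; have iw := eu t0.
have te : 0 < t * e by rewrite mulr_gt0.
have [k kP] := mean_recovered_integrable psisP iw te.
have {}kP := kP k (leqnn k); exists k => s.
have mT := mollified_measurable psisP k iw.
have mU : measurable_fun setT (T k u).
  by apply: (measurable_conv (psisP k)) => //; exact: excess_integrable_locally.
pose D x := T k (excess t u) x - excess t u x.
have mD : measurable_fun setT D by apply: measurable_funB => //; exact: iw.1.
apply: (@le_trans _ _ (mu ([set x | (s < `|T k u x|)%R] `|` [set x | (t < `|D x|)%R]))).
  apply: le_measure; rewrite ?inE; [exact: measurable_level|apply: measurableU; exact: measurable_level|].
  move=> x /= ux; have [Dx|Dx] := ltP t `|D x|; [by right|left].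
  exact: (level_transfer ux (conv_excess_dist (psisP k) x t0) (norm_excess_le u x (ltW t0)) Dx).
apply: le_trans (measureU2 _ _ _) _; [exact: measurable_level..|].
apply: leeD => //.
apply: le_trans (measure_level_markov mD t0) _.
apply: le_trans (lee_wpmul2l _ kP) _; first by rewrite lee_fin invr_ge0 ltW.
by rewrite -EFinM lee_fin mulKf// gt_eqF.
Qed.

End lower_semicontinuity.

Lemma poweR_le_add (R : realType) (a b : \bar R) (e r : R) : (0 <= a)%E -> (0 <= b)%E ->
  b \is a fin_num -> 0 <= e -> 0 < r <= 1 -> (a <= b + e%:E)%E ->
  (a `^ r <= b `^ r + (e `^ r)%:E)%E.
Proof.
case: a b => [a| |] [b| |]// a0 b0 _ e0 r01 abe.
rewrite !poweR_EFin -EFinD lee_fin; rewrite !lee_fin in a0 b0 abe.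
apply: le_trans (powR_subadd b0 e0 r01); apply: ge0_ler_powR => //.
- by case/andP: r01 => /ltW.
- by rewrite nnegrE addr_ge0.
Qed.

(** Reduction to bounded intervals, where a constant error is integrable. *)
Lemma integral_ray_le_segments (R : realType) (phi : R -> \bar R) (c : R) (B : \bar R) :
  measurable_fun setT (phi : measurableTypeR R -> \bar R) -> (forall t, 0 <= phi t)%E ->
  (forall k : nat, (\int[lebesgue_measure]_(t in `[c, (c + k%:R)%R]) phi t <= B)%E) ->
  (\int[lebesgue_measure]_(t in `[c, +oo[) phi t <= B)%E.
Proof.
move=> mphi phi0 H.
have bT : \bigcup_(k : nat) `[c, c + k%:R]%classic = `[c, +oo[%classic.
  apply/seteqP; split => t /=.
    by move=> [k _]; rewrite /= !in_itv/= andbT => /andP[].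
  rewrite in_itv/= andbT => ct; exists (Num.truncn (t - c)).+1 => //=.
  by rewrite in_itv/= ct/= -lerBlDl ltW// truncnS_gt.
have cv := @ge0_nondecreasing_set_cvg_integral _ _ R
  (fun k : nat => `[c, c + k%:R]%classic : set (measurableTypeR R)) phi lebesgue_measure _ _ _ _.
have {}cv : (\int[lebesgue_measure]_(x in `[c, (c + k%:R)%R]) phi x @[k --> \oo] -->
    \int[lebesgue_measure]_(x in \bigcup_(k : nat) `[c, (c + k%:R)%R]%classic) phi x)%E.
  apply: cv => //.
  - move=> k l kl; apply/subsetPset => t /=; rewrite !in_itv/= => /andP[-> h]/=.
    by rewrite (le_trans h)// lerD2l ler_nat.
  - by move=> k; exact: measurable_funTS.
rewrite bT in cv; rewrite -(cvg_lim _ cv)//; apply: lime_le.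
  by apply/cvg_ex; eexists; exact: cv.
by apply: nearW => k; exact: H.
Qed.

Section isoperimetric_bv.
Context {R : realType} {n : nat}.
Hypothesis n2 : (2 <= n)%N.
Local Notation mu := (lebesgue_row R n).
Local Notation leb := (@lebesgue_measure R).
Local Notation alpha := ((n%:R - 1) / n%:R : R).
Local Notation S := (@isoperimetric_constant R n).

Let alpha01 : 0 < alpha <= 1.
Proof.
have n0 : 0 < n%:R :> R by rewrite ltr0n (leq_trans _ n2).
have n1 : 1 < n%:R :> R by rewrite ltr1n.
by rewrite divr_gt0 ?subr_gt0//= ler_pdivrMr// mul1r gerBl.
Qed.

(** Lower semicontinuity: on a bounded interval of levels away from 0, shift the levels
    by c / 2 and let the error in measure tend to 0. *)
Lemma isoperimetric_bv (u : 'rV[R]_n -> R) : measurable_fun setT u ->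
  (forall t, 0 < t -> integrable_fun (excess t u)) ->
  (S%:E * level_integral u <= bv_seminorm u)%E.
Proof.
move=> mu_ eu.
have S0 : 0 < S by exact: isoperimetric_constant_gt0.
have /choice[psis psisP] : forall k : nat, exists psi, is_mollifier (k.+1%:R^-1 : R) psi.
  by move=> k; exact: exists_mollifier.
pose B := (S^-1%:E * bv_seminorm u)%E.
suff H : (level_integral u <= B)%E.
  apply: le_trans (lee_wpmul2l _ H) _; first by rewrite lee_fin ltW.
  by rewrite /B muleA -EFinM divff ?gt_eqF// mul1e.
have TB k : (level_integral (conv (n := n) (psis k) [::] u) <= B)%E.
  have := isoperimetric_conv n2 mu_ eu psisP k => h.
  have := @lee_wpmul2l _ S^-1%:E _ _ _ h.
  rewrite muleA -EFinM mulVf ?gt_eqF// mul1e; apply.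
  by rewrite lee_fin invr_ge0 ltW.
have mlp := measurable_level_power mu_.
rewrite /level_integral; apply: integral_ray_le => //; first by move=> t; exact: poweR_ge0.
move=> c c0; apply: integral_ray_le_segments => //; first by move=> t; exact: poweR_ge0.
move=> L; apply/lee_addgt0Pr => dl dl0.
have L1 : 0 < L%:R + 1 :> R by rewrite ltr_wpDl.
pose eta := dl / (L%:R + 1); have eta0 : 0 < eta by rewrite divr_gt0.
have al0 : 0 < alpha by case/andP: alpha01.
(* an error e in measure becomes an error eta in its power *)
pose e := eta `^ alpha^-1.
have e0 : 0 < e by rewrite powR_gt0.
have ea : e `^ alpha = eta by rewrite /e -powRrM mulVf ?gt_eqF// powRr1// ltW.
have c6 : 0 < c / 6 by rewrite divr_gt0.
have [k kP] := level_mollified_near mu_ eu psisP c6 e0.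
set v := conv (n := n) (psis k) [::] u in kP.
have mv : measurable_fun setT v.
  by apply: (measurable_conv (psisP k)) => //; exact: excess_integrable_locally.
have mvp := measurable_level_power mv.
pose phi (s : R) := (mu [set x | (s - c / 2 < `|v x|)%R] `^ alpha)%E.
have mphi : measurable_fun setT (phi : measurableTypeR R -> \bar R).
  have ms : measurable_fun setT (fun s : measurableTypeR R => s - c / 2 : measurableTypeR R).
    exact: measurable_funB.
  exact: measurableT_comp mvp ms.
have phi0 s : (0 <= phi s)%E by exact: poweR_ge0.
apply: (@le_trans _ _ (\int[leb]_(s in `[c, (c + L%:R)%R]) (phi s + eta%:E))%E).
  apply: ge0_le_integral => //.
  - by move=> t _; exact: poweR_ge0.
  - exact: measurable_funTS.
  - by apply: emeasurable_funD => //; exact: measurable_funTS.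
  - move=> s; rewrite /= in_itv/= => /andP[cs _]; rewrite -ea; apply: poweR_le_add => //.
    + rewrite ge0_fin_numE//; apply: (mollified_level_finite mu_ eu psisP k).
      by rewrite subr_gt0 (lt_le_trans _ cs)// gtr_pMr// invf_lt1// ltr1n.
    + exact: ltW.
    + apply: le_trans (kP (s - c / 2)); rewrite (_ : s - c / 2 + 3 * (c / 6) = s)//.
      by field.
rewrite ge0_integralD//; last 2 first.
- exact: measurable_funTS.
- by move=> s _; rewrite lee_fin ltW.
apply: leeD; last first.
  rewrite integral_cst//= lebesgue_measure_itv/=; case: ifPn => _; last by rewrite mule0 lee_fin ltW.
  rewrite -EFinB -EFinM lee_fin addrAC subrr add0r /eta mulrAC ler_pdivrMr//.
  by rewrite mulrDr mulr1 lerDl ltW.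
apply: le_trans (TB k).
apply: (@le_trans _ _ (\int[leb]_(s in `[(c / 2)%R, +oo[) phi s)%E).
  apply: ge0_subset_integral => //; first exact: measurable_funTS.
  move=> s /=; rewrite !in_itv/= andbT => /andP[cs _].
  by rewrite (le_trans _ cs)// ger_pMr// invf_le1// ler1n.
rewrite -integral_shift_ray// /level_integral; apply: ge0_le_integral => //.
- apply: measurable_funTS.
  have ms : measurable_fun setT (fun s : measurableTypeR R => c / 2 + s : measurableTypeR R).
    exact: measurable_funD.
  exact: measurableT_comp mphi ms.
- exact: measurable_funTS.
- by move=> s _; rewrite /phi (addrC (c / 2)) addrK.
Qed.

End isoperimetric_bv.

(** * The Hardy weight and the normalisation, level by level *)

Lemma integral_ray_powR (R : realType) (b a : R) : 0 < b -> 1 < a ->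
  (\int[lebesgue_measure]_(t in `[b, +oo[) (t `^ (- a))%:E =
   (b `^ (1 - a) / (a - 1))%:E)%E.
Proof.
move=> b0 a1; have a10 : 0 < a - 1 by rewrite subr_gt0.
pose F (t : R) := - (a - 1)^-1 * t `^ (1 - a).
have dF (t : R) : 0 < t -> is_derive t 1 F (t `^ (- a)).
  move=> t0; have d := is_derive1_powR (1 - a) t0.
  have -> : F = - (a - 1)^-1 \*: (@powR R ^~ (1 - a)) by [].
  apply: is_derive_eq; rewrite /GRing.scale/= mulrA (_ : 1 - a - 1 = - a); last by ring.
  by rewrite mulNr -mulrN opprB mulVf ?mul1r// gt_eqF.
rewrite (@ge0_continuous_FTC2y _ (fun t => t `^ (- a)) F b 0).
- by rewrite -EFinB; congr EFin; rewrite /F; ring.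
- by move=> t _; exact: powR_ge0.
- apply: continuous_in_subspaceT => t; rewrite inE/= in_itv/= andbT => bt.
  apply: differentiable_continuous; apply/derivable1_diffP.
  by have [] := is_derive1_powR (- a) (lt_le_trans b0 bt).
- apply/cvgrPdist_lt => e e0; pose M := ((a - 1) * e)^-1 `^ (a - 1)^-1; near=> t.
  have tM : M < t by near: t; apply: nbhs_pinfty_gt; exact: num_real.
  have t0 : 0 < t by near: t; exact: nbhs_pinfty_gt.
  rewrite sub0r normrN /F normrM normrN !gtr0_norm ?invr_gt0 ?powR_gt0//.
  rewrite -[1 - a]opprB powRN -ltr_pdivlMl ?invr_gt0// invrK -[ltRHS]invrK ltf_pV2 ?posrE ?powR_gt0 ?invr_gt0 ?mulr_gt0//.
  have -> : ((a - 1) * e)^-1 = M `^ (a - 1).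
    by rewrite -powRrM mulVf ?gt_eqF// powRr1// invr_ge0 mulr_ge0// ltW.
  by apply: gt0_ltr_powR => //; rewrite ?nnegrE ?powR_ge0 ?(ltW t0).
- by move=> t bt; have [] := dF _ (lt_trans b0 bt).
- apply: cvg_at_right_filter; apply: differentiable_continuous; apply/derivable1_diffP.
  by have [] := dF _ b0.
- move=> t; rewrite in_itv/= andbT => bt; rewrite derive1E.
  by have [_ ->] := dF _ (lt_trans b0 bt).
Unshelve. all: by end_near. Qed.

Section hardy.
Context {R : realType} {n : nat}.
Hypothesis n2 : (2 <= n)%N.
Local Notation mu := (lebesgue_row R n).
Local Notation leb := (@lebesgue_measure R).
Local Notation alpha := ((n%:R - 1) / n%:R : R).
Local Notation om := (ball_volume R n).

Let n0 : 0 < n%:R :> R. Proof. by rewrite ltr0n (leq_trans _ n2). Qed.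
Let n1 : 1 < n%:R :> R. Proof. by rewrite ltr1n. Qed.

Lemma measurable_inv_enorm : measurable_fun setT (fun x : 'rV[R]_n => (enorm x)^-1).
Proof. by apply: measurable_inv_ge0; [exact: measurable_enorm|exact: enorm_ge0]. Qed.

Lemma integral_ray_eball (b : R) : 0 < b ->
  (\int[leb]_(t in `[b, +oo[) (t `^ (- n%:R) * om)%:E = (om * b^-1 ^+ n.-1 / (n%:R - 1))%:E)%E.
Proof.
move=> b0; have bn : b `^ (1 - n%:R) = b^-1 ^+ n.-1.
  have -> : 1 - n%:R = - n.-1%:R :> R by rewrite -subn1 natrB ?(ltnW n2)// opprB.
  by rewrite powRN powR_mulrn ?(ltW b0)// exprVn.
rewrite -bn (mulrC om) mulrAC EFinM -integral_ray_powR// muleC.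
rewrite -ge0_integralZl_EFin ?(ltW (ball_volume_gt0 _ _))//; last 2 first.
- by move=> t _; rewrite lee_fin powR_ge0.
- by apply/measurable_EFinP; apply: measurable_funTS; exact: measurable_powR.
by apply: eq_integral => t _; rewrite -EFinM mulrC.
Qed.

(** Layer cake: {1 / |x| > t} is the ball of radius 1 / t, so that its part in E has
    measure at most min(|E|, om t^(-n)); the two bounds agree at t = 1 / r, where r is the
    radius of the ball of measure |E|. *)
Lemma integral_inv_enorm_le (E : set 'rV[R]_n) r : measurable E -> 0 < r ->
  mu E = (r ^+ n * om)%:E ->
  (\int[mu]_(x in E) ((enorm x)^-1)%:E <= (om * r ^+ n.-1 * (n%:R / (n%:R - 1)))%:E)%E.
Proof.
move=> mE r0 muE.
pose f x := (enorm x)^-1 * \1_E x.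
have mf : measurable_fun setT f.
  by apply: measurable_funM; [exact: measurable_inv_enorm|exact: measurable_indic].
have f0 x : 0 <= f x by apply: mulr_ge0 => //; rewrite invr_ge0 enorm_ge0.
have -> : (\int[mu]_(x in E) ((enorm x)^-1)%:E = \int[mu]_x (f x)%:E)%E.
  rewrite integral_mkcond; apply: eq_integral => x _; rewrite /patch /f indicE.
  by case: (_ \in _); rewrite ?mulr1 ?mulr0.
rewrite (layer_cake mu mf f0).
have mS t : measurable [set x | t < f x] by exact: measurable_superlevel.
have ml : measurable_fun setT (fun t : measurableTypeR R => mu [set x | (t < f x)%R]).
  have := @measurable_level_measure R n f mf.
  by under eq_fun do under eq_set do rewrite ger0_norm//.
have ri0 : 0 < r^-1 by rewrite invr_gt0.
rewrite (_ : `[0%R, +oo[%classic = `[0%R, r^-1[%classic `|` `[r^-1, +oo[%classic); last first.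
  apply/seteqP; split => t /=; rewrite !in_itv/= ?andbT.
    by move=> t0; have [h|h] := ltP t r^-1; [left|right]; rewrite ?t0.
  by move=> [/andP[]//|]; apply: le_trans; exact: ltW.
rewrite ge0_integral_setU//; last 2 first.
- exact: measurable_funTS.
- apply/disj_set2P/seteqP; split => // t [] /=; rewrite !in_itv/= andbT.
  by move=> /andP[_ h1] h2; rewrite ltNge h2 in h1.
have -> : om * r ^+ n.-1 * (n%:R / (n%:R - 1)) = (r ^+ n * om) * r^-1 + om * r^-1^-1 ^+ n.-1 / (n%:R - 1).
  have -> : r ^+ n = r * r ^+ n.-1 by rewrite -exprS prednK// ltnW.
  rewrite invrK.
  have nn : n%:R - 1 != 0 :> R by rewrite subr_eq0 gt_eqF.
  by have rn : r != 0 by [rewrite gt_eqF]; field; rewrite nn rn.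
rewrite EFinD; apply: leeD.
  apply: (@le_trans _ _ (\int[leb]_(t in `[0%R, (r^-1)%R[) (r ^+ n * om)%:E)%E).
    apply: ge0_le_integral => //; first exact: measurable_funTS.
    move=> t Dt; rewrite -muE; apply: le_measure; rewrite ?inE// => x /=.
    rewrite /f indicE; have [xE|xE] := boolP (x \in E); first by rewrite inE in xE.
    by rewrite mulr0 => t0; move: Dt; rewrite /= in_itv/= leNgt t0.
  by rewrite integral_cst//= lebesgue_measure_itv/= lte_fin ri0 -EFinB subr0 -EFinM.
rewrite -integral_ray_eball//; apply: ge0_le_integral => //.
- exact: measurable_funTS.
- apply/measurable_EFinP; apply: measurable_funTS.
  have mp : measurable_fun setT (fun t : R => t `^ (- n%:R)) by exact: measurable_powR.
  by apply: measurable_funM.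
- move=> t; rewrite /= in_itv/= andbT => rt; have t0 : 0 < t by exact: lt_le_trans rt.
  rewrite powRN powR_mulrn ?(ltW t0)// -exprVn -measure_eball ?invr_gt0//; apply: le_measure; rewrite ?inE//.
    exact: measurable_eball.
  move=> x; rewrite /= /f /eball/= => tx.
  have h : t < (enorm x)^-1.
    apply: lt_le_trans tx _; rewrite indicE ler_piMr ?invr_ge0 ?enorm_ge0//.
    by case: (_ \in _).
  have x0 : 0 < enorm x by rewrite -invr_gt0 (lt_trans t0).
  by rewrite -[ltLHS]invrK ltf_pV2 ?posrE ?invr_gt0.
Qed.

Lemma integral_inv_enorm_power (E : set 'rV[R]_n) : measurable E ->
  (\int[mu]_(x in E) ((enorm x)^-1)%:E <=
   (om `^ n%:R^-1 * (n%:R / (n%:R - 1)))%:E * mu E `^ alpha)%E.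
Proof.
move=> mE; have om0 := ball_volume_gt0 R n.
have al0 : 0 < alpha by rewrite divr_gt0 ?subr_gt0.
have nn : n%:R - 1 != 0 :> R by rewrite subr_eq0 gt_eqF.
have K0 : 0 < om `^ n%:R^-1 * (n%:R / (n%:R - 1)) by rewrite mulr_gt0 ?powR_gt0 ?divr_gt0 ?subr_gt0.
have [Efin|] := boolP (mu E \is a fin_num); last first.
  rewrite ge0_fin_numE// -leNgt leye_eq => /eqP ->.
  by rewrite poweRyr ?gt_eqF// gt0_muley ?leey ?lte_fin.
have [E0|E0] := eqVneq (mu E) 0%E.
  rewrite (@null_set_integral _ _ _ mu E) ?mule_ge0 ?poweR_ge0 ?lee_fin ?(ltW K0)//.
  by apply: measurable_funTS; apply/measurable_EFinP; exact: measurable_inv_enorm.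
pose a := fine (mu E).
have a0 : 0 < a by rewrite fine_gt0// lt_neqAle eq_sym E0 measure_ge0 ltey_eq Efin.
(* the radius of the ball of the same measure as E *)
pose r := (a / om) `^ n%:R^-1.
have ao : 0 < a / om by rewrite divr_gt0.
have r0 : 0 < r by rewrite powR_gt0.
have rn : r ^+ n = a / om.
  rewrite -powR_mulrn ?(ltW r0)// /r -powRrM mulVf ?gt_eqF// powRr1// divr_ge0// ltW//.
have muE : mu E = (r ^+ n * om)%:E by rewrite rn divfK ?gt_eqF// fineK.
apply: le_trans (integral_inv_enorm_le mE r0 muE) _.
rewrite -(fineK Efin) -/a poweR_EFin -EFinM lee_fin.
rewrite [leRHS]mulrAC ler_wpM2r ?divr_ge0 ?subr_ge0 ?(ltW n0) ?(ltW n1)//.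
rewrite le_eqVlt; apply/orP; left; apply/eqP.
have -> : r ^+ n.-1 = (a / om) `^ alpha.
  rewrite -powR_mulrn ?(ltW r0)// /r -powRrM -subn1 natrB ?(ltnW n2)//.
  by congr (_ `^ _); rewrite mulrC.
have omE : om `^ n%:R^-1 = om * om^-1 `^ alpha.
  rewrite -[om^-1]powR_inv1 ?(ltW om0)// -powRrM -{2}[om]powRr1 ?(ltW om0)//.
  rewrite -powRD; last by rewrite (gt_eqF om0) implybT.
  by congr (_ `^ _); field; rewrite gt_eqF.
by rewrite powRM ?invr_ge0 ?(ltW a0) ?(ltW om0)// omE; ring.
Qed.

Lemma hardy_level (u : 'rV[R]_n -> R) : measurable_fun setT u ->
  (\int[mu]_x (`|u x| / enorm x)%:E <=
   (om `^ n%:R^-1 * (n%:R / (n%:R - 1)))%:E * level_integral u)%E.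
Proof.
move=> mu_.
have mg : measurable_fun setT (fun x : 'rV[R]_n => ((enorm x)^-1)%:E).
  by apply/measurable_EFinP; exact: measurable_inv_enorm.
have mau : measurable_fun setT (fun x => `|u x|) by exact: measurableT_comp.
have K0 : 0 <= om `^ n%:R^-1 * (n%:R / (n%:R - 1)).
  by rewrite mulr_ge0 ?powR_ge0 ?divr_ge0 ?subr_ge0 ?(ltW n0) ?(ltW n1).
have -> : (\int[mu]_x (`|u x| / enorm x)%:E = \int[mu]_x (((enorm x)^-1)%:E * (`|u x|)%:E))%E.
  by apply: eq_integral => x _; rewrite -EFinM mulrC.
have g0 (x : 'rV[R]_n) : (0 <= ((enorm x)^-1)%:E)%E by rewrite lee_fin invr_ge0 enorm_ge0.
rewrite (layer_cake_weighted mu mau _ mg g0)//.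
rewrite /level_integral -ge0_integralZl_EFin//; last 2 first.
- by move=> t _; exact: poweR_ge0.
- by apply: measurable_funTS; exact: measurable_level_power.
apply: ge0_le_integral => //.
- by move=> t _; exact: integral_ge0.
- by apply: measurable_funTS; exact: measurable_layer.
- by apply: measurable_funeM; apply: measurable_funTS; exact: measurable_level_power.
by move=> t _; apply: integral_inv_enorm_power; exact: measurable_level.
Qed.

End hardy.

Section extremal_levels.
Context {R : realType} {n : nat}.
Hypothesis n2 : (2 <= n)%N.
Local Notation mu := (lebesgue_row R n).
Local Notation leb := (@lebesgue_measure R).
Local Notation alpha := ((n%:R - 1) / n%:R : R).
Local Notation om := (ball_volume R n).

Let n0 : 0 < n%:R :> R. Proof. by rewrite ltr0n (leq_trans _ n2). Qed.
Let n1 : 1 < n%:R :> R. Proof. by rewrite ltr1n. Qed.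

Lemma measurable_origin : measurable [set 0 : 'rV[R]_n].
Proof.
rewrite (_ : [set 0 : 'rV[R]_n] = [set x | enorm x <= 0]); first exact: measurable_eclosed.
apply/seteqP; split => x /=; first by move=> ->; rewrite enorm0.
by move=> x0; apply: enorm_eq0; apply/eqP; rewrite eq_le x0 enorm_ge0.
Qed.

Lemma measure_setD_origin (A : set 'rV[R]_n) : measurable A ->
  mu (A `\` [set 0]) = mu A.
Proof.
move=> mA; have mO := measurable_origin.
rewrite [RHS](measureDI mu mA mO) [X in (_ + X)%E](_ : _ = 0%E) ?adde0//.
apply/eqP; rewrite eq_le measure_ge0 andbT -(@measure_row_origin R n (ltnW n2)).
by apply: le_measure; rewrite ?inE//; exact: measurableI.
Qed.

(** For the unit ball the two bounds of [integral_inv_enorm_le] are attained.  The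
    origin, where the inverse of 0 is 0, is a null set. *)
Lemma integral_inv_enorm_ball :
  ((om * (n%:R / (n%:R - 1)))%:E <=
   \int[mu]_(x in [set x | (enorm x <= 1)%R]) ((enorm x)^-1)%:E)%E.
Proof.
set E := [set x | _]; have mE : measurable E by exact: measurable_eclosed.
pose f x := (enorm x)^-1 * \1_E x.
have mf : measurable_fun setT f.
  by apply: measurable_funM; [exact: measurable_inv_enorm|exact: measurable_indic].
have f0 x : 0 <= f x by apply: mulr_ge0 => //; rewrite invr_ge0 enorm_ge0.
have -> : (\int[mu]_(x in E) ((enorm x)^-1)%:E = \int[mu]_x (f x)%:E)%E.
  rewrite integral_mkcond; apply: eq_integral => x _; rewrite /patch /f indicE.
  by case: (_ \in _); rewrite ?mulr1 ?mulr0.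
rewrite (layer_cake mu mf f0).
have mS t : measurable [set x | t < f x] by exact: measurable_superlevel.
have ml : measurable_fun setT (fun t : measurableTypeR R => mu [set x | (t < f x)%R]).
  have := @measurable_level_measure R n f mf.
  by under eq_fun do under eq_set do rewrite ger0_norm//.
have pos (x : 'rV[R]_n) : x != 0 -> 0 < enorm x.
  by move=> x0; rewrite lt_neqAle enorm_ge0 andbT eq_sym; apply: contra x0 => /eqP/enorm_eq0/eqP.
rewrite (_ : `[0%R, +oo[%classic = `[0%R, 1[%classic `|` `[1, +oo[%classic); last first.
  apply/seteqP; split => t /=; rewrite !in_itv/= ?andbT.
    by move=> t0; have [h|h] := ltP t 1; [left|right]; rewrite ?t0.
  by move=> [/andP[]//|]; apply: le_trans.
rewrite ge0_integral_setU//; last 2 first.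
- exact: measurable_funTS.
- apply/disj_set2P/seteqP; split => // t [] /=; rewrite !in_itv/= andbT.
  by move=> /andP[_ h1] h2; rewrite ltNge h2 in h1.
have -> : om * (n%:R / (n%:R - 1)) = om + om * 1^-1 ^+ n.-1 / (n%:R - 1).
  rewrite invr1 expr1n; have nn : n%:R - 1 != 0 :> R by rewrite subr_eq0 gt_eqF.
  by field.
rewrite EFinD; apply: leeD.
  apply: (@le_trans _ _ (\int[leb]_(t in `[0%R, 1%R[) (om)%:E)%E).
    rewrite integral_cst//= lebesgue_measure_itv/= lte_fin ltr01 -EFinB subr0 -EFinM.
    by rewrite mulr1.
  apply: ge0_le_integral => //; first by move=> t _; rewrite lee_fin ltW// ball_volume_gt0.
    exact: measurable_funTS.
  move=> t; rewrite /= in_itv/= => /andP[t0 t1].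
  have <- : mu (E `\` [set 0]) = om%:E.
    by rewrite measure_setD_origin// measure_eclosed// expr1n mul1r.
  apply: le_measure; rewrite ?inE//; first exact: measurableD measurable_origin.
  move=> x [Ex /eqP/pos x0] /=; rewrite /f indicE mem_set// mulr1.
  by apply: lt_le_trans t1 _; rewrite invf_ge1.
rewrite -integral_ray_eball//; apply: ge0_le_integral => //.
- by move=> t _; rewrite lee_fin mulr_ge0 ?powR_ge0// ltW// ball_volume_gt0.
- apply/measurable_EFinP; apply: measurable_funTS.
  have mp : measurable_fun setT (fun t : R => t `^ (- n%:R)) by exact: measurable_powR.
  by apply: measurable_funM.
- exact: measurable_funTS.
- move=> t; rewrite /= in_itv/= andbT => t1; have t0 : 0 < t by exact: lt_le_trans t1.
  have mb := measurable_eball (R := R) (n := n) t^-1.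
  rewrite powRN powR_mulrn ?(ltW t0)// -exprVn -measure_eball ?invr_gt0//.
  rewrite -(measure_setD_origin mb); apply: le_measure; rewrite ?inE//.
    exact: measurableD measurable_origin.
  move=> x [xt /eqP/pos x0] /=; rewrite /eball/= in xt.
  rewrite /f indicE mem_set ?mulr1; first by rewrite -[ltLHS]invrK ltf_pV2 ?posrE ?invr_gt0.
  by rewrite /E/= (le_trans (ltW xt))// invf_le1.
Qed.

(** Hoelder's inequality for |w|^(p - 1) and the characteristic function of A, in the form
    of Young's pointwise inequality with a constant c tuned to |A|. *)
Lemma integral_power_set (w : 'rV[R]_n -> R) (A : set 'rV[R]_n) :
  measurable_fun setT w -> measurable A ->
  (\int[mu]_x (`|w x| `^ one_star R n)%:E = 1)%E ->
  (\int[mu]_(x in A) (`|w x| `^ (one_star R n - 1))%:E <= mu A `^ alpha)%E.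
Proof.
move=> mw mA w1.
have nn : n%:R - 1 != 0 :> R by rewrite subr_eq0 gt_eqF.
have nn0 : n%:R != 0 :> R by rewrite gt_eqF.
have n10 : 0 < n%:R - 1 :> R by rewrite subr_gt0.
have al0 : 0 < alpha by rewrite divr_gt0.
have maw : measurable_fun setT (fun x => `|w x|) by exact: measurableT_comp.
have mpw (r : R) : measurable_fun setT (fun x => (`|w x| `^ r)%:E).
  by apply/measurable_EFinP; exact: measurableT_comp (measurable_powR r) maw.
have [Afin|] := boolP (mu A \is a fin_num); last first.
  by rewrite ge0_fin_numE// -leNgt leye_eq => /eqP ->; rewrite poweRyr ?gt_eqF// leey.
have [A0|A0] := eqVneq (mu A) 0%E.
  rewrite (@null_set_integral _ _ _ mu A) ?poweR_ge0//.
  exact: measurable_funTS.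
pose a := fine (mu A).
have a0 : 0 < a by rewrite fine_gt0// lt_neqAle eq_sym A0 measure_ge0 ltey_eq Afin.
pose p : R := one_star R n.
have p0 : 0 < p by rewrite /p/one_star divr_gt0.
(* the value of c for which the two terms of Young's inequality are proportional *)
pose c := a `^ (alpha / n%:R).
have c0 : 0 < c by rewrite powR_gt0.
have Y (x : 'rV[R]_n) : `|w x| `^ (p - 1) <= (c `^ n%:R / n%:R) * `|w x| `^ p + c `^ (- p) / p.
  have := @conjugate_powR R (`|w x| `^ (p - 1) * c) c^-1 n%:R p _ _ n0 p0 _.
  rewrite mulfK ?gt_eqF// => H; apply: le_trans (H _ _ _) _.
  - by rewrite mulr_ge0 ?powR_ge0// ltW.
  - by rewrite invr_ge0 ltW.
  - by rewrite /p /one_star; field; rewrite nn nn0.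
  - rewrite powRM ?powR_ge0 ?(ltW c0)// -powRrM.
    have -> : (p - 1) * n%:R = p by rewrite /p /one_star; field.
    have -> : c^-1 `^ p = c `^ (- p).
      by rewrite -(powR_inv1 (ltW c0)) -(powRrM c (-1) p) mulN1r.
    by rewrite le_eqVlt; apply/orP; left; apply/eqP; ring.
apply: (@le_trans _ _ (\int[mu]_(x in A) ((c `^ n%:R / n%:R)%:E * (`|w x| `^ p)%:E + (c `^ (- p) / p)%:E))%E).
  apply: ge0_le_integral => //.
  - exact: measurable_funTS.
  - by apply: emeasurable_funD => //; apply: measurable_funeM; exact: measurable_funTS.
  - by move=> x _; rewrite -EFinM -EFinD lee_fin Y.
have cn0 : 0 <= c `^ n%:R / n%:R by rewrite divr_ge0 ?powR_ge0// ltW.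
have cp0 : 0 <= c `^ (- p) / p by rewrite divr_ge0 ?powR_ge0// ltW.
rewrite ge0_integralD//; last 2 first.
- by move=> x _; apply: mule_ge0; rewrite lee_fin// powR_ge0.
- by apply: measurable_funeM; exact: measurable_funTS.
rewrite ge0_integralZl_EFin//; last exact: measurable_funTS.
rewrite integral_cst//.
apply: (@le_trans _ _ ((c `^ n%:R / n%:R)%:E * 1 + (c `^ (- p) / p)%:E * mu A)%E).
  apply: leeD => //; apply: lee_wpmul2l; first by rewrite lee_fin.
  by rewrite -w1; apply: ge0_subset_integral => //; exact: measurable_funTS.
rewrite -(fineK Afin) -/a poweR_EFin mule1 -EFinM -EFinD lee_fin.
have -> : c `^ n%:R = a `^ alpha by rewrite /c -powRrM divfK.
have -> : c `^ (- p) / p * a = a `^ alpha / p.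
  rewrite mulrAC; congr (_ / _); rewrite /c -powRrM -{2}[a]powRr1 ?(ltW a0)//.
  rewrite -powRD; last by rewrite (gt_eqF a0) implybT.
  by congr (_ `^ _); rewrite /p /one_star; field; rewrite nn nn0.
rewrite le_eqVlt; apply/orP; left; apply/eqP; rewrite /p /one_star.
by field; rewrite nn nn0.
Qed.

Lemma level_integral_ge1 (w : 'rV[R]_n -> R) : measurable_fun setT w ->
  (\int[mu]_x (`|w x| `^ one_star R n)%:E = 1)%E -> (1 <= level_integral w)%E.
Proof.
move=> mw w1.
have maw : measurable_fun setT (fun x => `|w x|) by exact: measurableT_comp.
have mpw (r : R) : measurable_fun setT (fun x => (`|w x| `^ r)%:E).
  by apply/measurable_EFinP; exact: measurableT_comp (measurable_powR r) maw.
have g0 (x : 'rV[R]_n) : (0 <= (`|w x| `^ (one_star R n - 1))%:E)%E by rewrite lee_fin powR_ge0.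
rewrite -w1.
have -> : (\int[mu]_x (`|w x| `^ one_star R n)%:E =
    \int[mu]_x ((`|w x| `^ (one_star R n - 1))%:E * (`|w x|)%:E))%E.
  apply: eq_integral => x _; rewrite -EFinM; congr EFin.
  have p0 : one_star R n != 0 by rewrite /one_star mulf_neq0 ?invr_eq0 ?subr_eq0 ?gt_eqF.
  have [->|x0] := eqVneq `|w x| 0; first by rewrite mulr0 powR0.
  rewrite -{3}[`|w x|]powRr1// -powRD ?subrK// x0 implybT//.
rewrite (layer_cake_weighted mu maw _ (mpw _) g0)//.
rewrite /level_integral; apply: ge0_le_integral => //.
- by move=> t _; exact: integral_ge0.
- by apply: measurable_funTS; exact: measurable_layer.
- by apply: measurable_funTS; exact: measurable_level_power.
by move=> t _; apply: integral_power_set => //; exact: measurable_level.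
Qed.

End extremal_levels.

(** * Integration by parts against Lipschitz functions *)

Section smooth_fields.
Context {R : realType} {n : nat}.
Local Notation e_ i := (delta_mx ord0 i : 'rV[R]_n).
Variable v : 'rV[R]_n -> 'rV[R]_n.
Hypothesis sv : smooth v.

Let coord_cts (g : 'rV[R]_n -> 'rV[R]_n) i : continuous g -> continuous (fun x => g x ord0 i).
Proof.
move=> cg x; apply: (@continuous_comp _ _ _ g (fun y : 'rV[R]_n => y ord0 i)); first exact: cg.
exact: coord_continuous.
Qed.

Lemma smooth_coord_derive (i j : 'I_n) x :
  is_derive x (e_ j) (fun y => v y ord0 i) (partial j v x ord0 i).
Proof.
have [_ /(_ j x) dv] := sv [::].
have /derivable_mxP/(_ ord0 i) d := dv.
by apply: DeriveDef => //; rewrite /partial derive_mx// mxE.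
Qed.

Lemma smooth_coord_continuous (i : 'I_n) : continuous (fun x => v x ord0 i).
Proof. by apply: coord_cts; have [] := sv [::]. Qed.

Lemma smooth_partial_continuous (i j : 'I_n) : continuous (fun x => partial j v x ord0 i).
Proof. by apply: coord_cts; have [] := sv [:: j]. Qed.

Hypothesis kv : compactly_supported v.

Lemma smooth_support_bounded : exists M, 0 < M /\ forall x, ~ @cube R n M x ->
  v x = 0 /\ forall j, partial j v x = 0.
Proof.
have [M0 [_ MP]] := compact_bounded kv.
pose M := Num.max M0 0 + 1.
have MM : M0 < M by rewrite /M ltr_pwDr// le_max lexx.
exists M; split; first by rewrite /M ltr_pwDr// le_max lexx orbT.
move=> x xM.
have nc : ~ closure [set x | v x != 0] x.
  move=> cx; apply: xM; apply/cubeP => i; rewrite (le_trans (normr_coord _ _))//.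
  exact: MP.
have nb : \forall y \near x, v y = 0.
  have : nbhs x (~` closure [set x | v x != 0]).
    by apply: open_nbhs_nbhs; split => //; apply: closed_openC; exact: closed_closure.
  apply: filterS => y ny; apply: contrapT => /eqP vy; apply: ny; exact: subset_closure.
split; first exact: nbhs_singleton nb.
move=> j; rewrite /partial (near_eq_derive (g := cst 0))//.
exact: derive_cst.
Qed.

Lemma smooth_partial_bounded : exists G, forall i j x, `|partial j v x ord0 i| <= G.
Proof.
have [M [M0 MP]] := smooth_support_bounded.
have /choice[G GP] : forall ij : 'I_n * 'I_n, exists G, forall x, `|partial ij.2 v x ord0 ij.1| <= G.
  move=> [i j] /=.
  have ne : @cube R n M !=set0 by exists 0; apply/cubeP => k; rewrite mxE normr0 ltW.
  have cf : continuous (fun x => `|partial j v x ord0 i|).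
    by move=> x; apply: continuous_comp (@smooth_partial_continuous i j x) _; exact: norm_continuous.
  have [c _ cP] := EVT_max_rV ne (@compact_cube R n M) (continuous_subspaceT cf).
  exists `|partial j v c ord0 i| => x; have [xM|xM] := pselect (@cube R n M x).
    by apply: cP; rewrite inE.
  by rewrite (MP x xM).2 mxE normr0.
exists (\sum_ij `|G ij|) => i j x; apply: le_trans (GP (i, j) x) _.
by rewrite (le_trans (ler_norm _))// (bigD1 (i, j))//= lerDl sumr_ge0.
Qed.

End smooth_fields.

Section integration_by_parts.
Context {R : realType} {n : nat}.
Local Notation mu := (lebesgue_row R n).
Local Notation e_ i := (delta_mx ord0 i : 'rV[R]_n).

Lemma integral_translate_signed (b : 'rV[R]_n) (F : 'rV[R]_n -> R) :
  measurable_fun setT F -> (\int[mu]_x (F (x + b)%R)%:E = \int[mu]_x (F x)%:E)%E.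
Proof.
move=> mF; have mF' : measurable_fun setT (EFin \o F) by exact/measurable_EFinP.
rewrite integralE [RHS]integralE; congr (_ - _)%E.
- rewrite -(@integral_translate R n b (EFin \o F)^\+%E)//.
  + by apply: eq_integral => x _; rewrite !funeposE.
  + exact: measurable_funepos.
- rewrite -(@integral_translate R n b (EFin \o F)^\-%E)//.
  + by apply: eq_integral => x _; rewrite !funenegE.
  + exact: measurable_funeneg.
Qed.

Lemma integrable_indic_cube (K M : R) :
  mu.-integrable setT (fun x => (K * \1_(@cube R n M) x)%:E).
Proof.
have [_ iC] := @integrable_fun_indic R n _ (@measurable_cube R n M) (measure_cube_lty n M).
by have := integrableZl measurableT K iC; congr (integrable _ _ _).
Qed.

Lemma integrable_bounded_cube (F : 'rV[R]_n -> R) (K M : R) : measurable_fun setT F ->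
  (forall x, `|F x| <= K) -> (forall x, ~ @cube R n M x -> F x = 0) ->
  mu.-integrable setT (fun x => (F x)%:E).
Proof.
move=> mF FK F0; apply: le_integrable (integrable_indic_cube K M) => //.
  exact/measurable_EFinP.
move=> x _; rewrite lee_fin; have [xM|xM] := pselect (@cube R n M x).
  by rewrite indicE mem_set// mulr1 (le_trans (FK x))// ler_norm.
by rewrite F0// normr0.
Qed.

Lemma measurable_row_shift (F : 'rV[R]_n -> R) (b : 'rV[R]_n) : measurable_fun setT F ->
  measurable_fun setT (fun x : 'rV[R]_n => F (x + b)).
Proof.
move=> mF; rewrite (_ : (fun x => _) = F \o (fun x => 1 *: x + b)).
  exact: measurableT_comp mF (measurable_row_affine 1 b).
by apply/funext => x /=; rewrite scale1r.
Qed.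

Lemma cube_shift (M h : R) i (x : 'rV[R]_n) : 0 <= h <= 1 ->
  @cube R n M (x + h *: e_ i) -> @cube R n (M + 1) x.
Proof.
move=> /andP[h0 h1] /cubeP xM; apply/cubeP => j.
have -> : x ord0 j = (x + h *: e_ i) ord0 j - (h *: e_ i) ord0 j by rewrite !mxE addrK.
rewrite (le_trans (ler_normB _ _))// lerD//.
rewrite !mxE eqxx/=; case: (j == i); rewrite ?mulr0 ?normr0// mulr1.
by rewrite ger0_norm.
Qed.

Lemma derive_quotients (w : 'rV[R]_n -> R) (dw : R) x i : is_derive x (e_ i) w dw ->
  (k.+1%:R * (w (x + k.+1%:R^-1 *: e_ i) - w x)) @[k --> \oo] --> dw.
Proof.
move=> [dv <-].
have h0 : (fun k : nat => k.+1%:R^-1 : R) @ \oo --> (0 : R)^'.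
  move=> A A0; suff : \forall k \near \oo, A (k.+1%:R^-1) by [].
  have : \forall k \near \oo, (k.+1%:R^-1 != 0 :> R -> A (k.+1%:R^-1)).
    exact: (@cvg_harmonic R _ A0).
  by apply: filterS => k; apply; rewrite invr_eq0 pnatr_eq0.
have -> : (fun k : nat => k.+1%:R * (w (x + k.+1%:R^-1 *: e_ i) - w x)) =
    (fun h : R => h^-1 *: ((w \o shift x) (h *: e_ i) - w x)) \o (fun k => k.+1%:R^-1).
  by apply/funext => k /=; rewrite invrK [_ *: e_ i + x]addrC.
exact: cvg_comp h0 dv.
Qed.

(** The derivative is moved from w to f through difference quotients, by translation
    invariance and dominated convergence.  Pointwise convergence of the quotients of f off a
    null set is enough, so f may have corners. *)
Lemma integration_by_parts_lipschitz (f w dw df : 'rV[R]_n -> R) (i : 'I_n)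
    (K L G M : R) (Z : set 'rV[R]_n) :
  measurable_fun setT f -> (forall x, `|f x| <= K) ->
  measurable_fun setT w -> (forall x, `|w x| <= 1) ->
  (forall x, ~ @cube R n M x -> w x = 0) ->
  measurable_fun setT dw -> (forall x, is_derive x (e_ i) w (dw x)) ->
  (forall x (h : R), 0 <= h <= 1 -> `|w (x + h *: e_ i) - w x| <= G * h) ->
  measurable_fun setT df ->
  (forall x (h : R), 0 <= h <= 1 -> @cube R n M x -> `|f (x - h *: e_ i) - f x| <= L * h) ->
  measurable Z -> mu Z = 0%E ->
  (forall x, ~ Z x -> (k.+1%:R * (f (x - k.+1%:R^-1 *: e_ i) - f x)) @[k --> \oo] --> df x) ->
  (\int[mu]_x (f x * dw x)%:E = \int[mu]_x (df x * w x)%:E)%E.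
Proof.
move=> mf fK mw w1 w0 mdw wd wL mdf fL mZ Z0 fdf.
have K0 : 0 <= K by exact: le_trans (fK 0).
pose h k : R := k.+1%:R^-1.
have h01 k : 0 <= h k <= 1 by rewrite /h invr_ge0 ler0n invf_le1// ler1n.
have hh k : k.+1%:R * h k = 1 :> R by rewrite /h divff.
pose P k x := f x * (k.+1%:R * (w (x + h k *: e_ i) - w x)).
pose Q k x := (k.+1%:R * (f (x - h k *: e_ i) - f x)) * w x.
have mP k : measurable_fun setT (P k).
  apply: measurable_funM => //; apply: measurable_funM => //.
  by apply: measurable_funB => //; exact: measurable_row_shift.
have mQ k : measurable_fun setT (Q k).
  apply: measurable_funM => //; apply: measurable_funM => //.
  apply: measurable_funB => //; exact: (@measurable_row_shift f (- (h k *: e_ i))).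
have PQ k : (\int[mu]_x (P k x)%:E = \int[mu]_x (Q k x)%:E)%E.
  (* P k = F1 - F3 and Q k = F2 - F3, and F1 is a translate of F2 *)
  pose F1 x := f x * (k.+1%:R * w (x + h k *: e_ i)).
  pose F2 x := f (x - h k *: e_ i) * (k.+1%:R * w x).
  pose F3 x := f x * (k.+1%:R * w x).
  have bK (a b : R) : `|a| <= K -> `|b| <= 1 -> `|a * (k.+1%:R * b)| <= K * k.+1%:R.
    move=> a1 b1; rewrite !normrM normr_nat; apply: ler_pM => //.
    by rewrite ler_piMr.
  have mF1 : measurable_fun setT F1.
    by apply: measurable_funM => //; apply: measurable_funM => //; exact: measurable_row_shift.
  have mF2 : measurable_fun setT F2.
    apply: measurable_funM; first exact: (@measurable_row_shift f (- (h k *: e_ i))).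
    exact: measurable_funM.
  have mF3 : measurable_fun setT F3.
    by apply: measurable_funM => //; exact: measurable_funM.
  have i1 : mu.-integrable setT (fun x => (F1 x)%:E).
    apply: (@integrable_bounded_cube _ (K * k.+1%:R) (M + 1)) => //.
      by move=> x; exact: bK.
    move=> x xM; rewrite /F1 w0 ?mulr0// => xM'; apply: xM.
    exact: cube_shift (h01 k) xM'.
  have i2 : mu.-integrable setT (fun x => (F2 x)%:E).
    apply: (@integrable_bounded_cube _ (K * k.+1%:R) M) => //.
      by move=> x; exact: bK.
    by move=> x xM; rewrite /F2 w0 ?mulr0.
  have i3 : mu.-integrable setT (fun x => (F3 x)%:E).
    apply: (@integrable_bounded_cube _ (K * k.+1%:R) M) => //.
      by move=> x; exact: bK.
    by move=> x xM; rewrite /F3 w0 ?mulr0.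
  transitivity (\int[mu]_x (F1 x)%:E - \int[mu]_x (F3 x)%:E)%E.
    by rewrite -integralB_EFin//; apply: eq_integral => x _; rewrite -EFinB /P /F1 /F3; congr EFin; ring.
  rewrite -[X in (X - _)%E = _](_ : \int[mu]_x (F2 x)%:E = _)%E; last first.
    rewrite -(integral_translate_signed (h k *: e_ i) mF2); apply: eq_integral => x _.
    by rewrite /F2 /F1 addrK.
  by rewrite -integralB_EFin//; apply: eq_integral => x _; rewrite -EFinB /Q /F2 /F3; congr EFin; ring.
have G0 : 0 <= G.
  by have := wL 0 (h 0%N) (h01 0%N); rewrite /h invr1 mulr1; exact: le_trans.
have cP : (\int[mu]_x (P k x)%:E)%E @[k --> \oo] --> (\int[mu]_x (f x * dw x)%:E)%E.
  apply: (dominated_cvg measurableT (g := fun x => (K * G * \1_(@cube R n (M + 1)) x)%:E)) => //.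
  - by move=> k; exact/measurable_EFinP.
  - move=> x _; apply: cvg_EFin; first exact: nearW.
    by apply: cvgMr; exact: derive_quotients.
  - exact: integrable_indic_cube.
  - move=> k x _; rewrite lee_fin /P indicE.
    have [xM|xM] := boolP (x \in @cube R n (M + 1)).
      rewrite mulr1 normrM; apply: ler_pM => //.
      rewrite normrM normr_nat; apply: le_trans (ler_wpM2l (ler0n _ _) (wL x _ (h01 k))) _.
      by rewrite mulrCA hh mulr1.
    have xM2 : ~ @cube R n (M + 1) x by move=> h'; rewrite mem_set in xM.
    rewrite mulr0 !w0 ?subrr ?mulr0 ?normr0//.
      by move=> /cubeP xM'; apply: xM2; apply/cubeP => j; rewrite (le_trans (xM' j))// lerDl.
    by move=> xM'; apply: xM2; exact: cube_shift (h01 k) xM'.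
have cQ : (\int[mu]_x (Q k x)%:E)%E @[k --> \oo] --> (\int[mu]_x (df x * w x)%:E)%E.
  have [] := @dominated_convergence _ _ _ mu setT measurableT (fun k x => (Q k x)%:E)
    (fun x => (df x * w x)%:E) (fun x => (L * \1_(@cube R n M) x)%:E) _ _ _ _ _ => //.
  - by move=> k; exact/measurable_EFinP.
  - by apply/measurable_EFinP; exact: measurable_funM.
  - exists Z; split => // x /= nx; apply: contrapT => xZ; apply: nx => _.
    apply: cvg_EFin; first exact: nearW.
    by apply: cvgMl; exact: fdf.
  - exact: integrable_indic_cube.
  - apply: aeW => x k _; rewrite lee_fin /Q indicE.
    have [xM|xM] := boolP (x \in @cube R n M); last first.
      by rewrite w0 ?mulr0 ?normr0// => h'; rewrite mem_set in xM.
    rewrite inE in xM; rewrite mulr1 normrM; apply: le_trans (ler_wpM2l (normr_ge0 _) (w1 x)) _.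
    rewrite mulr1 normrM normr_nat; apply: le_trans (ler_wpM2l (ler0n _ _) (fL x _ (h01 k) xM)) _.
    by rewrite mulrCA hh mulr1.
have E : (fun k => \int[mu]_x (P k x)%:E)%E = (fun k => \int[mu]_x (Q k x)%:E)%E.
  by apply/funext.
by rewrite E in cP; exact: cvg_unique cP cQ.
Qed.

End integration_by_parts.

(** * The perimeter of the ball *)

Section clamp.
Context {R : realType}.
Implicit Types a b : R.

Definition clamp a : R := Num.max 0 (Num.min 1 a).

Lemma clamp01 a : 0 <= clamp a <= 1.
Proof. by rewrite /clamp le_max lexx/= ge_max ler01 ge_min lexx. Qed.

Lemma clamp_ge1 a : 1 <= a -> clamp a = 1.
Proof. by move=> a1; rewrite /clamp (min_idPl a1); apply/max_idPr. Qed.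

Lemma clamp_le0 a : a <= 0 -> clamp a = 0.
Proof.
move=> a0; rewrite /clamp; apply/max_idPl; rewrite ge_min a0 orbT//.
Qed.

Lemma clamp_id a : 0 <= a <= 1 -> clamp a = a.
Proof. by move=> /andP[a0 a1]; rewrite /clamp (min_idPr a1); apply/max_idPr. Qed.

Lemma clamp_dist a b : `|clamp a - clamp b| <= `|a - b|.
Proof.
wlog ab : a b / a <= b.
  by move=> H; have [/H//|/ltW/H] := leP a b; rewrite distrC [leRHS]distrC.
have mono : clamp a <= clamp b.
  by rewrite /clamp ge_max !le_max lexx/= le_min !ge_min lexx ab/= orbT orbT.
rewrite distrC [leRHS]distrC !ger0_norm ?subr_ge0//.
have [b0|b0] := leP b 0; first by rewrite !clamp_le0 ?subrr ?subr_ge0// (le_trans ab).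
have [a1|a1] := leP 1 a; first by rewrite !clamp_ge1 ?subrr ?subr_ge0// (le_trans a1).
have cb : clamp b <= b by rewrite /clamp ge_max (ltW b0) ge_min lexx orbT.
have ca : a <= clamp a by rewrite /clamp le_max le_min lexx (ltW a1) orbT.
by rewrite lerB.
Qed.

(** The difference quotients of a quadratic polynomial truncated to [0, 1], at the points
    where the truncation is locally inactive or locally constant. *)
Lemma clamp_quotients a b c : a != 0 -> a != 1 ->
  (k.+1%:R * (clamp (a + b * k.+1%:R^-1 - c * k.+1%:R^-1 ^+ 2) - clamp a)) @[k --> \oo] -->
  (if 0 < a < 1 then b else 0).
Proof.
move=> a0 a1.
have h0 : (fun k : nat => k.+1%:R^-1 : R) @ \oo --> (0 : R) by exact: cvg_harmonic.
pose q (k : nat) : R := a + b * k.+1%:R^-1 - c * k.+1%:R^-1 ^+ 2.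
have cq : q @ \oo --> a.
  have -> : a = a + b * 0 - c * (0 * 0) by rewrite !mulr0 addr0 subr0.
  apply: cvgB; first by apply: cvgD; [exact: cvg_cst|exact: cvgMr].
  apply: cvgMr; exact: cvgM.
have flat (d : R) : clamp a = d -> (\forall k \near \oo, clamp (q k) = d) ->
    (k.+1%:R * (clamp (q k) - clamp a)) @[k --> \oo] --> (0 : R).
  move=> -> H; apply: cvg_near_cst; apply: filterS H => k ->.
  by rewrite subrr mulr0.
case: ifPn => [/andP[ap al]|].
  have cb : (fun k : nat => b - c * k.+1%:R^-1) @ \oo --> b.
    rewrite -[X in _ --> X]subr0 -[X in _ - X](mulr0 c).
    by apply: cvgB; [exact: cvg_cst|exact: cvgMr].
  apply: cvg_trans cb.
  apply: near_eq_cvg.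
  have n1 : \forall k \near \oo, 0 < q k by exact: cvgr_gt cq _ ap.
  have n2 : \forall k \near \oo, q k < 1 by exact: cvgr_lt cq _ al.
  near=> k.
  have k0 : 0 < q k by near: k.
  have k1 : q k < 1 by near: k.
  rewrite -/(q k) !clamp_id ?(ltW ap) ?(ltW al) ?(ltW k0) ?(ltW k1)//.
  have m0 : k.+1%:R != 0 :> R by rewrite pnatr_eq0.
  by rewrite /q; move: (k.+1%:R : R) m0 => m m0; field.
rewrite negb_and -!leNgt => h; have [al|al] := ltP 1 a.
  apply: (flat 1); first by rewrite clamp_ge1// ltW.
  have n1 : \forall k \near \oo, 1 < q k by exact: cvgr_gt cq _ al.
  by apply: filterS n1 => k /ltW; exact: clamp_ge1.
have ap : a < 0.
  rewrite lt_neqAle a0/=; case/orP: h => // h.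
  by move: a1; rewrite eq_le al h.
apply: (flat 0); first by rewrite clamp_le0// ltW.
have n1 : \forall k \near \oo, q k < 0 by exact: cvgr_lt cq _ ap.
by apply: filterS n1 => k /ltW; exact: clamp_le0.
Unshelve. all: by end_near. Qed.

End clamp.

Section ramp.
Context {R : realType} {n : nat}.
Hypothesis n0 : (0 < n)%N.
Local Notation mu := (lebesgue_row R n).
Local Notation e_ i := (delta_mx ord0 i : 'rV[R]_n).
Local Notation om := (ball_volume R n).
Variable r : R.
Hypothesis r1 : 1 < r.

Let D := r ^+ 2 - 1.
Let q (x : 'rV[R]_n) := (r ^+ 2 - enorm x ^+ 2) / D.

Let r0 : 0 < r. Proof. exact: lt_trans r1. Qed.
Let D0 : 0 < D. Proof. by rewrite subr_gt0 exprn_egt1. Qed.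

(** A radial function that equals 1 on the unit ball and 0 outside the ball of radius r.  It is
    affine in |x|^2 rather than in |x|, so that it restricts to quadratic polynomials on lines
    parallel to the axes. *)
Definition ramp (x : 'rV[R]_n) : R := clamp ((r ^+ 2 - enorm x ^+ 2) / (r ^+ 2 - 1)).

Definition ramp_grad (i : 'I_n) (x : 'rV[R]_n) : R :=
  2 * x ord0 i / (r ^+ 2 - 1) * \1_(@eball R n r `\` [set x | enorm x <= 1]) x.

Let q_gt0 x : (0 < q x) = (enorm x < r).
Proof.
by rewrite /q pmulr_lgt0 ?invr_gt0// subr_gt0 ltr_pXn2r// nnegrE ?enorm_ge0// ltW.
Qed.

Let q_lt1 x : (q x < 1) = (1 < enorm x).
Proof.
rewrite /q ltr_pdivrMr// mul1r /D ltrD2l ltrN2 -[X in X < _](expr1n _ 2).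
by rewrite ltr_pXn2r// nnegrE ?enorm_ge0.
Qed.

Lemma ramp_in x : enorm x <= 1 -> ramp x = 1.
Proof. by move=> x1; apply: clamp_ge1; rewrite leNgt -/D -/(q x) q_lt1 -leNgt. Qed.

Lemma ramp_out x : r <= enorm x -> ramp x = 0.
Proof. by move=> x1; apply: clamp_le0; rewrite leNgt -/D -/(q x) q_gt0 -leNgt. Qed.

Lemma measurable_ramp : measurable_fun setT ramp.
Proof.
apply: measurable_maxr => //; apply: measurable_minr => //.
apply: measurable_funM => //; apply: measurable_funB => //.
apply: measurable_funX; exact: measurable_enorm.
Qed.

Lemma measurable_ramp_grad i : measurable_fun setT (ramp_grad i).
Proof.
apply: measurable_funM; last first.
  by apply: measurable_indic; apply: measurableD; [exact: measurable_eball|exact: measurable_eclosed].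
by apply: measurable_funM => //; apply: measurable_funM => //; exact: measurable_row_coord.
Qed.

Lemma enorm_shift_sqr (x : 'rV[R]_n) (h : R) i :
  enorm (x - h *: e_ i) ^+ 2 = enorm x ^+ 2 - 2 * h * x ord0 i + h ^+ 2.
Proof.
rewrite !enorm_sqr (bigD1 i)//= [in RHS](bigD1 i)//= !mxE !eqxx/= mulr1.
rewrite (eq_bigr (fun j => x ord0 j ^+ 2)); first by ring.
by move=> j ji; rewrite !mxE (negbTE ji) andbF/= mulr0 subr0.
Qed.

Let q_shift x (h : R) i : q (x - h *: e_ i) = q x + (2 * x ord0 i / D) * h - D^-1 * h ^+ 2.
Proof. by rewrite /q enorm_shift_sqr; field; rewrite gt_eqF. Qed.

Lemma ramp_lipschitz (M : R) i x (h : R) : 0 <= h <= 1 -> @cube R n M x ->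
  `|ramp (x - h *: e_ i) - ramp x| <= (2 * M + 1) / D * h.
Proof.
move=> /andP[h0 h1] /cubeP/(_ i) xM; apply: le_trans (clamp_dist _ _) _.
rewrite -/D -/(q x) -/(q (x - h *: e_ i)) q_shift.
have -> : q x + 2 * x ord0 i / D * h - D^-1 * h ^+ 2 - q x = D^-1 * (h * (2 * x ord0 i - h)) by ring.
have -> : (2 * M + 1) / D * h = D^-1 * (h * (2 * M + 1)) by ring.
rewrite !normrM (ger0_norm h0) gtr0_norm ?invr_gt0//.
rewrite ler_pM2l ?invr_gt0//; apply: ler_wpM2l => //.
rewrite (le_trans (ler_normB _ _))// lerD ?(ger0_norm h0)// normrM ger0_norm//.
by rewrite ler_wpM2l.
Qed.

Lemma ramp_quotients x i : enorm x != 1 -> enorm x != r ->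
  (k.+1%:R * (ramp (x - k.+1%:R^-1 *: e_ i) - ramp x)) @[k --> \oo] --> ramp_grad i x.
Proof.
move=> x1 xr.
have q0 : q x != 0.
  rewrite /q mulf_eq0 invr_eq0 (gt_eqF D0) orbF subr_eq0 eqrXn2 ?enorm_ge0 ?(ltW r0)//.
  by rewrite eq_sym.
have q1 : q x != 1.
  apply/negP => /eqP h; have : r ^+ 2 - enorm x ^+ 2 = D.
    by rewrite -[RHS]mul1r -h /q divfK ?gt_eqF.
  rewrite /D => /addrI/oppr_inj/eqP; rewrite -[X in _ == X](expr1n _ 2) eqrXn2 ?enorm_ge0//.
  exact/negP.
have := @clamp_quotients R (q x) (2 * x ord0 i / D) D^-1 q0 q1.
have -> : (if 0 < q x < 1 then 2 * x ord0 i / D else 0) = ramp_grad i x.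
  rewrite q_gt0 q_lt1 /ramp_grad indicE; case: ifPn => [/andP[h1 h2]|h].
    by rewrite mem_set ?mulr1//; split => //=; rewrite leNgt h2.
  rewrite memNset ?mulr0// => -[/= h1]; rewrite leNgt => /negP/negPn h2.
  by move: h; rewrite h1 h2.
move=> H; apply: cvg_trans H; apply: near_eq_cvg; apply: nearW => k.
by rewrite /ramp -/D -/(q x) -/(q (x - k.+1%:R^-1 *: e_ i)) q_shift.
Qed.

Lemma ramp_grad_bounded i x : `|ramp_grad i x| <= 2 * r / (r ^+ 2 - 1).
Proof.
rewrite /ramp_grad indicE; case: (boolP (x \in _)) => [|_]; last first.
  by rewrite mulr0 normr0 divr_ge0 ?mulr_ge0// ltW.
rewrite inE => -[/= xr _]; rewrite mulr1 !normrM normfV (gtr0_norm D0) ger0_norm//.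
rewrite ler_pM2r ?invr_gt0// ler_wpM2l//.
exact: le_trans (normr_coord_enorm _ _) (ltW xr).
Qed.

End ramp.

Section ball_perimeter.
Context {R : realType} {n : nat}.
Hypothesis n0 : (0 < n)%N.
Local Notation mu := (lebesgue_row R n).
Local Notation e_ i := (delta_mx ord0 i : 'rV[R]_n).
Local Notation om := (ball_volume R n).
Variable v : 'rV[R]_n -> 'rV[R]_n.
Hypotheses (sv : smooth v) (kv : compactly_supported v) (v1 : forall x, enorm (v x) <= 1).

Let mv (i : 'I_n) : measurable_fun setT (fun x => v x ord0 i).
Proof. by apply: continuous_measurable_row; exact: smooth_coord_continuous. Qed.

Let mdv (i j : 'I_n) : measurable_fun setT (fun x => partial j v x ord0 i).
Proof. by apply: continuous_measurable_row; exact: smooth_partial_continuous. Qed.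

Let vi1 x i : `|v x ord0 i| <= 1.
Proof. exact: le_trans (normr_coord_enorm _ _) (v1 x). Qed.

Lemma measurable_divergence : measurable_fun setT (divergence v).
Proof. by apply: measurable_sum => i; exact: mdv. Qed.

Lemma divergence_bounded : exists C M : R, forall x, `|divergence v x| <= C /\
  (~ @cube R n M x -> divergence v x = 0).
Proof.
have [M [M0 MP]] := smooth_support_bounded kv.
have [G GP] := smooth_partial_bounded sv kv.
exists (n%:R * G), M => x; split.
  apply: le_trans (ler_norm_sum _ _ _) _.
  apply: (@le_trans _ _ (\sum_(i < n) G)); first by apply: ler_sum => i _; exact: GP.
  by rewrite sumr_const card_ord mulr_natl.
by move=> xM; apply: big1 => i _; rewrite (MP x xM).2 mxE.
Qed.

Lemma integrable_divergence_ramp (f : 'rV[R]_n -> R) (K : R) : measurable_fun setT f ->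
  (forall x, `|f x| <= K) -> mu.-integrable setT (fun x => (f x * divergence v x)%:E).
Proof.
move=> mf fK; have [C [M CP]] := divergence_bounded.
apply: (@integrable_bounded_cube _ _ _ (K * C) M).
- by apply: measurable_funM => //; exact: measurable_divergence.
- by move=> x; rewrite normrM ler_pM//; have [] := CP x.
- by move=> x xM; have [_ ->] := CP x; rewrite ?mulr0.
Qed.

(** The two spheres where the ramp has corners are null. *)
Lemma ramp_divergence (r : R) : 1 < r ->
  (\int[mu]_x (ramp r x * divergence v x)%:E =
   \int[mu]_x (\sum_(i < n) ramp_grad r i x * v x ord0 i)%:E)%E.
Proof.
move=> r1; have r0 : 0 < r by exact: lt_trans r1.
have [M [M0 MP]] := smooth_support_bounded kv.
have [G GP] := smooth_partial_bounded sv kv.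
have D0 : 0 < r ^+ 2 - 1 by rewrite subr_gt0 exprn_egt1.
have rK (x : 'rV[R]_n) : `|ramp r x| <= (1 : R).
  by have /andP[h0 h1] := clamp01 ((r ^+ 2 - enorm x ^+ 2) / (r ^+ 2 - 1)); rewrite ger0_norm.
have rgK := @ramp_grad_bounded R n r r1.
transitivity (\sum_(i < n) \int[mu]_x (ramp r x * partial i v x ord0 i)%:E)%E.
  rewrite -integral_sum//; last first.
    move=> i; apply: (@integrable_bounded_cube _ _ _ (1 * G) M).
    - by apply: measurable_funM => //; exact: measurable_ramp.
    - by move=> x; rewrite normrM ler_pM.
    - by move=> x xM; rewrite (MP x xM).2 mxE mulr0.
  by apply: eq_integral => x _; rewrite /divergence mulr_sumr -sumEFin.
transitivity (\sum_(i < n) \int[mu]_x (ramp_grad r i x * v x ord0 i)%:E)%E; last first.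
  rewrite -integral_sum//; last first.
    move=> i; apply: (@integrable_bounded_cube _ _ _ (2 * r / (r ^+ 2 - 1) * 1) M).
    - by apply: measurable_funM => //; exact: measurable_ramp_grad.
    - by move=> x; rewrite normrM ler_pM.
    - by move=> x xM; rewrite (MP x xM).1 mxE mulr0.
  by apply: eq_integral => x _; rewrite -sumEFin.
apply: eq_bigr => i _.
have mS (s : R) : measurable [set x : 'rV[R]_n | enorm x = s].
  rewrite (_ : mkset _ = setT `&` @enorm R n @^-1` [set s]); last by rewrite setTI.
  exact: measurable_enorm.
apply: (@integration_by_parts_lipschitz R n (ramp r) (fun x => v x ord0 i) _ (ramp_grad r i) i
  1 ((2 * M + 1) / (r ^+ 2 - 1)) (n%:R * G) M ([set x | enorm x = 1] `|` [set x | enorm x = r])) => //.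
- exact: measurable_ramp.
- by move=> x xM; rewrite (MP x xM).1 mxE.
- by move=> x; exact: smooth_coord_derive.
- move=> x h /andP[h0 h1].
  have G0 : 0 <= G by exact: le_trans (GP i i 0).
  have he : `|h *: e_ i| <= h.
    apply/row_norm_le => // j; rewrite !mxE eqxx/=.
    by case: (j == i); rewrite ?mulr0 ?normr0// mulr1 ger0_norm.
  apply: (@le_trans _ _ (n%:R * G * `|h *: e_ i|)); last by rewrite ler_wpM2l// mulr_ge0.
  apply: (@lipschitz_of_partials R n (fun x => v x ord0 i) (fun j x => partial j v x ord0 i)) => //.
  by move=> j y; exact: smooth_coord_derive.
- exact: measurable_ramp_grad.
- by move=> x h h01 xM; exact: ramp_lipschitz.
- by apply: measurableU.
- by apply: null_set_setU => //; exact: measure_sphere.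
- by move=> x xZ; apply: ramp_quotients => //; apply/eqP => h; apply: xZ; [left|right].
Qed.

(** The gradient of the ramp has norm at most 2 r / (r^2 - 1) on a shell of volume
    om (r^n - 1), and r^n - 1 <= (r - 1) n r^(n - 1). *)
Lemma ramp_divergence_le (r : R) : 1 < r ->
  (\int[mu]_x (ramp r x * divergence v x)%:E <= (n%:R * om * r ^+ n)%:E)%E.
Proof.
move=> r1; have r0 : 0 < r by exact: lt_trans r1.
rewrite ramp_divergence//.
set A := @eball R n r `\` [set x | enorm x <= 1].
have mA : measurable A by apply: measurableD; [exact: measurable_eball|exact: measurable_eclosed].
have muA : mu A = (om * (r ^+ n - 1))%:E.
  have mb := @measurable_eball R n r; have mc := @measurable_eclosed R n 1.
  rewrite measureD//; last exact: measure_eball_lty.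
  rewrite setIidr; last by move=> x /= x1; exact: le_lt_trans r1.
  rewrite [X in (X - _)%E](measure_eball n r0) [X in (_ - X)%E](measure_eclosed n ltr01).
  by rewrite expr1n mul1r -EFinB; congr EFin; ring.
have D0 : 0 < r ^+ 2 - 1 by rewrite subr_gt0 exprn_egt1.
pose K := 2 * r / (r ^+ 2 - 1).
have K0 : 0 <= K by rewrite divr_ge0 ?mulr_ge0// ltW.
have mAI : measurable_fun setT (fun x => (K * \1_A x)%:E).
  by apply/measurable_EFinP; apply: measurable_funM => //; exact: measurable_indic.
apply: (@le_trans _ _ (\int[mu]_x (K * \1_A x)%:E)%E).
  apply: le_integral => //.
  - have [M [M0 MP]] := smooth_support_bounded kv.
    apply: (@integrable_bounded_cube _ _ _ (\sum_(i < n) K) M).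
    + by apply: measurable_sum => i; apply: measurable_funM => //; exact: measurable_ramp_grad.
    + move=> x; apply: le_trans (ler_norm_sum _ _ _) _; apply: ler_sum => i _.
      rewrite normrM -[leRHS]mulr1; apply: ler_pM => //; exact: ramp_grad_bounded.
    + by move=> x xM; apply: big1 => i _; rewrite (MP x xM).1 mxE mulr0.
  - apply: (@integrable_bounded_cube _ _ _ K r).
    + by apply/measurable_EFinP.
    + by move=> x; rewrite normrM (ger0_norm K0) indicE ler_piMr//; case: (_ \in _); rewrite ?normr1 ?normr0.
    + move=> x xM; rewrite indicE memNset ?mulr0// => -[/= xr _]; apply: xM; apply/cubeP => i.
      exact: le_trans (normr_coord_enorm _ _) (ltW xr).
  move=> x _; rewrite lee_fin.
  rewrite (eq_bigr (fun i => (2 / (r ^+ 2 - 1) * \1_A x) * (x ord0 i * v x ord0 i))); last first.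
    by move=> i _; rewrite /ramp_grad -/A; ring.
  rewrite -mulr_sumr; apply: le_trans (ler_wpM2l _ (cauchy_schwarz _ _)) _.
    by rewrite mulr_ge0// divr_ge0// ltW.
  rewrite indicE; case: (boolP (x \in A)) => [|_]; last by rewrite !mulr0 mul0r.
  rewrite inE => -[/= xr _]; rewrite !mulr1 /K mulrAC ler_pM2r ?invr_gt0// ler_wpM2l//.
  rewrite -[leRHS]mulr1; apply: ler_pM => //; [exact: enorm_ge0|exact: enorm_ge0|].
  exact: ltW.
rewrite (_ : (fun x => _) = (fun x => K%:E * (\1_A x)%:E)%E); last first.
  by apply/funext => x; rewrite EFinM.
rewrite ge0_integralZl_EFin//; last by apply/measurable_EFinP; exact: measurable_indic.
rewrite integral_indic// setIT [X in (_ * X)%E]muA -EFinM lee_fin.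
have tele : r ^+ n - 1 <= (r - 1) * (n%:R * r ^+ n.-1).
  rewrite -[X in _ - X](expr1n _ n) subrXX ler_wpM2l ?subr_ge0 ?(ltW r1)//.
  rewrite mulr_natl -[X in _ *+ X](card_ord n) -sumr_const; apply: ler_sum => i _.
  rewrite expr1n mulr1 -subn1 -subnDA add1n; apply: ler_weXn2l; first exact: ltW.
  by rewrite leq_sub2l.
have Kr : K * (r - 1) <= r.
  have -> : K * (r - 1) = 2 * r / (r + 1).
    rewrite /K (_ : r ^+ 2 - 1 = (r + 1) * (r - 1)); last by ring.
    have h1 : r - 1 != 0 by rewrite subr_eq0 gt_eqF.
    have h2 : r + 1 != 0 by rewrite gt_eqF// addr_gt0.
    by field; rewrite h1 h2.
  rewrite ler_pdivrMr ?addr_gt0// [2 * r]mulrC ler_pM2l// -lerBlDr.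
  by rewrite (_ : 2 - 1 = 1) ?(ltW r1)//; ring.
apply: (@le_trans _ _ (K * (om * ((r - 1) * (n%:R * r ^+ n.-1))))).
  by rewrite ler_wpM2l// ler_wpM2l// ltW// ball_volume_gt0.
have -> : K * (om * ((r - 1) * (n%:R * r ^+ n.-1))) = (K * (r - 1)) * (om * n%:R * r ^+ n.-1) by ring.
have -> : n%:R * om * r ^+ n = r * (om * n%:R * r ^+ n.-1).
  have -> : r ^+ n = r * r ^+ n.-1 by rewrite -exprS prednK.
  ring.
by rewrite ler_wpM2r// !mulr_ge0// ?exprn_ge0// ltW// ball_volume_gt0.
Qed.

End ball_perimeter.

(** * The minimiser *)

Section ball_minimizer.
Context {R : realType} {n : nat}.
Hypothesis n2 : (2 <= n)%N.
Local Notation mu := (lebesgue_row R n).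
Local Notation alpha := ((n%:R - 1) / n%:R : R).
Local Notation om := (ball_volume R n).
Local Notation B := [set x : 'rV[R]_n | enorm x <= 1].

Let n0 : 0 < n%:R :> R. Proof. by rewrite ltr0n (leq_trans _ n2). Qed.
Let n1 : 1 < n%:R :> R. Proof. by rewrite ltr1n. Qed.
Let mB : measurable B. Proof. exact: measurable_eclosed. Qed.
Let om0 : 0 < om. Proof. exact: ball_volume_gt0. Qed.

Lemma ball_divergence_le (v : 'rV[R]_n -> 'rV[R]_n) : smooth v -> compactly_supported v ->
  (forall x, enorm (v x) <= 1) ->
  (\int[mu]_x (\1_B x * divergence v x)%:E <= (n%:R * om)%:E)%E.
Proof.
move=> sv kv v1.
pose r k : R := 1 + k.+1%:R^-1.
have r1 k : 1 < r k by rewrite /r ltrDl invr_gt0.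
have h0 : (fun k : nat => k.+1%:R^-1 : R) @ \oo --> (0 : R) by exact: cvg_harmonic.
have mdiv := measurable_divergence sv.
have cI : (\int[mu]_x (ramp (r k) x * divergence v x)%:E)%E @[k --> \oo] -->
    (\int[mu]_x (\1_B x * divergence v x)%:E)%E.
  apply: (dominated_cvg measurableT (g := fun x => `|(1 * divergence v x)%:E|%E)) => //.
  - by move=> k; apply/measurable_EFinP; apply: measurable_funM => //; exact: measurable_ramp.
  - move=> x _; apply: cvg_EFin; first exact: nearW.
    apply: cvgMl; apply: cvg_near_cst; rewrite indicE.
    have [xB|xB] := leP (enorm x) 1.
      by rewrite mem_set//; apply: nearW => k; exact: ramp_in.
    rewrite memNset/=; last by apply/negP; rewrite -ltNge.
    have xB' : 0 < enorm x - 1 by rewrite subr_gt0.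
    have H : \forall k \near \oo, k.+1%:R^-1 < enorm x - 1 by exact: cvgr_lt h0 _ xB'.
    by apply: filterS H => k h; apply: ramp_out => //; rewrite /r addrC -lerBrDr ltW.
  - apply: integrable_abse.
    exact: (@integrable_divergence_ramp R n v sv kv (cst 1) `|1|).
  - move=> k x _; rewrite lee_fin mul1r normrM ler_piMl//.
    by have /andP[c0 c1] := clamp01 ((r k ^+ 2 - enorm x ^+ 2) / (r k ^+ 2 - 1)); rewrite ger0_norm.
have cb : (n%:R * om * r k ^+ n)%:E @[k --> \oo] --> (n%:R * om)%:E.
  apply: cvg_EFin; first exact: nearW.
  have cr : r @ \oo --> (1 + 0 : R) by apply: cvgD; [exact: cvg_cst|exact: h0].
  have cc : (n%:R * om * r k ^+ n) @[k --> \oo] --> n%:R * om * (1 + 0) ^+ n.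
    by apply: cvgMr; exact: (cvg_comp _ _ cr (@exprn_continuous R n (1 + 0))).
  by rewrite addr0 expr1n mulr1 in cc.
rewrite -(cvg_lim _ cI)// -(cvg_lim _ cb)//; apply: lee_lim.
- by apply/cvg_ex; eexists; exact: cI.
- by apply/cvg_ex; eexists; exact: cb.
- by apply: nearW => k; apply: ramp_divergence_le => //; exact: ltnW.
Qed.

Lemma bv_seminorm_ball (c : R) : 0 <= c ->
  (bv_seminorm (fun x : 'rV[R]_n => (c * \1_B x)%R) <= (c * (n%:R * om))%:E)%E.
Proof.
move=> c0; apply: ge_ereal_sup => _ /= [v [sv kv v1] <-].
have vx x : enorm (v x) <= 1.
  by rewrite -lee_fin -v1; apply: ereal_sup_ubound; exists x.
have iB : mu.-integrable setT (fun x => (\1_B x * divergence v x)%:E).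
  apply: (@integrable_divergence_ramp R n v sv kv \1_B 1); first exact: measurable_indic.
  by move=> x; rewrite indicE ger0_norm//; case: (_ \in _).
rewrite (_ : (fun x => _) = (fun x => c%:E * (\1_B x * divergence v x)%:E)%E); last first.
  by apply/funext => x; rewrite -EFinM mulrA.
rewrite integralZl// EFinM; apply: lee_wpmul2l; first by rewrite lee_fin.
exact: ball_divergence_le.
Qed.

Lemma measurable_compact_row (K : set 'rV[R]_n) : compact K -> measurable K.
Proof.
move=> cK; rewrite -[K]setCK; apply: measurableC; apply: open_measurable_row.
by apply: closed_openC; apply: compact_closed => //; exact: norm_hausdorff.
Qed.

(** The constant makes the integral of the p-th power equal to 1. *)
Definition ball_minimizer (x : 'rV[R]_n) : R := om `^ (- alpha) * \1_B x.

Let c0 : 0 < om `^ (- alpha). Proof. by rewrite powR_gt0. Qed.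

Let muB : mu B = om%:E.
Proof. by rewrite measure_eclosed// expr1n mul1r. Qed.

Lemma ball_minimizer_integrable : integrable_fun ball_minimizer.
Proof.
apply: integrable_funZ; apply: integrable_fun_indic => //.
by rewrite muB ltry.
Qed.

Lemma ball_minimizer_admissible : admissible ball_minimizer.
Proof.
have [mu0 iu0] := ball_minimizer_integrable.
split; [split|].
- exact: mu0.
- by move=> K cK; apply: integrableS iu0 => //; exact: measurable_compact_row.
- move=> e e0; apply: (@le_lt_trans _ _ (mu B)); last by rewrite muB ltry.
  apply: le_measure; rewrite ?inE//; first exact: measurable_level.
  move=> x /= ex; apply: contrapT => xB; move: ex.
  by rewrite /ball_minimizer indicE memNset// mulr0 normr0 ltNge (ltW e0).
- by apply: le_lt_trans (bv_seminorm_ball (ltW c0)) _; rewrite ltry.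
have p0 : one_star R n != 0 by rewrite /one_star mulf_neq0 ?invr_eq0 ?subr_eq0 ?gt_eqF.
have nn : n%:R - 1 != 0 :> R by rewrite subr_eq0 gt_eqF.
rewrite (_ : (fun x => _) = (fun x => (om^-1)%:E * (\1_B x)%:E)%E); last first.
  apply/funext => x; rewrite -EFinM; congr EFin.
  rewrite /ball_minimizer indicE; case: (x \in B); last by rewrite !mulr0 normr0 powR0.
  rewrite !mulr1 gtr0_norm// -powRrM -[RHS]powR_inv1 ?(ltW om0)//; congr (_ `^ _).
  by rewrite /one_star; field; rewrite nn gt_eqF.
rewrite ge0_integralZl_EFin ?invr_ge0 ?(ltW om0)//; last first.
  by apply/measurable_EFinP; exact: measurable_indic.
by rewrite integral_indic// setIT [X in (_ * X)%E]muB -EFinM mulVf// gt_eqF.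
Qed.

Lemma ball_minimizer_energy (lam : R) : 0 < lam ->
  (hardy_energy lam ball_minimizer <=
   ((@isoperimetric_constant R n) * (1 - lam / (n%:R - 1)))%:E)%E.
Proof.
move=> lam0; rewrite /hardy_energy.
have nn : n%:R - 1 != 0 :> R by rewrite subr_eq0 gt_eqF.
have cS : om `^ (- alpha) * (n%:R * om) = @isoperimetric_constant R n.
  rewrite /isoperimetric_constant mulrCA; congr (_ * _).
  rewrite -[X in _ * X]powRr1 ?(ltW om0)// -powRD; last by rewrite (gt_eqF om0) implybT.
  by congr (_ `^ _); field; rewrite gt_eqF.
have H : ((om `^ (- alpha) * (om * (n%:R / (n%:R - 1))))%:E <=
    \int[mu]_x (`|ball_minimizer x| / enorm x)%:E)%E.
  rewrite (_ : (fun x => _) = (fun x => (om `^ (- alpha))%:E * ((enorm x)^-1 * \1_B x)%:E)%E); last first.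
    apply/funext => x; rewrite -EFinM /ball_minimizer normrM (gtr0_norm c0) ger0_norm//.
    by congr EFin; ring.
  rewrite ge0_integralZl_EFin ?(ltW c0)//; last 2 first.
  - by move=> x _; rewrite lee_fin mulr_ge0// invr_ge0 enorm_ge0.
  - apply/measurable_EFinP; apply: measurable_funM; first exact: measurable_inv_enorm.
    exact: measurable_indic.
  rewrite EFinM; apply: lee_wpmul2l; first by rewrite lee_fin ltW.
  apply: le_trans (integral_inv_enorm_ball n2) _.
  rewrite [leLHS]integral_mkcond le_eqVlt; apply/orP; left; apply/eqP.
  apply: eq_integral => x _.
  by rewrite /patch indicE; case: (_ \in _); rewrite ?mulr1 ?mulr0.
apply: (@le_trans _ _ ((om `^ (- alpha) * (n%:R * om))%:E -
    lam%:E * (om `^ (- alpha) * (om * (n%:R / (n%:R - 1))))%:E)%E).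
  apply: leeB; first exact: bv_seminorm_ball (ltW c0).
  by apply: lee_wpmul2l => //; rewrite lee_fin ltW.
rewrite -EFinM -EFinB lee_fin -cS le_eqVlt; apply/orP; left; apply/eqP.
by field.
Qed.

End ball_minimizer.

(** * The lower bound of the energy *)

Section lower_bound.
Context {R : realType} {n : nat}.
Hypothesis n2 : (2 <= n)%N.
Local Notation mu := (lebesgue_row R n).
Local Notation om := (ball_volume R n).
Local Notation S := (@isoperimetric_constant R n).

Let n0 : 0 < n%:R :> R. Proof. by rewrite ltr0n (leq_trans _ n2). Qed.
Let n1 : 1 < n%:R :> R. Proof. by rewrite ltr1n. Qed.

(** Where |w| > t, |w| is at most t^(1 - p) |w|^p. *)
Lemma integrable_excess (w : 'rV[R]_n -> R) (p t : R) : measurable_fun setT w -> 1 <= p ->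
  (\int[mu]_x (`|w x| `^ p)%:E < +oo)%E -> 0 < t -> integrable_fun (excess t w).
Proof.
move=> mw p1 wp t0.
have maw : measurable_fun setT (fun x => `|w x|) by exact: measurableT_comp.
have mp : measurable_fun setT (fun x => `|w x| `^ p).
  exact: measurableT_comp (measurable_powR p) maw.
have ip : mu.-integrable setT (fun x => (`|w x| `^ p)%:E).
  apply/integrableP; split; first exact/measurable_EFinP.
  by under eq_integral do rewrite gee0_abs ?lee_fin ?powR_ge0//.
have me : measurable_fun setT (excess t w).
  by apply: measurable_funB => //; apply: measurable_maxr => //; exact: measurable_minr.
split=> //; apply: le_integrable (integrableZl measurableT (t `^ (1 - p)) ip) => //.
  exact/measurable_EFinP.
move=> x _; rewrite -EFinM lee_fin (excess_norm _ _ (ltW t0)) (@ger0_norm _ (_ * _)); last first.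
  by rewrite mulr_ge0 ?powR_ge0.
rewrite ge_max mulr_ge0 ?powR_ge0//=.
have [wt|wt] := leP `|w x| t.
  by rewrite (@le_trans _ _ 0) ?subr_le0// mulr_ge0 ?powR_ge0.
have w0 : 0 < `|w x| by exact: lt_trans wt.
apply: (@le_trans _ _ `|w x|); first by rewrite gerBl ltW.
have -> : t `^ (1 - p) = (t `^ (p - 1))^-1 by rewrite -powRN opprB.
rewrite ler_pdivlMl ?powR_gt0//.
rewrite (_ : `|w x| `^ p = `|w x| `^ (p - 1) * `|w x|); last first.
  by rewrite -{3}[`|w x|]powRr1// -powRD ?subrK// (gt_eqF w0) implybT.
rewrite ler_wpM2r//; apply: ge0_ler_powR; rewrite ?nnegrE ?subr_ge0// ?(ltW t0)//.
exact: ltW.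
Qed.

(** The total variation is finite, hence so is the level integral, and the three sharp
    inequalities combine; lam < n - 1 makes the coefficient of the level integral positive. *)
Lemma hardy_energy_ge (lam : R) (w : 'rV[R]_n -> R) : 0 < lam -> lam < n%:R - 1 ->
  admissible w -> ((S * (1 - lam / (n%:R - 1)))%:E <= hardy_energy lam w)%E.
Proof.
move=> lam0 laml [[mw _ _ bvw] w1]; rewrite /hardy_energy.
have n10 : 0 < n%:R - 1 :> R by rewrite subr_gt0.
have S0 : 0 < S by exact: isoperimetric_constant_gt0.
have p1 : 1 <= one_star R n.
  by rewrite /one_star ler_pdivlMr// mul1r gerBl.
have wfin : (\int[mu]_x (`|w x| `^ one_star R n)%:E < +oo)%E by rewrite w1 ltry.
have K := isoperimetric_bv n2 mw (fun t t0 => integrable_excess mw p1 wfin t0).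
have H := hardy_level n2 mw.
have L1 := level_integral_ge1 n2 mw w1.
have Lfin : level_integral w \is a fin_num.
  rewrite ge0_fin_numE; last exact: le_trans L1.
  rewrite ltNge leye_eq; apply/negP => /eqP Loo; move: K.
  by rewrite Loo gt0_muley ?lte_fin// leye_eq => /eqP bvoo; rewrite bvoo ltxx in bvw.
have HS : om `^ n%:R^-1 * (n%:R / (n%:R - 1)) = S / (n%:R - 1).
  by rewrite /isoperimetric_constant; ring.
rewrite HS in H.
apply: (@le_trans _ _ (S%:E * level_integral w - lam%:E * ((S / (n%:R - 1))%:E * level_integral w))%E).
  rewrite -(fineK Lfin) -!EFinM -EFinB lee_fin.
  have -> : S * fine (level_integral w) - lam * (S / (n%:R - 1) * fine (level_integral w)) =
    S * (1 - lam / (n%:R - 1)) * fine (level_integral w) by ring.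
  rewrite ler_peMr//; last by rewrite -lee_fin fineK.
  by rewrite mulr_ge0 ?(ltW S0)// subr_ge0 ler_pdivrMr// mul1r ltW.
by apply: leeB => //; apply: lee_wpmul2l => //; rewrite lee_fin ltW.
Qed.

End lower_bound.

Unset Implicit Arguments.

Theorem theorem5p2 (R : realType) (N : nat) (lam : R) (hN : (2 <= N)%N)
    (lam_gt0 : 0 < lam) (lam_lt : lam < N%:R - 1) :
  exists u : 'rV[R]_N -> R, admissible u /\
    hardy_energy lam u =
      ereal_inf [set hardy_energy lam w | w in @admissible R N].
Proof.
have adm := @ball_minimizer_admissible R N hN.
exists ball_minimizer; split => //.
apply/eqP; rewrite eq_le; apply/andP; split.
  apply: le_ereal_inf_tmp => _ [w aw <-].
  apply: le_trans (ball_minimizer_energy hN lam_gt0) _.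
  exact: hardy_energy_ge.
by apply: ereal_inf_lbound; exists ball_minimizer.
Qed.
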